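(* Let $q$ be a prime power, and fix constants $\gamma_1,\gamma_2\in(0,1)$ and $c\ge 1$. Put $$\beta:=\min\left\{\frac{\gamma_1}{4},\frac{1-\gamma_2}{8}\right\}>0.$$ Then for every $\varepsilon>0$ and every $D>0$ there is a quantity $N(\varepsilon,D,c,\gamma_1,\gamma_2)$ such that the following holds for all $n\ge N(\varepsilon,D,c,\gamma_1,\gamma_2)$: for every $[n,k]_q$ linear code $\mathcal{C}$ with dual distance $d^\perp\ge 5$ and every positive integer $p$ with $c^{-1}n^{\gamma_1}\le p\le c\,n^{\gamma_2}$, if $\mu_n$ denotes the spectral measure of the random matrix $M_{\mathcal{C}}$ (defined in the context) obtained by choosing $p$ distinct codewords of $\mathcal{C}$ uniformly at random, then $$\sup_{\mathcal{I}}\ \mathbb{P}\left[\,|\mu_n(\mathcal{I})-\varrho_{\mathrm{SC}}(\mathcal{I})|>n^{-\beta+\varepsilon}\,\right]\le n^{-D},$$ where the supremum is over all intervals $\mathcal{I}\subset\mathbb{R}$.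
   Context: An $[n,k]_q$ code is a $k$-dimensional linear subspace $\mathcal{C}\subset\mathbb{F}_q^n$. Its dual is $\mathcal{C}^\perp=\{\mathbf{a}\in\mathbb{F}_q^n:\mathbf{a}\cdot\mathbf{c}=0\ \forall \mathbf{c}\in\mathcal{C}\}$, and its dual distance $d^\perp$ is the minimum Hamming weight of a nonzero element of $\mathcal{C}^\perp$; thus $d^\perp\ge5$ means every nonzero element of $\mathcal{C}^\perp$ has Hamming weight at least $5$. The standard additive character of $\mathbb{F}_q$ is $\psi(a)=\zeta^{\mathrm{Tr}(a)}$, where $\mathrm{Tr}$ is the absolute trace from $\mathbb{F}_q$ to its prime subfield $\mathbb{F}_r$ and $\zeta=\exp(2\pi\sqrt{-1}/r)$. It is extended component-wise to $\psi:\mathbb{F}_q^n\to(\mathbb{C}^* )^n$. Random matrix: choose $p$ distinct codewords from $\mathcal{C}$ (uniformly among all such choices), apply $\psi$ to each, and let these be the rows of the $p\times n$ matrix $\Phi_{\mathcal{C}}$. Put $\mathcal{G}_{\mathcal{C}}=\frac1{n}\Phi_{\mathcal{C}}\Phi_{\mathcal{C}}^*$ ($^*$ is conjugate transpose) and $M_{\mathcal{C}}=\sqrt{n/p}\,(\mathcal{G}_{\mathcal{C}}-I_{p})$. $\mathbb{P}$ is the probability for this random choice. The spectral measure of an $m\times m$ matrix with eigenvalues $\lambda_1,\dots,\lambda_m$ is $\frac1m\sum_{j=1}^m\delta_{\lambda_j}$, with $\delta_\lambda$ the Dirac measure at $\lambda$. $\varrho_{\mathrm{SC}}$ is the semicircle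 law, the probability measure on $\mathbb{R}$ with density $\frac1{2\pi}\sqrt{4-x^2}\,\mathbf{1}_{[-2,2]}(x)$. *)

(* Defs.v *)
From HB Require Import structures.
From mathcomp Require Import all_boot all_order all_algebra all_field.
From mathcomp Require Import spectral sesquilinear.
From mathcomp Require Import complex.
From mathcomp Require Import all_classical all_reals all_analysis.

Set Implicit Arguments.
Unset Strict Implicit.
Unset Printing Implicit Defensive.

Import Order.TTheory GRing.Theory Num.Theory.
Import numFieldNormedType.Exports.

Local Open Scope classical_set_scope.
Local Open Scope ring_scope.
Local Open Scope complex_scope.
Local Open Scope sesquilinear_scope.

(* A linear code of length n over F is a subspace C : {vspace 'rV[F]_n};
   F ranges over finFieldType, whose cardinals are the prime powers q. *)

Definition hamming_weight (F : finFieldType) (n : nat) (a : 'rV[F]_n) : nat :=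
  #|[set i : 'I_n | a 0 i != 0]%SET|.

Definition dual_code (F : finFieldType) (n : nat) (C : {vspace 'rV[F]_n}) :
    set 'rV[F]_n :=
  [set a | forall c, c \in C -> \sum_(i < n) a 0 i * c 0 i = 0].

(* The zero dual code satisfies the bound for every d: its minimum distance is
   taken to be infinite. *)
Definition dual_distance_ge (F : finFieldType) (n : nat)
    (C : {vspace 'rV[F]_n}) (d : nat) : Prop :=
  forall a, dual_code C a -> a != 0 -> (d <= hamming_weight a)%N.

Definition char_of (F : finFieldType) : nat := s2val (finPcharP F).

Definition char_ofP (F : finFieldType) : char_of F \in [pchar F] :=
  s2valP' (finPcharP F).

(* [pPrimeCharType (char_ofP F)] is F regarded as an extension of its prime
   field, which appears there as the subspace 1. *)
Definition abs_trace (F : finFieldType) (a : F) : F :=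
  galTrace 1%VS {: pPrimeCharType (char_ofP F)}%VS a.

(* The residue modulo r representing Tr(a), where r is the characteristic;
   [None] never occurs, see [abs_trace_natE]. *)
Definition abs_trace_nat (F : finFieldType) (a : F) : nat :=
  if [pick j : 'I_(char_of F) | (j : nat)%:R == abs_trace a] is Some j
  then j else 0%N.

Definition zeta (R : realType) (r : nat) : R[i] :=
  cos (2 * pi / r%:R) +i* sin (2 * pi / r%:R).

Definition std_char (R : realType) (F : finFieldType) (a : F) : R[i] :=
  zeta R (char_of F) ^+ abs_trace_nat a.

(* The sample space: ordered choices of p distinct codewords. *)
Definition codeword_choices (F : finFieldType) (n : nat)
    (C : {vspace 'rV[F]_n}) (p : nat) : {set {ffun 'I_p -> 'rV[F]_n}} :=
  [set w : {ffun 'I_p -> 'rV[F]_n} | injectiveb w & [forall i, w i \in C]].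

(* The uniform probability on the sample space.  It is 0 / 0 = 0 if C has fewer
   than p elements. *)
Definition Pr_choice (R : realType) (F : finFieldType) (n : nat)
    (C : {vspace 'rV[F]_n}) (p : nat) (E : pred {ffun 'I_p -> 'rV[F]_n}) : R :=
  #|[set w in codeword_choices C p | E w]%SET|%:R / #|codeword_choices C p|%:R.

Definition Phi_mx (R : realType) (F : finFieldType) (n p : nat)
    (w : {ffun 'I_p -> 'rV[F]_n}) : 'M[R[i]]_(p, n) :=
  \matrix_(i < p, j < n) std_char R (w i 0 j).

Definition Gram_mx (R : realType) (F : finFieldType) (n p : nat)
    (w : {ffun 'I_p -> 'rV[F]_n}) : 'M[R[i]]_p :=
  n%:R^-1 *: (Phi_mx R w *m (Phi_mx R w)^t*).

Definition M_mx (R : realType) (F : finFieldType) (n p : nat)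
    (w : {ffun 'I_p -> 'rV[F]_n}) : 'M[R[i]]_p :=
  (Num.sqrt (n%:R / p%:R : R))%:C *: (Gram_mx R w - 1%:M).

(* The eigenvalues, listed with algebraic multiplicity. *)
Definition eigenvalues (R : realType) (m : nat) (A : 'M[R[i]]_m) : seq R[i] :=
  sval (closed_field_poly_normal (char_poly A)).

(* The real part is there only to view an eigenvalue as a real number; for
   M_mx all eigenvalues are real, see [M_mx_eigenvalues_real]. *)
Definition spectral_measure (R : realType) (m : nat) (A : 'M[R[i]]_m)
    (I : set R) : \bar R :=
  ((m%:R^-1)%:E * \sum_(z <- eigenvalues A) \d_(complex.Re z) I)%E.

Definition semicircle_density (R : realType) (x : R) : R :=
  (2 * pi)^-1 * Num.sqrt (4 - x ^+ 2) * \1_(`[-2, 2]) x.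

Definition semicircle (R : realType) (I : set R) : \bar R :=
  (\int[lebesgue_measure]_(x in I) (semicircle_density x)%:E)%E.

Lemma abs_trace_natE (F : finFieldType) (a : F) :
  (abs_trace_nat a)%:R = abs_trace a.
Proof.
have pr := pcharf_prime (char_ofP F).
have : galTrace 1%VS {: pPrimeCharType (char_ofP F)}%VS a \in 1%VS.
  apply: mem_galTrace; last exact: memvf.
  exact: (@finField_galois _ _ 1%AS {: pPrimeCharType (char_ofP F)}%AS (sub1v _)).
rewrite /abs_trace_nat; case: pickP => [j /eqP //|no /vlineP[k ek]].
have kr : (k < char_of F)%N by rewrite -[X in (_ < X)%N](Fp_cast pr) ltn_ord.
have := no (Ordinal kr); rewrite /= /abs_trace ek => /eqP[].
exact/esym/mulr1.
Qed.

Lemma M_mx_herm (R : realType) (F : finFieldType) (n p : nat)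
    (w : {ffun 'I_p -> 'rV[F]_n}) : (M_mx R w)^t* = M_mx R w.
Proof.
have sqC (x : R) : Num.conj (x%:C) = x%:C.
  by apply/eqP; rewrite eq_complex /= oppr0 !eqxx.
rewrite /M_mx /Gram_mx; apply/matrixP => i j; rewrite !mxE.
rewrite rmorphM /= sqC rmorphB rmorphM /= fmorphV !rmorph_nat eq_sym.
congr (_ * (_ * _ - _)).
rewrite rmorph_sum; apply: eq_bigr => l _.
by rewrite !mxE rmorphM /= conjCK mulrC.
Qed.

Lemma eigenvaluesE (R : realType) (m : nat) (A : 'M[R[i]]_m) :
  char_poly A = \prod_(z <- eigenvalues A) ('X - z%:P).
Proof.
rewrite /eigenvalues; case: closed_field_poly_normal => s /= {1}->.
by rewrite (monicP (char_poly_monic A)) scale1r.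
Qed.

Lemma M_mx_eigenvalues_real (R : realType) (F : finFieldType) (n p : nat)
    (w : {ffun 'I_p -> 'rV[F]_n}) (z : R[i]) :
  z \in eigenvalues (M_mx R w) -> complex.Im z = 0.
Proof.
rewrite -root_prod_XsubC -eigenvaluesE -eigenvalue_root_char.
move=> /eigenvalueP[v vA v0].
have vv0 : (v *m v^t*) 0 0 != 0.
  by apply: lt0r_neq0; rewrite -dotmxE dotmx_is_dotmx.
have : z *: (v *m v^t*) = z^* *: (v *m v^t*).
  rewrite scalemxAl -vA -[in LHS](M_mx_herm R w).
  by rewrite -mulmxA -map_mxM -trmx_mul vA linearZ /= map_mxZ scalemxAr.
move=> /matrixP/(_ 0 0); rewrite [LHS]mxE [RHS]mxE => /(mulIf vv0).
by case: z {vA} => a b [] /esym/eqP; rewrite eqNr => /eqP.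
Qed.

(* Main.v *)
(* Draw the rows independently first: as the dual distance is at least 5, four
   coordinates of a random codeword are independent and uniform, so a row of
   [Phi] has the first four moments of a vector of independent entries.  The
   variance bound for quadratic forms and the Schur complement formula then show
   that the expected Stieltjes transform [f] satisfies
   [f * (z + f) ^+ 2 = - (z + f) + r] with [r] small as long as [Im z] exceeds a
   constant times [max (p ^ (-1/4), (p/n) ^ (1/8))].  Writing [z = u + i y] this
   gives [|Im f - sqrt (4 - u^2) / 2| = O (y / sqrt (4 - u^2))] inside [-2, 2],
   an error that is integrable up to the edges; no information outside [-2, 2] is
   needed, since the semicircle already carries the whole mass.

   [Im f] is the expected spectral measure smoothed by a Poisson kernel.  The
   kernel [2 P_y - P_(2y)] is positive and its distribution function approaches a
   step like [O (y^2 / x^2)], that is like [y P_y], whose integral is again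
   [y Im f].  Hence undoing the smoothing costs only [O (y)], uniformly over
   intervals.

   Changing one row moves the proportion of eigenvalues in an interval by at most
   [2 / p] (interlacing), so it concentrates around its mean at scale
   [p ^ (-1/2)].  Finally independent codewords are distinct with probability at
   least 1/2, because the code has at least [(n - 1)^2 / 2] elements. *)
Require Import Defs.
From HB Require Import structures.
From mathcomp Require Import all_boot all_order all_algebra all_fingroup all_field.
From mathcomp Require Import spectral sesquilinear.
From mathcomp Require Import complex.
From mathcomp Require Import ring lra.
From mathcomp Require Import all_classical all_reals all_analysis.
From mathcomp Require Import measurable_realfun.

Set Implicit Arguments.
Unset Strict Implicit.
Unset Printing Implicit Defensive.

Import Order.TTheory GRing.Theory Num.Theory.
Import numFieldNormedType.Exports.

Local Open Scope classical_set_scope.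
Local Open Scope ring_scope.
Local Open Scope complex_scope.
Local Open Scope sesquilinear_scope.

(** * Moduli of complex numbers and averages over finite types *)

(** The randomness is finite, so every expectation is a normalised sum [mean], and independence is
    expressed by resampling one coordinate of [{ffun 'I_p -> T}]. Fluctuations are treated on the
    eigenvalue counts themselves, one interval at a time, so only the mean of the Stieltjes
    transform has to be controlled and no union bound over spectral parameters arises. The cubic
    form of the equation comes from expanding each diagonal entry [- 1 / (z + s)] to second order
    around [- 1 / (z + f)]. The linear error then enters through its mean alone, of order
    [(1/p + kap) / y] with [kap = sqrt (p/n)], and the fluctuation through its square times [1/y],
    which gives [(1/p + kap^2) / y^3]. A first-order expansion would leave the standard deviation
    instead of its square. Asking for an error below a multiple of [y] leads to the condition that
    [y^4] dominate [1/p] and [kap]; the bounds on [p] turn it into the exponents [gamma1 / 4] and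
    [(1 - gamma2) / 8]. *)

Definition cabs (R : realType) (z : R[i]) : R :=
  Num.sqrt (complex.Re z ^+ 2 + complex.Im z ^+ 2).

Section Modulus.
Variable R : realType.
Implicit Types (z u v : R[i]) (a : R).

Lemma cabsE z : `|z| = (cabs z)%:C.
Proof. exact: normc_def. Qed.

Lemma cabs_ge0 z : 0 <= cabs z.
Proof. exact: sqrtr_ge0. Qed.

Lemma sqr_cabs z : cabs z ^+ 2 = complex.Re z ^+ 2 + complex.Im z ^+ 2.
Proof. by rewrite sqr_sqrtr // addr_ge0 ?sqr_ge0. Qed.

Lemma cabsM u v : cabs (u * v) = cabs u * cabs v.
Proof. by apply: complexI; rewrite -cabsE normrM !cabsE rmorphM. Qed.

Lemma cabsD u v : cabs (u + v) <= cabs u + cabs v.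
Proof. by rewrite -lecR -cabsE rmorphD /= -!cabsE ler_normD. Qed.

Lemma cabsN z : cabs (- z) = cabs z.
Proof. by apply: complexI; rewrite -!cabsE normrN. Qed.

Lemma cabsB u v : cabs (u - v) <= cabs u + cabs v.
Proof. by rewrite -(cabsN v) cabsD. Qed.

Lemma cabsV z : cabs z^-1 = (cabs z)^-1.
Proof. by apply: complexI; rewrite -cabsE normfV cabsE fmorphV. Qed.

Lemma cabs_conj z : cabs (z^*)%R = cabs z.
Proof. by apply: complexI; rewrite -!cabsE norm_conjC. Qed.

Lemma cabs_real a : cabs a%:C = `|a|.
Proof. by rewrite /cabs /= expr0n addr0 sqrtr_sqr. Qed.

Lemma cabs_nat n : cabs (n%:R : R[i]) = n%:R.
Proof. by rewrite -(rmorph_nat (real_complex R)) cabs_real ger0_norm. Qed.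

Lemma cabs0 : cabs (0 : R[i]) = 0.
Proof. by rewrite (cabs_nat 0). Qed.

Lemma cabs1 : cabs (1 : R[i]) = 1.
Proof. by rewrite (cabs_nat 1). Qed.

Lemma cabs_eq0 z : (cabs z == 0) = (z == 0).
Proof. by rewrite -(inj_eq (@complexI R)) -cabsE normr_eq0. Qed.

Lemma cabsX z n : cabs (z ^+ n) = cabs z ^+ n.
Proof. by elim: n => [|n IH]; rewrite ?expr0 ?cabs1 // !exprS cabsM IH. Qed.

Lemma cabs_sum (I : Type) (r : seq I) (P : pred I) (F : I -> R[i]) :
  cabs (\sum_(i <- r | P i) F i) <= \sum_(i <- r | P i) cabs (F i).
Proof.
elim/big_rec2: _ => [|i y x _ h]; first by rewrite cabs0.
exact: le_trans (cabsD _ _) (lerD _ h).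
Qed.

Lemma normRe_cabs z : `|complex.Re z| <= cabs z.
Proof. by rewrite -sqrtr_sqr ler_wsqrtr // lerDl sqr_ge0. Qed.

Lemma normIm_cabs z : `|complex.Im z| <= cabs z.
Proof. by rewrite -sqrtr_sqr ler_wsqrtr // lerDr sqr_ge0. Qed.

Lemma Im_le_cabs z : complex.Im z <= cabs z.
Proof. exact: le_trans (ler_norm _) (normIm_cabs z). Qed.

Lemma mul_conj_cabs z : z * (z^*)%R = (cabs z ^+ 2)%:C.
Proof. by rewrite -normCK cabsE rmorphXn. Qed.

Lemma sqr_cabsD u v : cabs (u + v) ^+ 2 <= 2 * (cabs u ^+ 2 + cabs v ^+ 2).
Proof.
rewrite !sqr_cabs !raddfD /= -subr_ge0.
rewrite (_ : _ - _ = (complex.Re u - complex.Re v) ^+ 2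
                   + (complex.Im u - complex.Im v) ^+ 2); last by ring.
by rewrite addr_ge0 ?sqr_ge0.
Qed.

End Modulus.

Definition mean (K : fieldType) (J : finType) (X : J -> K) : K :=
  (\sum_j X j) / #|J|%:R.

Section Mean.
Variables (K : numFieldType) (J : finType).
Implicit Types X Y : J -> K.

Lemma eq_mean X Y : X =1 Y -> mean X = mean Y.
Proof. by move=> h; rewrite /mean (eq_bigr _ (fun j _ => h j)). Qed.

Lemma meanD X Y : mean (fun j => X j + Y j) = mean X + mean Y.
Proof. by rewrite /mean big_split mulrDl. Qed.

Lemma meanZ (a : K) X : mean (fun j => a * X j) = a * mean X.
Proof. by rewrite /mean -mulr_sumr mulrA. Qed.

Lemma meanN X : mean (fun j => - X j) = - mean X.
Proof. by rewrite /mean sumrN mulNr. Qed.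

Lemma meanB X Y : mean (fun j => X j - Y j) = mean X - mean Y.
Proof. by rewrite meanD meanN. Qed.

Lemma mean_sum (I : Type) (r : seq I) (P : pred I) (F : I -> J -> K) :
  mean (fun j => \sum_(i <- r | P i) F i j) = \sum_(i <- r | P i) mean (F i).
Proof. by rewrite /mean exchange_big mulr_suml. Qed.

Lemma mean_ge0 X : (forall j, 0 <= X j) -> 0 <= mean X.
Proof. by move=> h; rewrite divr_ge0 ?sumr_ge0. Qed.

Lemma ler_mean X Y : (forall j, X j <= Y j) -> mean X <= mean Y.
Proof. by move=> h; rewrite ler_wpM2r ?invr_ge0 ?ler_sum. Qed.

Hypothesis J_gt0 : (0 < #|J|)%N.

Lemma mean_cst (a : K) : mean (fun _ : J => a) = a.
Proof.
by rewrite /mean sumr_const -[a *+ _]mulr_natr mulfK // pnatr_eq0 -lt0n.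
Qed.

End Mean.

Section ComplexMean.
Variables (R : realType) (J : finType).
Implicit Types X : J -> R[i].

Lemma cabs_mean X : cabs (mean X) <= mean (fun j => cabs (X j)).
Proof.
by rewrite /mean cabsM cabsV cabs_nat ler_wpM2r ?invr_ge0 ?cabs_sum.
Qed.

Lemma Re_mean X : complex.Re (mean X) = mean (fun j => complex.Re (X j)).
Proof.
rewrite /mean -(rmorph_nat (real_complex R)) -fmorphV mulrC.
rewrite (_ : complex.Re _ = #|J|%:R^-1 * complex.Re (\sum_j X j)); last first.
  by case: (\sum_j X j) => a b /=; rewrite mul0r subr0.
by rewrite raddf_sum mulrC.
Qed.

Lemma Im_mean X : complex.Im (mean X) = mean (fun j => complex.Im (X j)).
Proof.
rewrite /mean -(rmorph_nat (real_complex R)) -fmorphV mulrC.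
rewrite (_ : complex.Im _ = #|J|%:R^-1 * complex.Im (\sum_j X j)); last first.
  by case: (\sum_j X j) => a b /=; rewrite mul0r addr0.
by rewrite raddf_sum mulrC.
Qed.

Lemma mean_real (X : J -> R) : mean (fun j => (X j)%:C) = (mean X)%:C.
Proof. by rewrite /mean rmorphM fmorphV /= rmorph_nat rmorph_sum. Qed.

Hypothesis J_gt0 : (0 < #|J|)%N.

Lemma mean_sqr_cabs X :
  mean (fun j => cabs (X j) ^+ 2) =
  cabs (mean X) ^+ 2 + mean (fun j => cabs (X j - mean X) ^+ 2).
Proof.
set m := mean X.
rewrite (@eq_mean _ _ _ (fun j => (cabs (X j - m) ^+ 2 +
   (2 * complex.Re m) * (complex.Re (X j) - complex.Re m)) +
   ((2 * complex.Im m) * (complex.Im (X j) - complex.Im m) + cabs m ^+ 2)));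
  last by move=> j; rewrite !sqr_cabs !raddfB /=; ring.
rewrite !meanD !meanZ !meanB !mean_cst // -Re_mean -Im_mean -/m.
by rewrite !subrr !mulr0 addr0 add0r addrC.
Qed.

End ComplexMean.

(** * Concentration of functions with bounded differences *)

Section Resampling.
Variables (I T : finType) (K : numFieldType).
Implicit Types (w : {ffun I -> T}) (X : {ffun I -> T} -> K).

Definition upd w i t : {ffun I -> T} := [ffun j => if j == i then t else w j].

Definition resample i X w : K := mean (fun t => X (upd w i t)).

Lemma upd_upd w i t s : upd (upd w i t) i s = upd w i s.
Proof. by apply/ffunP => j; rewrite !ffunE; case: eqP. Qed.

Lemma upd_swap w i j t s : i != j -> upd (upd w i t) j s = upd (upd w j s) i t.
Proof.
move=> ij; apply/ffunP => l; rewrite !ffunE.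
by case: (eqVneq l j) => [->|//]; rewrite eq_sym (negbTE ij).
Qed.

Lemma upd_id w i : upd w i (w i) = w.
Proof. by apply/ffunP => j; rewrite ffunE; case: eqP => [->|]. Qed.

Hypothesis T_gt0 : (0 < #|T|)%N.

Lemma mean_resample i X : mean (resample i X) = mean X.
Proof.
rewrite /resample /mean -mulr_suml; congr (_ / _).
rewrite pair_big /=.
(* Exchanging coordinate [i] with the fresh value is an involution of the product space; after this
   change of variables the summand no longer sees the fresh value. *)
pose f (a : {ffun I -> T} * T) := (upd a.1 i a.2, a.1 i).
have fK : involutive f by move=> [w t]; rewrite /f /= upd_upd upd_id ffunE eqxx.
rewrite (reindex_inj (inv_inj fK)) /=.
under eq_bigr => a _ do rewrite upd_upd upd_id.
rewrite -(pair_big xpredT xpredT (fun w (_ : T) => X w)) /=.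
under eq_bigr => w _ do rewrite sumr_const -[X w *+ _]mulr_natr.
by rewrite -mulr_suml mulfK // pnatr_eq0 -lt0n.
Qed.

Definition resamples (s : seq I) X := foldr resample X s.

Lemma mean_resamples s X : mean (resamples s X) = mean X.
Proof. by elim: s => //= i s <-; rewrite mean_resample. Qed.

Lemma resamples_upd s X i w t : i \in s -> resamples s X (upd w i t) = resamples s X w.
Proof.
elim: s w => //= j s IH w; rewrite inE; case: (eqVneq i j) => [<- _|ij /= si].
  by apply: eq_mean => u; rewrite upd_upd.
by apply: eq_mean => u; rewrite upd_swap // IH.
Qed.

Lemma invariant_upd_cst X : (forall i w t, X (upd w i t) = X w) ->
  forall w w', X w = X w'.
Proof.
move=> h w w'.
suff e (s : seq I) : X [ffun i => if i \in s then w' i else w i] = X w.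
  rewrite -(e (enum I)); congr X; apply/ffunP => i.
  by rewrite ffunE mem_enum.
elim: s => [|i s <-]; first by congr X; apply/ffunP => j; rewrite ffunE.
rewrite -(h i [ffun j => if j \in s then w' j else w j] (w' i)); congr X.
apply/ffunP => j; rewrite !ffunE inE.
by case: eqVneq => [->|].
Qed.

(** Once every coordinate has been resampled, no [upd] changes the value, so the function is
    constant; the constant is the mean because resampling preserves means. *)
Lemma resamples_enum X w : resamples (enum I) X w = mean X.
Proof.
rewrite -(mean_resamples (enum I)).
have cst := invariant_upd_cst (fun i w t =>
  resamples_upd X w t (mem_enum I i)).
rewrite (@eq_mean _ _ _ (fun=> resamples (enum I) X w)); last by move=> w'; exact: cst.
by rewrite mean_cst // card_ffun expn_gt0 T_gt0.
Qed.

End Resampling.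

Section BoundedDifferences.
Variables (R : realType) (I T : finType).
Hypothesis T_gt0 : (0 < #|T|)%N.
Let Omega_gt0 : (0 < #|{ffun I -> T}|)%N.
Proof. by rewrite card_ffun expn_gt0 T_gt0. Qed.

Definition bounded_diff (X : {ffun I -> T} -> R[i]) (c : R) :=
  forall w i t, cabs (X (upd w i t) - X w) <= c.

Lemma bounded_diff_resample X c i :
  bounded_diff X c -> bounded_diff (resample i X) c.
Proof.
move=> h w j t; rewrite /resample -meanB.
apply: le_trans (cabs_mean _) _; rewrite -[leRHS](mean_cst T_gt0).
apply: ler_mean => u; have [<-|ij] := eqVneq i j; last first.
  by rewrite -upd_swap ?(h (upd w i u) j t) // eq_sym.
rewrite upd_upd subrr cabs0.
by apply: le_trans (h w i t); rewrite cabs_ge0.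
Qed.

Lemma bounded_diff_resamples X c s :
  bounded_diff X c -> bounded_diff (resamples s X) c.
Proof. by move=> h; elim: s => //= i s; exact: bounded_diff_resample. Qed.

(* Resampling all coordinates one after the other turns [X] into its mean, so a
   functional that loses at most [d] per resampling loses at most [#|I| * d]. *)
Lemma bounded_diff_iter (Psi : ({ffun I -> T} -> R[i]) -> R) (c d : R) X :
  (forall Y i, bounded_diff Y c -> Psi Y <= Psi (resample i Y) + d) ->
  bounded_diff X c -> Psi X <= Psi (fun=> mean X) + #|I|%:R * d.
Proof.
move=> step bX.
have -> : (fun=> mean X) = resamples (enum I) X.
  by apply/funext => w; rewrite resamples_enum.
rewrite cardE; elim: (enum I) => [|i s IH] /=; first by rewrite mul0r addr0.
apply: le_trans IH _; rewrite -natr1 mulrDl mul1r addrA addrAC lerD2r.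
exact/step/bounded_diff_resamples.
Qed.

Lemma cabs_resample_diff X c i w : bounded_diff X c ->
  cabs (X w - resample i X w) <= c.
Proof.
move=> h; rewrite -[X w](mean_cst T_gt0) -meanB.
apply: le_trans (cabs_mean _) _; rewrite -[leRHS](mean_cst T_gt0).
by apply: ler_mean => t; rewrite -cabsN opprB.
Qed.

(** An Efron-Stein bound: the functional is the second moment, of which one resampling loses exactly
    the average of a conditional variance, at most [c ^+ 2]. Splitting the second moment of [X] then
    cancels the squared mean. *)
Lemma bounded_diff_variance X c : 0 <= c -> bounded_diff X c ->
  mean (fun w => cabs (X w - mean X) ^+ 2) <= #|I|%:R * c ^+ 2.
Proof.
move=> c0 bX.
have E := mean_sqr_cabs Omega_gt0 X.
pose Psi (Y : {ffun I -> T} -> R[i]) := mean (fun w => cabs (Y w) ^+ 2).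
have step Y i : bounded_diff Y c -> Psi Y <= Psi (resample i Y) + c ^+ 2.
  move=> bY; rewrite /Psi -(mean_resample T_gt0 i) -[X in _ + X](mean_cst Omega_gt0).
  rewrite -meanD; apply: ler_mean => w.
  have E1 := mean_sqr_cabs T_gt0 (fun t => Y (upd w i t)).
  rewrite {1}/resample E1 {E1} -/(resample i Y w).
  apply: lerD => //; rewrite -[leRHS](mean_cst T_gt0); apply: ler_mean => t.
  rewrite lerXn2r ?nnegrE ?cabs_ge0 //.
  rewrite (_ : resample i Y w = resample i Y (upd w i t)) ?cabs_resample_diff //.
  by apply: eq_mean => u; rewrite upd_upd.
have := bounded_diff_iter step bX.
rewrite /Psi E (mean_cst Omega_gt0); move: (cabs (mean X) ^+ 2) (mean _) => a V.
by rewrite lerD2l.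
Qed.

(** From [expR (- x) >= 1 - x] follows [expR x <= 1 / (1 - x)], and [(1 + x + 2 * x ^+ 2) * (1 - x)
    - 1 = x ^+ 2 * (1 - 2 * x)] is nonnegative for [x <= 1 / 2]. *)
Lemma expR_le_quadratic (x : R) : `|x| <= 1 / 2 -> expR x <= 1 + x + 2 * x ^+ 2.
Proof.
rewrite ler_norml => /andP[x1 x2].
have h := expR_ge1Dx (- x); rewrite expRN in h.
have e0 := expR_gt0 x.
have x3 : 0 < 1 - x by lra.
have : expR x * (1 - x) <= 1.
  by rewrite -[leRHS](mulfV (lt0r_neq0 e0)) ler_pM2l.
rewrite -ler_pdivlMr // => /le_trans; apply.
rewrite ler_pdivrMr //.
rewrite -subr_ge0 (_ : _ - 1 = x ^+ 2 * (1 - 2 * x)); last by ring.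
by rewrite mulr_ge0 ?sqr_ge0 //; lra.
Qed.

Lemma mean_expR_le (Y : T -> R) (c : R) : c <= 1 / 2 ->
  (forall t, `|Y t - mean Y| <= c) ->
  mean (fun t => expR (Y t)) <= expR (mean Y + 2 * c ^+ 2).
Proof.
move=> c1 h; rewrite expRD.
apply: (@le_trans _ _ (mean (fun t => expR (mean Y) *
   (1 + (Y t - mean Y) + 2 * c ^+ 2)))).
  apply: ler_mean => t; rewrite -{1}(subrK (mean Y) (Y t)) expRD mulrC.
  rewrite ler_pM2l ?expR_gt0 //.
  apply: le_trans (expR_le_quadratic (le_trans (h t) c1)) _.
  rewrite lerD2l ler_pM2l // -[leLHS]real_normK ?num_real //.
  by rewrite lerXn2r ?nnegrE ?h //; exact: le_trans (normr_ge0 _) (h t).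
rewrite meanZ ler_pM2l ?expR_gt0 // !meanD meanN !(mean_cst T_gt0) subrr addr0.
exact: expR_ge1Dx.
Qed.

Lemma bounded_diff_mgf (X : {ffun I -> T} -> R) (c l : R) :
  0 < c -> `|l| * c <= 1 / 2 ->
  bounded_diff (fun w => (X w)%:C) c ->
  mean (fun w => expR (l * (X w - mean X))) <= expR (#|I|%:R * (2 * (l * c) ^+ 2)).
Proof.
move=> c0 lc bX.
(* The logarithm turns the loss of a factor at each resampling into the additive loss that
   [bounded_diff_iter] expects. *)
pose Psi (Y : {ffun I -> T} -> R[i]) := ln (mean (fun w => expR (l * complex.Re (Y w)))).
have mpos (Y : {ffun I -> T} -> R) : 0 < mean (fun w => expR (Y w)).
  have /card_gt0P[w _] := Omega_gt0.
  rewrite divr_gt0 ?ltr0n // (bigD1 w) //= ltr_wpDr ?expR_gt0 //.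
  by apply: sumr_ge0 => *; exact: expR_ge0.
have step Y i : bounded_diff Y c -> Psi Y <= Psi (resample i Y) + 2 * (l * c) ^+ 2.
  move=> bY; rewrite /Psi.
  rewrite -ler_expR expRD (lnK (mpos _)) (lnK (mpos _)).
  rewrite -(mean_resample T_gt0 i) mulrC -meanZ; apply: ler_mean => w.
  rewrite -expRD addrC.
  have -> : l * complex.Re (resample i Y w) = mean (fun t => l * complex.Re (Y (upd w i t))).
    by rewrite meanZ -Re_mean.
  have -> : (l * c) ^+ 2 = (`|l| * c) ^+ 2.
    by rewrite !exprMn real_normK ?num_real.
  apply: mean_expR_le => // t; rewrite meanZ -Re_mean -mulrBr normrM ler_wpM2l //.
  rewrite -raddfB; apply: le_trans (normRe_cabs _) _.
  have -> : mean (fun t => Y (upd w i t)) = resample i Y (upd w i t).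
    by apply: eq_mean => u; rewrite upd_upd.
  exact: cabs_resample_diff.
have E : Psi (fun=> mean (fun w => (X w)%:C)) = l * mean X.
  by rewrite /Psi mean_real (mean_cst Omega_gt0) expRK.
have H := bounded_diff_iter step bX; rewrite E in H; move: H; rewrite /Psi.
rewrite -ler_expR lnK ?posrE ?mpos // expRD => H.
under eq_mean => w do rewrite mulrBr expRD mulrC.
by rewrite meanZ expRN mulrC ler_pdivrMr ?expR_gt0 // mulrC.
Qed.

Lemma mean_ind_gt_le (Z : {ffun I -> T} -> R) (t : R) :
  mean (fun w => ((t < Z w)%R : nat)%:R) <= mean (fun w => expR (Z w)) / expR t.
Proof.
rewrite mulrC -meanZ; apply: ler_mean => w; case: ltP => [h|_] /=.
  by rewrite mulrC ler_pdivlMr ?expR_gt0 // mul1r ler_expR ltW.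
by rewrite mulr_ge0 ?invr_ge0 ?expR_ge0.
Qed.

Lemma mcdiarmid (X : {ffun I -> T} -> R) (c t : R) :
  (0 < #|I|)%N -> 0 < c -> 0 < t <= 2 * #|I|%:R * c ->
  bounded_diff (fun w => (X w)%:C) c ->
  mean (fun w => ((t < `|X w - mean X|)%R : nat)%:R) <=
    2 * expR (- (t ^+ 2 / (8 * #|I|%:R * c ^+ 2))).
Proof.
move=> I0 c0 /andP[t0 t1] bX.
set P : R := #|I|%:R in t1 *.
have P0 : 0 < P by rewrite ltr0n.
(* The minimiser of [- l * t + 2 * P * (l * c) ^+ 2]; the upper bound on [t] is what keeps [l * c]
   at most 1/2. *)
pose l := t / (4 * P * c ^+ 2).
have l0 : 0 < l by rewrite divr_gt0 // !mulr_gt0 // exprn_gt0.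
have lc : l * c = t / (4 * P * c).
  by rewrite /l; field; rewrite !lt0r_neq0.
have lc2 : l * c <= 1 / 2.
  by rewrite lc ler_pdivrMr ?mulr_gt0 //; nra.
have tail (s : R) : `|s| = l ->
    mean (fun w => ((l * t < s * (X w - mean X))%R : nat)%:R) <=
    expR (- (t ^+ 2 / (8 * P * c ^+ 2))).
  move=> sl; apply: le_trans (mean_ind_gt_le _ _) _.
  rewrite ler_pdivrMr ?expR_gt0 // -expRD.
  have H := @bounded_diff_mgf X c s c0 _ bX; apply: le_trans (H _) _; first by rewrite sl.
  rewrite ler_expR -/P exprMn -real_normK ?num_real // sl -exprMn lc /l.
  by rewrite le_eqVlt; apply/orP; left; apply/eqP; field; rewrite !lt0r_neq0.
rewrite mulr_natl mulr2n.
apply: le_trans (lerD (tail l _) (tail (- l) _)); last 2 first.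
- by rewrite gtr0_norm.
- by rewrite normrN gtr0_norm.
rewrite -meanD; apply: ler_mean => w.
rewrite mulNr -mulrN !ltr_pM2l // -natrD ler_nat.
by rewrite real_ltr_normr ?num_real //; case: (_ < _)%R; case: (_ < _)%R.
Qed.

End BoundedDifferences.

(** * Resolvents of Hermitian matrices *)

Section Adjoint.
Variable R : realType.
Local Notation C := R[i].

Lemma adjmxM m n q (A : 'M[C]_(m, n)) (B : 'M[C]_(n, q)) :
  (A *m B)^t* = B^t* *m A^t*.
Proof. by rewrite trmx_mul map_mxM. Qed.

Lemma adjmxB m n (A B : 'M[C]_(m, n)) : (A - B)^t* = A^t* - B^t*.
Proof. by rewrite linearB /= map_mxB. Qed.

Lemma adjmx_scalar n (a : C) : (a%:M : 'M[C]_n)^t* = ((a^*)%R)%:M.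
Proof. by rewrite tr_scalar_mx map_scalar_mx. Qed.

Definition fro2 m n (A : 'M[C]_(m, n)) : R := \sum_i \sum_j cabs (A i j) ^+ 2.

Lemma fro2_ge0 m n (A : 'M[C]_(m, n)) : 0 <= fro2 A.
Proof. by do 2![apply: sumr_ge0 => ? _]; rewrite sqr_ge0. Qed.

Lemma mulmx_adj_diag m n (A : 'M[C]_(m, n)) i :
  (A *m A^t*) i i = (\sum_j cabs (A i j) ^+ 2)%:C.
Proof.
rewrite mxE rmorph_sum; apply: eq_bigr => j _.
by rewrite !mxE mul_conj_cabs.
Qed.

Lemma trace_mulmx_adj m n (A : 'M[C]_(m, n)) : \tr (A *m A^t*) = (fro2 A)%:C.
Proof.
by rewrite /mxtrace rmorph_sum; apply: eq_bigr => i _; rewrite mulmx_adj_diag.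
Qed.

Lemma fro2Z m n (a : C) (A : 'M[C]_(m, n)) : fro2 (a *: A) = cabs a ^+ 2 * fro2 A.
Proof.
rewrite /fro2 mulr_sumr; apply: eq_bigr => i _; rewrite mulr_sumr.
by apply: eq_bigr => j _; rewrite mxE cabsM exprMn.
Qed.

Lemma fro2D m n (A B : 'M[C]_(m, n)) : fro2 (A + B) <= 2 * (fro2 A + fro2 B).
Proof.
rewrite /fro2 -big_split mulr_sumr; apply: ler_sum => i _.
rewrite -big_split mulr_sumr; apply: ler_sum => j _.
by rewrite mxE sqr_cabsD.
Qed.

Lemma fro2_1 n : fro2 (1%:M : 'M[C]_n) = n%:R.
Proof.
apply: complexI; rewrite -trace_mulmx_adj adjmx_scalar conjC1 mulmx1 mxtrace_scalar.
by rewrite rmorph_nat.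
Qed.

Lemma cabs_dot_le m (u : 'M[C]_(1, m)) (v : 'M[C]_(m, 1)) :
  cabs ((u *m v) 0 0) <= (fro2 u + fro2 v) / 2.
Proof.
rewrite mxE; apply: le_trans (cabs_sum _ _ _) _.
rewrite /fro2 big_ord1 [X in _ + X](_ : _ = \sum_j cabs (v j 0) ^+ 2); last first.
  by apply: eq_bigr => j _; rewrite big_ord1.
rewrite -big_split mulr_suml; apply: ler_sum => j _.
rewrite cabsM ler_pdivlMr //= -subr_ge0.
rewrite (_ : _ - _ = (cabs (u 0 j) - cabs (v j 0)) ^+ 2) ?sqr_ge0 //; ring.
Qed.

End Adjoint.

Section Hermitian.
Variables (R : realType) (p : nat) (H : 'M[R[i]]_p).
Hypothesis Hh : H^t* = H.

Lemma herm_spectral : exists (U : 'M[R[i]]_p) (d : 'I_p -> R),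
  U \is unitarymx /\ H = U^t* *m diag_mx (\row_i (d i)%:C) *m U.
Proof.
have hs : H \is hermsymmx.
  by apply/is_hermitianmxP; rewrite expr0 scale1r Hh.
have /orthomx_spectralP HE := hermitian_normalmx hs.
have Dr := hermitian_spectral_diag_real hs.
have Uu := spectral_unitarymx H.
move: (spectralmx H) (spectral_diag H) HE Dr Uu => U D HE /mxOverP Dr Uu.
exists U, (fun i => complex.Re (D 0 i)); split; first exact: Uu.
have -> : \row_i (complex.Re (D 0 i))%:C = D by apply/rowP => i; rewrite mxE RRe_real.
by rewrite [LHS]HE (invmx_unitary Uu).
Qed.

Variable z : R[i].
Hypothesis z_gt0 : 0 < complex.Im z.

Lemma real_sub_neq0 (d : R) : d%:C - z != 0.
Proof.
apply: contraTneq z_gt0 => /(congr1 (@complex.Im R)).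
by rewrite raddfB /= sub0r => /eqP; rewrite oppr_eq0 => /eqP ->; rewrite ltxx.
Qed.

Definition res : 'M[R[i]]_p := invmx (H - z%:M).

Lemma res_spectral (U : 'M[R[i]]_p) (d : 'I_p -> R) :
  U \is unitarymx -> H = U^t* *m diag_mx (\row_i (d i)%:C) *m U ->
  (H - z%:M \in unitmx) *
  (res = U^t* *m diag_mx (\row_i ((d i)%:C - z)^-1) *m U).
Proof.
move=> Uu HE.
have UU : U *m U^t* = 1%:M by exact/unitarymxP.
have UU' : U^t* *m U = 1%:M by exact: mulmx1C.
have e : H - z%:M = U^t* *m diag_mx (\row_i ((d i)%:C - z)) *m U.
  rewrite (_ : diag_mx _ = diag_mx (\row_i (d i)%:C) - z%:M); last first.
    by apply/matrixP => i j; rewrite !mxE; case: eqP => // _; rewrite !mulr0n subr0.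
  by rewrite mulmxBr mulmxBl -HE mul_mx_scalar -scalemxAl UU' scalemx1.
have e2 : (H - z%:M) *m (U^t* *m diag_mx (\row_i ((d i)%:C - z)^-1) *m U) = 1%:M.
  rewrite e -!mulmxA (mulmxA U) UU mul1mx (mulmxA (diag_mx _) (diag_mx _)).
  rewrite (_ : diag_mx _ *m _ = 1%:M) ?mul1mx //.
  apply/matrixP => i j; rewrite mul_diag_mx !mxE.
  case: eqVneq => [->|_]; last by rewrite !mulr0n mulr0.
  by rewrite !mulr1n mulfV // real_sub_neq0.
have [u _] := mulmx1_unit e2; split; first exact: u.
by rewrite /res -[RHS](mulKmx u) e2 mulmx1.
Qed.

Lemma res_unit : H - z%:M \in unitmx.
Proof. by have [U [d [Uu HE]]] := herm_spectral; rewrite (res_spectral Uu HE). Qed.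

Lemma trace_res (U : 'M[R[i]]_p) (d : 'I_p -> R) :
  U \is unitarymx -> H = U^t* *m diag_mx (\row_i (d i)%:C) *m U ->
  \tr res = \sum_i ((d i)%:C - z)^-1.
Proof.
move=> Uu HE; rewrite (res_spectral Uu HE).2 mxtrace_mulC mulmxA.
rewrite (unitarymxP Uu) mul1mx /mxtrace; apply: eq_bigr => i _.
by rewrite !mxE eqxx.
Qed.

Lemma mulVres : res *m (H - z%:M) = 1%:M.
Proof. exact: mulVmx res_unit. Qed.

Lemma mulresV : (H - z%:M) *m res = 1%:M.
Proof. exact: mulmxV res_unit. Qed.

Lemma res_adj_l : res^t* *m (H - ((z^*)%R)%:M) = 1%:M.
Proof.
have -> : H - ((z^*)%R)%:M = (H - z%:M)^t* by rewrite adjmxB Hh adjmx_scalar.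
by rewrite -adjmxM mulresV adjmx_scalar conjC1.
Qed.

Lemma res_adj_r : (H - ((z^*)%R)%:M) *m res^t* = 1%:M.
Proof. exact: mulmx1C res_adj_l. Qed.

Lemma res_diff_l : res - res^t* = (z - (z^*)%R) *: (res^t* *m res).
Proof.
have -> : (z - (z^*)%R) *: (res^t* *m res) =
   res^t* *m ((H - ((z^*)%R)%:M) - (H - z%:M)) *m res.
  rewrite opprB [X in _ *m X *m _]addrC subrKA -raddfB /= mul_mx_scalar -scalemxAl.
  by [].
by rewrite mulmxBr mulmxBl res_adj_l mul1mx -mulmxA mulresV mulmx1.
Qed.

Lemma res_diff_r : res - res^t* = (z - (z^*)%R) *: (res *m res^t*).
Proof.
have -> : (z - (z^*)%R) *: (res *m res^t*) =
   res *m ((H - ((z^*)%R)%:M) - (H - z%:M)) *m res^t*.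
  rewrite opprB [X in _ *m X *m _]addrC subrKA -raddfB /= mul_mx_scalar -scalemxAl.
  by [].
by rewrite mulmxBr mulmxBl mulVres mul1mx -mulmxA res_adj_r mulmx1.
Qed.

Lemma sub_conj (u : R[i]) : u - (u^*)%R = 2 * 'i%R * (complex.Im u)%:C.
Proof. by rewrite -complexiE -mulrAC -subcJ. Qed.

(** The two resolvent identities share their left-hand side, and the scalar in front is nonzero off
    the real axis. *)
Lemma res_normal : res^t* *m res = res *m res^t*.
Proof.
have zz : z - (z^*)%R != 0.
  by rewrite sub_conj !mulf_neq0 ?pnatr_eq0 ?neq0Ci // (inj_eq (@complexI R) _ 0) gt_eqF.
by apply: (scalerI zz); rewrite -res_diff_l -res_diff_r.
Qed.

Local Notation eta := (complex.Im z).

(** The Ward identity, read off the diagonal of [res_diff_r]. *)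
Lemma Im_res_diag k : complex.Im (res k k) = eta * \sum_j cabs (res k j) ^+ 2.
Proof.
have /matrixP/(_ k k) := res_diff_r.
have -> : (res - res^t*) k k = res k k - ((res k k)^*)%R by rewrite !mxE.
rewrite [RHS]mxE mulmx_adj_diag.
rewrite !sub_conj -[RHS]mulrA -rmorphM => /mulfI/complexI; apply.
by rewrite mulf_neq0 ?pnatr_eq0 ?neq0Ci.
Qed.

(** For [g = res k k], keeping only the term [j = k] of the Ward identity gives
    [eta * |g|^2 <= Im g <= |g|]. *)
Lemma cabs_res_diag k : cabs (res k k) <= eta^-1.
Proof.
have [->|] := eqVneq (cabs (res k k)) 0; first by rewrite invr_ge0 ltW.
move=> h; have c0 : 0 < cabs (res k k) by rewrite lt_neqAle eq_sym h cabs_ge0.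
rewrite -(ler_pM2l z_gt0) mulfV ?gt_eqF // -(ler_pM2r c0) mul1r -mulrA -expr2.
apply: le_trans (Im_le_cabs (res k k)).
rewrite Im_res_diag ler_pM2l // (bigD1 k) //= lerDl.
by apply: sumr_ge0 => j _; rewrite sqr_ge0.
Qed.

Lemma Im_trace_res : complex.Im (\tr res) = eta * fro2 res.
Proof.
by rewrite /mxtrace raddf_sum mulr_sumr; apply: eq_bigr => k _; exact: Im_res_diag.
Qed.

Lemma cabs_trace_res : cabs (\tr res) <= p%:R / eta.
Proof.
apply: le_trans (cabs_sum _ _ _) _.
apply: le_trans (ler_sum _ (fun i _ => cabs_res_diag i)) _.
by rewrite sumr_const card_ord mulr_natl.
Qed.

Lemma fro2_res : fro2 res <= p%:R / eta ^+ 2.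
Proof.
rewrite expr2 invfM mulrA ler_pdivlMr // mulrC -Im_trace_res.
exact: le_trans (Im_le_cabs _) cabs_trace_res.
Qed.

End Hermitian.


(** * Decoupling one coordinate of a Hermitian matrix *)

Section RankTwo.
Variables (R : realType) (p : nat) (k : 'I_p) (M : 'M[R[i]]_p).
Hypotheses (Mh : M^t* = M) (Mkk : M k k = 0).
Variable z : R[i].
Hypothesis z_gt0 : 0 < complex.Im z.

Variables (e : 'M[R[i]]_(p, 1)) (e' : 'M[R[i]]_(1, p)).
Variables (r : 'M[R[i]]_(1, p)) (c : 'M[R[i]]_(p, 1)) (Mo : 'M[R[i]]_p).
Hypotheses (e_def : e = delta_mx k 0) (e'_def : e' = delta_mx 0 k).
Hypotheses (r_def : r = e' *m M) (c_def : c = M *m e).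
(* [Mo] is [M] with row and column [k] set to zero; keeping its size avoids
   reindexing and only adds the eigenvalue 0. *)
Hypothesis Mo_def : Mo = M - e *m r - c *m e'.

Let adj_e : e^t* = e'.
Proof. by rewrite e_def e'_def; apply/matrixP => i j; rewrite !mxE conjC_nat andbC. Qed.

Let adj_e' : e'^t* = e.
Proof. by rewrite e_def e'_def; apply/matrixP => i j; rewrite !mxE conjC_nat andbC. Qed.

Let adj_r : r^t* = c.
Proof. by rewrite r_def c_def adjmxM Mh adj_e'. Qed.

Let adj_c : c^t* = r.
Proof. by rewrite r_def c_def adjmxM Mh adj_e. Qed.

Lemma decouple_herm : Mo^t* = Mo.
Proof.
by rewrite Mo_def 2!adjmxB Mh (adjmxM e r) (adjmxM c e') adj_r adj_e adj_c adj_e' addrAC.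
Qed.

Let quad (A : 'M[R[i]]_p) : e' *m A *m e = (A k k)%:M.
Proof. by rewrite e_def e'_def; apply/matrixP => i j; rewrite !ord1 -colE -rowE !mxE. Qed.

Let e'e : e' *m e = 1%:M.
Proof. by have := quad 1%:M; rewrite mulmx1 mxE eqxx. Qed.

Let re0 : r *m e = 0.
Proof. by rewrite r_def quad Mkk raddf0. Qed.

Let e'c0 : e' *m c = 0.
Proof. by rewrite c_def mulmxA -r_def re0. Qed.

Let decouple_e : Mo *m e = 0.
Proof. by rewrite Mo_def !mulmxBl -c_def -!mulmxA re0 e'e mulmx0 mulmx1 subr0 subrr. Qed.

Let e'_decouple : e' *m Mo = 0.
Proof.
by rewrite Mo_def !mulmxBr !mulmxA e'e mul1mx -r_def subrr e'c0 mul0mx subr0.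
Qed.

Let z_neq0 : z != 0.
Proof. by have := real_sub_neq0 z_gt0 0; rewrite sub0r oppr_eq0. Qed.

Local Notation Z := (res Mo z).
Local Notation G := (res M z).

Lemma res_decouple_col : Z *m e = - z^-1 *: e.
Proof.
have := congr1 (mulmx^~ e) (mulVres decouple_herm z_gt0).
rewrite mul1mx -mulmxA mulmxBl decouple_e sub0r mul_scalar_mx mulmxN -scalemxAr.
by move=> h; rewrite -[in RHS]h scalerN !scaleNr opprK scalerA mulVf // scale1r.
Qed.

Lemma res_decouple_row : e' *m Z = - z^-1 *: e'.
Proof.
have := congr1 (mulmx e') (mulresV decouple_herm z_gt0).
rewrite mulmx1 mulmxA mulmxBr e'_decouple sub0r mul_mx_scalar mulNmx -scalemxAl.
by move=> h; rewrite -[in RHS]h scalerN !scaleNr opprK scalerA mulVf // scale1r.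
Qed.

(** The second resolvent identity for [M] and [Mo], whose difference is the sum of two matrices of
    rank at most one. *)
Let GE : G = Z - Z *m e *m (r *m G) - Z *m c *m (e' *m G).
Proof.
have E : M - z%:M = (Mo - z%:M) + (e *m r + c *m e').
  rewrite Mo_def; move: (e *m r) (c *m e') => A B.
  by apply/matrixP => i j; rewrite !mxE; ring.
have := congr1 (mulmx Z) (mulresV Mh z_gt0).
rewrite mulmx1 E mulmxDl mulmxDr mulmxA (mulVres decouple_herm z_gt0) mul1mx => h.
rewrite -[X in X - _ - _]h mulmxDl mulmxDr -!mulmxA.
by rewrite [X in _ + X - _ - _]addrC addrA !addrK.
Qed.

Let rG : r *m G = z *: (e' *m G) + e'.
Proof.
have := congr1 (mulmx e') (mulresV Mh z_gt0).
rewrite mulmx1 mulmxBl mul_scalar_mx mulmxBr mulmxA -r_def -scalemxAr => /eqP.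
by rewrite subr_eq addrC => /eqP.
Qed.

Variable q : R[i].
Hypothesis q_def : q = (r *m Z *m c) 0 0.

Let qE : r *m Z *m c = q%:M.
Proof. by rewrite q_def [LHS]mx11_scalar. Qed.

Let rZe : r *m Z *m e = 0.
Proof. by rewrite -mulmxA res_decouple_col -scalemxAr re0 scaler0. Qed.

Let e'Zc : e' *m Z *m c = 0.
Proof. by rewrite res_decouple_row -scalemxAl e'c0 scaler0. Qed.

(** Multiply [GE] by [r]: the term through [Z *m e] drops out by [rZe], the other one is [q] times
    the row [e' *m G], and [rG] expresses the left side by that same row. *)
Let e'G : (z + q) *: (e' *m G) = r *m Z - e'.
Proof.
have := congr1 (mulmx r) GE; rewrite !mulmxBr !mulmxA rZe !mul0mx subr0.
rewrite qE -mulmxA mul_scalar_mx rG => /eqP.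
rewrite eq_sym subr_eq eq_sym => /eqP h.
by rewrite scalerDl; apply/eqP; rewrite eq_sym subr_eq addrAC -h.
Qed.

Lemma res_diag_self_energy : G k k * (z + q) = -1.
Proof.
have := congr1 (mulmx^~ e) e'G.
rewrite -scalemxAl quad mulmxBl rZe e'e sub0r => /matrixP/(_ 0 0).
by rewrite !mxE eqxx mulr1n => <-; rewrite mulrC.
Qed.

(** [Mo] carries the added eigenvalue 0, which contributes [- z^-1] to [\tr Z]; adding [z^-1] back
    leaves the trace over the genuine minor. The right side comes from taking traces in [GE], where
    both products have rank at most one. *)
Lemma trace_res_decouple : \tr G - \tr Z - z^-1 =
  G k k * (1 + (r *m Z *m (Z *m c)) 0 0).
Proof.
have tr1 (A : 'M[R[i]]_1) : \tr A = A 0 0 by rewrite /mxtrace big_ord1.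
have a : \tr (Z *m e *m (r *m G)) = - (G k k + z^-1).
  rewrite mxtrace_mulC res_decouple_col -scalemxAr rG mulmxDl -scalemxAl quad e'e.
  rewrite scale_scalar_mx -raddfD /= scale_scalar_mx mxtrace_scalar mulr1n.
  by rewrite mulNr mulrDr mulKf // mulr1.
have b : \tr (Z *m c *m (e' *m G)) = - (G k k * (r *m Z *m (Z *m c)) 0 0).
  rewrite mxtrace_mulC.
  have -> : e' *m G = - G k k *: (r *m Z - e').
    by rewrite -e'G scalerA mulNr res_diag_self_energy opprK scale1r.
  by rewrite -scalemxAl mulmxBl [e' *m _]mulmxA e'Zc subr0 linearZ /= tr1 mulNr.
by rewrite {1}GE 2!linearB /= a b; ring.
Qed.

Variable b0 : R.
Hypothesis b0_def : b0 = fro2 (Z *m c).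


(** The resolvent identity for [Z], placed between [r] and its adjoint [c]. *)
Let Im_q : complex.Im q = complex.Im z * b0.
Proof.
have : q - (q^*)%R = (z - (z^*)%R) * b0%:C.
  have -> : (q^*)%R = (r *m Z^t* *m c) 0 0.
    transitivity (((r *m Z *m c)^t*) 0 0); first by rewrite qE adjmx_scalar mxE eqxx.
    by rewrite !adjmxM adj_r adj_c mulmxA.
  rewrite [in LHS]q_def.
  have -> : b0%:C = (r *m (Z^t* *m Z) *m c) 0 0.
    rewrite b0_def -trace_mulmx_adj mxtrace_mulC adjmxM adj_c !mulmxA.
    by rewrite /mxtrace big_ord1.
  transitivity ((r *m (Z - Z^t*) *m c) 0 0).
    by rewrite mulmxBr mulmxBl; move: (_ *m c) (_ *m c) => A B; rewrite !mxE.
  by rewrite (res_diff_l decouple_herm z_gt0) -scalemxAr -scalemxAl mxE.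
rewrite !sub_conj -[RHS]mulrA -rmorphM => /mulfI/complexI; apply.
by rewrite mulf_neq0 ?pnatr_eq0 ?neq0Ci.
Qed.

(* [Im (z + q) = Im z * (1 + b0)] and [1 + b0] bounds the factor of [G k k] in
   [trace_res_decouple], while [G k k = - 1 / (z + q)]. *)
Lemma cabs_trace_res_decouple :
  cabs (\tr G - \tr Z - z^-1) <= (complex.Im z)^-1.
Proof.
rewrite trace_res_decouple cabsM.
have b0_ge0 : 0 <= b0 by rewrite b0_def fro2_ge0.
have h1 : cabs (1 + (r *m Z *m (Z *m c)) 0 0) <= 1 + b0.
  apply: le_trans (cabsD _ _) _; rewrite cabs1 lerD2l.
  apply: le_trans (cabs_dot_le _ _) _; rewrite -b0_def.
  suff -> : fro2 (r *m Z) = b0 by rewrite -mulr2n -[_ *+ 2]mulr_natr mulfK.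
  rewrite b0_def; apply: complexI; rewrite -!trace_mulmx_adj mxtrace_mulC [in RHS]mxtrace_mulC !adjmxM adj_r adj_c.
  rewrite [LHS]mxtrace_mulC -!mulmxA; congr (\tr (_ *m _)).
  by rewrite !mulmxA (res_normal decouple_herm z_gt0).
have h2 : complex.Im z * (1 + b0) <= cabs (z + q).
  apply: le_trans (Im_le_cabs _); rewrite raddfD /= Im_q.
  by rewrite mulrDr mulr1.
have h3 : cabs (G k k) * cabs (z + q) = 1.
  by rewrite -cabsM res_diag_self_energy cabsN cabs1.
apply: le_trans (ler_wpM2l (cabs_ge0 _) h1) _.
rewrite -(ler_pM2l z_gt0) mulfV ?gt_eqF // mulrCA -[leRHS]h3.
by rewrite ler_wpM2l ?cabs_ge0.
Qed.

End RankTwo.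

(** * Variance of quadratic forms *)

Lemma sum_mul_delta (R : pzSemiRingType) (J : finType) (F : J -> R) (c : J) :
  \sum_b F b * (b == c)%:R = F c.
Proof.
rewrite (bigD1 c) //= eqxx mulr1 big1 ?addr0 // => b /negbTE->.
by rewrite mulr0.
Qed.

Section QuadraticForm.
Variables (R : realType) (T : finType) (n : nat) (x : T -> 'rV[R[i]]_n).

Definition unimodular := forall t j, x t 0 j * ((x t 0 j)^*)%R = 1.

(** The two excluded pairs are those where the moment need not vanish: the same pair gives 1 for
    unimodular entries, and the swapped pair gives the mean of a square, which is also 1 for
    characters with values 1 and -1. *)
Definition iid_fourth_moments := forall j l j' l', j != l -> j' != l' ->
  (j', l') != (j, l) -> (j', l') != (l, j) ->
  mean (fun t => x t 0 j * ((x t 0 l)^*)%R * ((x t 0 j' * ((x t 0 l')^*)%R)^*)%R) = 0.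

Definition orthogonal_coords := forall j l, j != l ->
  mean (fun t => x t 0 j * ((x t 0 l)^*)%R) = 0.

Hypothesis T_gt0 : (0 < #|T|)%N.
Hypotheses (xU : unimodular) (xO : orthogonal_coords) (x4 : iid_fourth_moments).
Variable A : 'M[R[i]]_n.

Definition quad t : R[i] := (x t *m A *m (x t)^t*) 0 0.

Lemma cabs_unimodular t j : cabs (x t 0 j) = 1.
Proof.
have := mul_conj_cabs (x t 0 j); rewrite xU => /esym/complexI/eqP.
by rewrite sqrf_eq1 => /orP[/eqP//|/eqP h]; have := cabs_ge0 (x t 0 j); rewrite h oppr_ge0 ler10.
Qed.

Lemma quadE t : quad t =
  \sum_(a : 'I_n * 'I_n) A a.1 a.2 * (x t 0 a.1 * ((x t 0 a.2)^*)%R).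
Proof.
rewrite /quad mxE; under eq_bigr => l _ do rewrite !mxE mulr_suml.
rewrite exchange_big pair_big; apply: eq_bigr => -[j l] _ /=.
by rewrite [_ * A _ _]mulrC mulrA.
Qed.

Let off t := \sum_(a : 'I_n * 'I_n | a.1 != a.2)
   A a.1 a.2 * (x t 0 a.1 * ((x t 0 a.2)^*)%R).

Lemma quad_off t : quad t = \tr A + off t.
Proof.
rewrite quadE (bigID (fun a : 'I_n * 'I_n => a.1 == a.2)) /=; congr (_ + _).
rewrite -(pair_big_dep xpredT (fun i j => i == j)
   (fun i j => A i j * (x t 0 i * ((x t 0 j)^*)%R))) /=.
apply: eq_bigr => i _; rewrite (big_pred1 i); last by move=> j; rewrite eq_sym.
by rewrite xU mulr1.
Qed.

Lemma mean_quad : mean quad = \tr A.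
Proof.
rewrite (eq_mean quad_off) meanD mean_cst // mean_sum big1 ?addr0 // => a a12.
by rewrite meanZ xO // mulr0.
Qed.

Let y (a : 'I_n * 'I_n) t := x t 0 a.1 * ((x t 0 a.2)^*)%R.

Let gram_le a b : a.1 != a.2 -> b.1 != b.2 ->
  cabs (mean (fun t => y a t * ((y b t)^*)%R)) <= (b == a)%:R + (b == (a.2, a.1))%:R.
Proof.
case: a b => [j l] [j' l'] /= jl jl'.
have [e1|e1] := eqVneq (j', l') (j, l); last first.
  have [e2|e2] := eqVneq (j', l') (l, j); last by rewrite /y /= x4 // cabs0 addr0.
  rewrite add0r; apply: le_trans (cabs_mean _) _; rewrite -[leRHS](mean_cst T_gt0).
  apply: ler_mean => t; rewrite /y /= !(cabsM, cabs_conj, cabs_unimodular).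
  by rewrite !mulr1.
apply: (@le_trans _ _ 1); last by rewrite lerDl.
apply: le_trans (cabs_mean _) _; rewrite -[leRHS](mean_cst T_gt0).
apply: ler_mean => t; rewrite /y /= !(cabsM, cabs_conj, cabs_unimodular).
by rewrite !mulr1.
Qed.

Let mean_off : (mean (fun t => cabs (off t) ^+ 2))%:C =
  \sum_(a : 'I_n * 'I_n | a.1 != a.2) \sum_(b : 'I_n * 'I_n | b.1 != b.2)
    A a.1 a.2 * ((A b.1 b.2)^*)%R * mean (fun t => y a t * ((y b t)^*)%R).
Proof.
rewrite -mean_real.
transitivity (mean (fun t => \sum_(a : 'I_n * 'I_n | a.1 != a.2)
  \sum_(b : 'I_n * 'I_n | b.1 != b.2)
    A a.1 a.2 * ((A b.1 b.2)^*)%R * (y a t * ((y b t)^*)%R))).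
  apply: eq_mean => t; rewrite -mul_conj_cabs /off rmorph_sum /= mulr_suml.
  apply: eq_bigr => a _; rewrite mulr_sumr; apply: eq_bigr => b _.
  by rewrite rmorphM mulrACA.
rewrite mean_sum; apply: eq_bigr => a _; rewrite mean_sum; apply: eq_bigr => b _.
exact: meanZ.
Qed.

(** Unimodular entries make the diagonal part deterministic. Each off-diagonal product correlates at
    most with itself and with its transpose, whence the factor 2. *)
Lemma variance_quad : mean (fun t => cabs (quad t - \tr A) ^+ 2) <= 2 * fro2 A.
Proof.
under eq_mean => t do rewrite quad_off addrAC subrr add0r.
apply: le_trans (ler_norm _) _; rewrite -cabs_real mean_off.
pose N (a : 'I_n * 'I_n) := cabs (A a.1 a.2).
have fE : fro2 A = \sum_a N a ^+ 2 by rewrite /fro2 pair_big.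
apply: (@le_trans _ _ (\sum_a \sum_b (N a * N b) * ((b == a)%:R + (b == (a.2, a.1))%:R))).
  apply: le_trans (cabs_sum _ _ _) _; rewrite big_mkcond; apply: ler_sum => a _.
  case: ifP => a12; last first.
    by apply: sumr_ge0 => b _; rewrite !mulr_ge0 ?cabs_ge0 ?addr_ge0.
  apply: le_trans (cabs_sum _ _ _) _; rewrite big_mkcond; apply: ler_sum => b _.
  case: ifP => b12; last by rewrite !mulr_ge0 ?cabs_ge0 ?addr_ge0.
  rewrite cabsM (cabsM (A _ _)) cabs_conj; apply: ler_wpM2l; first by rewrite mulr_ge0 ?cabs_ge0.
  exact: gram_le.
apply: (@le_trans _ _ (\sum_a (N a ^+ 2 + (N a ^+ 2 + N (a.2, a.1) ^+ 2) / 2))).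
  apply: ler_sum => a _.
  under eq_bigr => b _ do rewrite mulrDr.
  rewrite big_split /= !sum_mul_delta -expr2 lerD2l ler_pdivlMr // -subr_ge0.
  rewrite (_ : _ - _ = (N a - N (a.2, a.1)) ^+ 2) ?sqr_ge0 //; ring.
rewrite big_split /= -mulr_suml big_split /= fE.
have -> : \sum_a N (a.2, a.1) ^+ 2 = \sum_a N a ^+ 2.
  have fK : involutive (fun a : 'I_n * 'I_n => (a.2, a.1)) by case.
  by rewrite [RHS](reindex_inj (inv_inj fK)).
by lra.
Qed.

End QuadraticForm.

(** * The self-consistent equation *)

Definition centered_gram (R : realType) (n p : nat) (Phi : 'M[R[i]]_(p, n)) : 'M[R[i]]_p :=
  (Num.sqrt (n%:R / p%:R : R))%:C *: (n%:R^-1 *: (Phi *m Phi^t*) - 1%:M).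

Lemma centered_gram_herm (R : realType) (n p : nat) (Phi : 'M[R[i]]_(p, n)) :
  (centered_gram Phi)^t* = centered_gram Phi.
Proof.
rewrite /centered_gram; apply/matrixP => i j; rewrite !mxE.
rewrite rmorphM /= rmorphB rmorphM /= fmorphV !rmorph_nat eq_sym.
congr (_ * (_ * _ - _)); first exact: conjc_real.
rewrite rmorph_sum; apply: eq_bigr => l _.
by rewrite !mxE rmorphM /= conjCK mulrC.
Qed.

Lemma cabs_sub_le2 (R : realType) (u v b c : R[i]) (d : R) :
  cabs (u - b - c) <= d -> cabs (v - b - c) <= d -> cabs (v - u) <= 2 * d.
Proof.
move=> hu hv; rewrite (_ : v - u = (v - b - c) - (u - b - c)); last by ring.
by apply: le_trans (cabsB _ _) _; lra.
Qed.

(* Second-order expansion of [g = - 1 / (z + s)] around [- 1 / (z + v)]. *)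
Lemma resolvent_expand (K : fieldType) (v g z s : K) : g * (z + s) = -1 ->
  (z + v) ^+ 2 * g = - (z + v) + (s - v + (s - v) ^+ 2 * g).
Proof.
move=> h; apply/eqP; rewrite -subr_eq0.
have -> : (z + v) ^+ 2 * g - (- (z + v) + (s - v + (s - v) ^+ 2 * g)) =
  (z + v - (s - v)) * (g * (z + s) + 1) by ring.
by rewrite h addNr mulr0.
Qed.

Section Model.
Variables (R : realType) (T : finType) (n p : nat) (x : T -> 'rV[R[i]]_n).
Hypotheses (T_gt0 : (0 < #|T|)%N) (n_gt0 : (0 < n)%N) (p_gt0 : (0 < p)%N).
Hypotheses (xU : unimodular x) (xO : orthogonal_coords x) (x4 : iid_fourth_moments x).
Implicit Types (w : {ffun 'I_p -> T}) (k : 'I_p).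

Definition data_mx w : 'M[R[i]]_(p, n) := \matrix_(i < p) x (w i).

Local Notation M w := (centered_gram (data_mx w)).
Local Notation a := (Num.sqrt (n%:R / p%:R : R)).
Local Notation kap := (Num.sqrt (p%:R / n%:R : R)).

Definition data_mx_off w k : 'M[R[i]]_(p, n) :=
  \matrix_(i < p) if i == k then 0 else x (w i).

(** Subtracting [1%:M - delta_mx k k] instead of the identity clears the whole of row and column
    [k], so this is the matrix [Mo] of the rank-two decoupling. *)
Definition minor w k : 'M[R[i]]_p :=
  a%:C *: (n%:R^-1 *: (data_mx_off w k *m (data_mx_off w k)^t*)
           - (1%:M - delta_mx k k)).

Lemma minor_upd w k t : minor (upd w k t) k = minor w k.
Proof.
suff e : data_mx_off (upd w k t) k = data_mx_off w k by rewrite /minor e.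
by apply/row_matrixP => i; rewrite !rowK ffunE; case: (i == k).
Qed.

Let nR_neq0 : (n%:R : R) != 0. Proof. by rewrite pnatr_eq0 -lt0n. Qed.
Let pR_neq0 : (p%:R : R) != 0. Proof. by rewrite pnatr_eq0 -lt0n. Qed.
Let nC_neq0 : (n%:R : R[i]) != 0. Proof. by rewrite pnatr_eq0 -lt0n. Qed.
Let pC_neq0 : (p%:R : R[i]) != 0. Proof. by rewrite pnatr_eq0 -lt0n. Qed.

Let a_kap : a * kap = 1.
Proof.
rewrite -sqrtrM ?divr_ge0 // (_ : _ * _ = 1) ?sqrtr1 //; field.
by rewrite nR_neq0 pR_neq0.
Qed.

Let a_sqr : a ^+ 2 = n%:R / p%:R.
Proof. by rewrite sqr_sqrtr // divr_ge0. Qed.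

Lemma centered_gram_diag w k : M w k k = 0.
Proof.
rewrite /centered_gram !mxE eqxx.
under eq_bigr => l _ do rewrite !mxE xU.
by rewrite sumr_const card_ord mulVf // subrr mulr0.
Qed.

Let M_entry w i j : i != j ->
  M w i j = a%:C * (n%:R^-1 * \sum_l x (w i) 0 l * ((x (w j) 0 l)^*)%R).
Proof.
move=> /negbTE ij; rewrite /centered_gram !mxE ij subr0; congr (_ * (_ * _)).
by apply: eq_bigr => l _; rewrite !mxE.
Qed.

Let minor_entry w k i j : minor w k i j = if (i == k) || (j == k) then 0 else M w i j.
Proof.
have e0 : (i == k) || (j == k) ->
    (data_mx_off w k *m (data_mx_off w k)^t*) i j = 0.
  move=> ijk; rewrite mxE big1 // => l _; rewrite !mxE.
  by case/orP: ijk => ->; rewrite mxE ?mul0r // conjC0 mulr0.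
rewrite /minor !mxE; case: ifPn => [ijk|].
  have := e0 ijk; rewrite mxE => ->; rewrite mulr0 sub0r.
  have [->|ik] /= := eqVneq i k; first by rewrite eq_sym; case: eqP => _; rewrite subrr oppr0 mulr0.
  have [->|jk] := eqVneq j k; last by move: ijk; rewrite (negbTE ik) (negbTE jk).
  by rewrite (negbTE ik) subr0 oppr0 mulr0.
rewrite negb_or => /andP[ik jk].
rewrite (negbTE ik) /= subr0; congr (_ * (_ * _ - _)).
by apply: eq_bigr => l _; rewrite !mxE (negbTE ik) (negbTE jk).
Qed.

Lemma minor_decouple w k (e : 'M[R[i]]_(p, 1)) (e' : 'M[R[i]]_(1, p)) :
  e = delta_mx k 0 -> e' = delta_mx 0 k ->
  minor w k = M w - e *m (e' *m M w) - (M w *m e) *m e'.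
Proof.
move=> -> ->; rewrite -rowE -colE; apply/matrixP => i j.
have := centered_gram_diag w k; have := minor_entry w k i j.
move: (minor w k) (M w) => N Mw -> Mkk; rewrite !mxE !big_ord1 !mxE !eqxx.
rewrite ?andbT /=; have [->|ik] := eqVneq i k.
  rewrite mul1r subrr sub0r; have [->|jk] := eqVneq j k; last by rewrite mulr0 oppr0.
  by rewrite Mkk mul0r oppr0.
rewrite mul0r subr0; have [->|jk] := eqVneq j k; first by rewrite mulr1 subrr.
by rewrite mulr0 subr0.
Qed.

Variable z : R[i].
Hypothesis z_gt0 : 0 < complex.Im z.
Local Notation eta := (complex.Im z).

Definition minor_res k w := res (minor w k) z.

Definition kernel_mx k w :=
  (data_mx_off w k)^t* *m minor_res k w *m data_mx_off w k.

(** The self-energy [q] of the decoupling, as a quadratic form in row [k] whose kernel depends on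
    the other rows only. The factor is [(a / n)^2] with [a^2 = n / p]. *)
Definition sigma k w : R[i] := (n * p)%:R^-1 * quad x (kernel_mx k w) (w k).

Definition mean_sigma k w : R[i] := (n * p)%:R^-1 * \tr (kernel_mx k w).

Lemma minor_herm w k : (minor w k)^t* = minor w k.
Proof.
exact: (decouple_herm (centered_gram_herm (data_mx w))
  (e := delta_mx k 0) (e' := delta_mx 0 k) erefl erefl erefl erefl
  (minor_decouple w (k := k) erefl erefl)).
Qed.

Let row_M w k : delta_mx (0 : 'I_1) k *m M w =
  (a / n%:R)%:C *: (x (w k) *m (data_mx_off w k)^t*).
Proof.
rewrite -rowE; apply/rowP => j; rewrite mxE.
have [<-|jk] := eqVneq k j.
  rewrite centered_gram_diag !mxE big1 ?mulr0 // => l _.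
  by rewrite !mxE eqxx mxE conjC0 mulr0.
rewrite M_entry // !mxE rmorphM fmorphV rmorph_nat mulrA; congr (_ * _).
by apply: eq_bigr => l _; rewrite !mxE eq_sym (negbTE jk).
Qed.

Lemma sigmaE w k : sigma k w =
  (delta_mx (0 : 'I_1) k *m M w *m minor_res k w *m (M w *m delta_mx k (0 : 'I_1))) 0 0.
Proof.
have -> : M w *m delta_mx k (0 : 'I_1) = (delta_mx (0 : 'I_1) k *m M w)^t*.
  rewrite adjmxM centered_gram_herm; congr (_ *m _).
  by apply/matrixP => i j; rewrite !mxE conjC_nat andbC.
rewrite row_M.
have -> : ((a / n%:R)%:C *: (x (w k) *m (data_mx_off w k)^t*))^t* =
   (a / n%:R)%:C *: (data_mx_off w k *m (x (w k))^t*).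
  rewrite linearZ /= map_mxZ; congr (_ *: _); first exact: conjc_real.
  by rewrite adjmxM trmxCK.
rewrite -scalemxAr -!scalemxAl scalerA !mulmxA mxE /sigma /quad /kernel_mx !mulmxA.
congr (_ * _); rewrite -rmorphM -(rmorph_nat (real_complex R)) -fmorphV.
congr (_%:C); rewrite mulrACA -!expr2 a_sqr natrM; field.
by rewrite nR_neq0 pR_neq0.
Qed.

Lemma res_diag_sigma w k : res (M w) z k k * (z + sigma k w) = -1.
Proof.
exact: (res_diag_self_energy (centered_gram_herm _) (centered_gram_diag w k) z_gt0
  erefl erefl erefl erefl (minor_decouple w erefl erefl) (sigmaE w k)).
Qed.

Lemma trace_minor_le w k :
  cabs (\tr (res (M w) z) - \tr (minor_res k w) - z^-1) <= eta^-1.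
Proof.
exact: (cabs_trace_res_decouple (centered_gram_herm _) (centered_gram_diag w k) z_gt0
  erefl erefl erefl erefl (minor_decouple w erefl erefl) (sigmaE w k) erefl).
Qed.

Let P k : 'M[R[i]]_p := 1%:M - delta_mx k k.

Let gram_off w k : data_mx_off w k *m (data_mx_off w k)^t* =
  n%:R *: (P k + kap%:C *: minor w k).
Proof.
rewrite /minor scalerA -rmorphM mulrC a_kap scale1r addrC subrK scalerA.
by rewrite mulfV // scale1r.
Qed.

Let minor_mul w k : minor_res k w *m minor w k = 1%:M + z *: minor_res k w.
Proof.
apply/eqP; rewrite -subr_eq -mul_mx_scalar -mulmxBr; apply/eqP.
exact: (mulVres (minor_herm w k) z_gt0).
Qed.

Let minor_mul' w k : minor w k *m minor_res k w = 1%:M + z *: minor_res k w.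
Proof.
apply/eqP; rewrite -subr_eq -mul_scalar_mx -mulmxBl; apply/eqP.
exact: (mulresV (minor_herm w k) z_gt0).
Qed.

Let delta_kk k : delta_mx k k = delta_mx k (0 : 'I_1) *m delta_mx (0 : 'I_1) k :> 'M[R[i]]_p.
Proof. by rewrite mul_delta_mx. Qed.

Let mul_P w k : minor_res k w *m P k = minor_res k w + z^-1 *: delta_mx k k.
Proof.
rewrite mulmxBr mulmx1 delta_kk mulmxA /minor_res.
rewrite (res_decouple_col (centered_gram_herm _) (centered_gram_diag w k) z_gt0
  erefl erefl erefl erefl (minor_decouple w erefl erefl)).
by rewrite -scalemxAl scaleNr opprK.
Qed.

Let P_mul w k : P k *m minor_res k w = minor_res k w + z^-1 *: delta_mx k k.
Proof.
rewrite mulmxBl mul1mx delta_kk -mulmxA /minor_res.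
rewrite (res_decouple_row (centered_gram_herm _) (centered_gram_diag w k) z_gt0
  erefl erefl erefl erefl (minor_decouple w erefl erefl)).
by rewrite -scalemxAr scaleNr opprK.
Qed.

Let B w k := minor_res k w *m (data_mx_off w k *m (data_mx_off w k)^t*).

Let B_E w k : B w k = n%:R *: ((1 + kap%:C * z) *: minor_res k w +
   (z^-1 *: delta_mx k k + kap%:C%:M)).
Proof.
rewrite /B gram_off -scalemxAr mulmxDr mul_P -scalemxAr minor_mul; congr (_ *: _).
rewrite scalerDr scalerA scalemx1 scalerDl scale1r.
by apply/matrixP => i j; rewrite !mxE; ring.
Qed.

Let B_E' w k : data_mx_off w k *m (data_mx_off w k)^t* *m minor_res k w = B w k.
Proof.
rewrite /B gram_off -scalemxAr -scalemxAl mulmxDr mulmxDl mul_P P_mul.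
by rewrite -scalemxAr -scalemxAl minor_mul minor_mul'.
Qed.

Lemma trace_delta k : \tr (delta_mx k k : 'M[R[i]]_p) = 1.
Proof.
rewrite /mxtrace (bigD1 k) //= !mxE !eqxx big1 ?addr0 // => i /negbTE ik.
by rewrite mxE ik.
Qed.

(** By cyclicity this is a trace of the resolvent of the minor times the Gram matrix of the other
    rows. [gram_off] writes that Gram matrix as a projection plus [kap] times the minor, and the
    minor times its resolvent is again affine in the resolvent. The [kap] term is the deviation from
    the semicircle equation. *)
Lemma mean_sigmaE w k : mean_sigma k w =
  p%:R^-1 * (\tr (minor_res k w) + z^-1) +
  kap%:C * (1 + z * (p%:R^-1 * \tr (minor_res k w))).
Proof.
rewrite /mean_sigma /kernel_mx -mulmxA mxtrace_mulC -mulmxA -/(B w k) B_E.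
rewrite linearZ /= !linearD /= !linearZ /= trace_delta mxtrace_scalar natrM.
have z_neq0 : z != 0 by have := real_sub_neq0 z_gt0 0; rewrite sub0r oppr_eq0.
by rewrite -mulr_natr; field; rewrite nC_neq0 pC_neq0 z_neq0.
Qed.

(** Cyclicity of the trace, together with the fact that the Gram matrix of the other rows commutes
    with the resolvent of the minor ([B_E']). *)
Lemma fro2_kernel w k : fro2 (kernel_mx k w) = fro2 (B w k).
Proof.
apply: complexI; rewrite -!trace_mulmx_adj /kernel_mx.
set D := data_mx_off w k; set Z := minor_res k w.
have BE : B w k = Z *m (D *m D^t*) by [].
have BE' : (B w k)^t* = Z^t* *m (D *m D^t*).
  by rewrite -B_E' !adjmxM trmxCK.
rewrite BE' BE (adjmxM (_ *m Z)) (adjmxM (D^t*)) trmxCK.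
by rewrite -[LHS]/(\tr (D^t* *m Z *m D *m (D^t* *m (Z^t* *m D)))) -!mulmxA mxtrace_mulC !mulmxA.
Qed.

Hypotheses (eta_le1 : eta <= 1) (z_le3 : cabs z <= 3) (p_le_n : (p <= n)%N).

Let kap_ge0 : 0 <= kap. Proof. exact: sqrtr_ge0. Qed.

Let kap_le1 : kap <= 1.
Proof.
have : p%:R / n%:R <= 1 :> R by rewrite ler_pdivrMr ?ltr0n // mul1r ler_nat.
by move/ler_wsqrtr; rewrite sqrtr1.
Qed.

Let p_ge1 : 1 <= p%:R :> R. Proof. by rewrite ler1n. Qed.

Let eta_inv_ge1 : 1 <= eta^-1. Proof. by rewrite invf_ge1. Qed.

Let z_inv_le : cabs z^-1 <= eta^-1.
Proof.
rewrite cabsV lef_pV2 ?posrE ?Im_le_cabs //.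
exact: lt_le_trans z_gt0 (Im_le_cabs z).
Qed.

Lemma fro2_kernel_le w k :
  fro2 (kernel_mx k w) <= 40 * n%:R ^+ 2 * p%:R / eta ^+ 2.
Proof.
rewrite fro2_kernel B_E fro2Z cabs_nat.
rewrite (_ : 40 * _ * _ / _ = n%:R ^+ 2 * (40 * (p%:R / eta ^+ 2))); last by rewrite !mulrA; ring.
apply: ler_wpM2l; first exact: sqr_ge0.
(* [40 = 2 * (4 ^ 2 + 2 * (1 + 1))]: 4 bounds [|1 + kap * z|], and the inner ones come from
   [delta_mx k k] and from the scalar matrix [kap]. *)
apply: le_trans (fro2D _ _) _; rewrite fro2Z.
have h1 := fro2D (z^-1 *: delta_mx k k) (kap%:C%:M : 'M[R[i]]_p).
have hd : fro2 (delta_mx k k : 'M[R[i]]_p) = 1.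
  apply: complexI; rewrite -trace_mulmx_adj.
  have -> : (delta_mx k k : 'M[R[i]]_p)^t* = delta_mx k k.
    by apply/matrixP => i j; rewrite !mxE conjC_nat andbC.
  by rewrite mul_delta_mx trace_delta.
rewrite -scalemx1 !fro2Z hd fro2_1 cabs_real ger0_norm // mulr1 in h1.
have h2 : cabs (1 + kap%:C * z) <= 4.
  apply: le_trans (cabsD _ _) _; rewrite cabs1 cabsM cabs_real ger0_norm //.
  have : kap * cabs z <= 1 * 3 by rewrite ler_pM ?cabs_ge0.
  by lra.
have h3 : fro2 (minor_res k w) <= p%:R / eta ^+ 2.
  exact: (fro2_res (minor_herm w k) z_gt0).
have h4 : cabs (1 + kap%:C * z) ^+ 2 * fro2 (minor_res k w) <= 4 ^+ 2 * (p%:R / eta ^+ 2).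
  by rewrite ler_pM ?sqr_ge0 ?fro2_ge0 // lerXn2r ?nnegrE ?cabs_ge0.
have h5 : cabs z^-1 ^+ 2 <= eta^-1 ^+ 2.
  by rewrite lerXn2r // nnegrE ?cabs_ge0 // invr_ge0 ltW.
have h6 : kap ^+ 2 * p%:R <= 1 * p%:R by rewrite ler_wpM2r // expr_le1.
have e2 : 1 <= eta^-1 ^+ 2 by rewrite exprn_ege1.
rewrite -exprVn in h4 *; rewrite -scalemx1.
move: h1 h4 h5 h6; set X := fro2 _; set Y := cabs _ ^+ 2 * _; move=> *.
have : 1 * p%:R <= eta^-1 ^+ 2 * p%:R by rewrite ler_wpM2r.
have : eta^-1 ^+ 2 * 1 <= eta^-1 ^+ 2 * p%:R by rewrite ler_wpM2l ?sqr_ge0.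
by lra.
Qed.

Lemma kernel_upd w k t : kernel_mx k (upd w k t) = kernel_mx k w.
Proof.
rewrite /kernel_mx /minor_res minor_upd; congr (_^t* *m _ *m _);
  by apply/row_matrixP => i; rewrite !rowK ffunE; case: (i == k).
Qed.

Lemma mean_sigma_upd w k t : mean_sigma k (upd w k t) = mean_sigma k w.
Proof. by rewrite /mean_sigma kernel_upd. Qed.

Lemma sigma_upd w k t : sigma k (upd w k t) = (n * p)%:R^-1 * quad x (kernel_mx k w) t.
Proof. by rewrite /sigma kernel_upd ffunE eqxx. Qed.

Lemma mean_sigma_mean k : mean (sigma k) = mean (mean_sigma k).
Proof.
rewrite -(mean_resample T_gt0 k); apply: eq_mean => w; rewrite /resample.
rewrite (eq_mean (sigma_upd w k)) meanZ mean_quad //.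
Qed.

(** With the other rows fixed the kernel is constant and [w k] is uniform, so [variance_quad]
    applies; 80 is twice the 40 of [fro2_kernel_le]. *)
Lemma variance_sigma k :
  mean (fun w => cabs (sigma k w - mean_sigma k w) ^+ 2) <= 80 / (p%:R * eta ^+ 2).
Proof.
rewrite -(mean_resample T_gt0 k).
rewrite -[leRHS](@mean_cst _ {ffun 'I_p -> T}); last by rewrite card_ffun expn_gt0 T_gt0.
apply: ler_mean => w; rewrite /resample.
have -> : mean (fun t => cabs (sigma k (upd w k t) - mean_sigma k (upd w k t)) ^+ 2) =
  (n * p)%:R^-1 ^+ 2 * mean (fun t => cabs (quad x (kernel_mx k w) t - \tr (kernel_mx k w)) ^+ 2).
  rewrite -meanZ; apply: eq_mean => t; rewrite sigma_upd mean_sigma_upd /mean_sigma.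
  by rewrite -mulrBr cabsM cabsV cabs_nat exprMn.
have h1 := variance_quad T_gt0 xU x4 (kernel_mx k w).
have h2 := fro2_kernel_le w k.
apply: (@le_trans _ _ ((n * p)%:R^-1 ^+ 2 * (2 * (40 * n%:R ^+ 2 * p%:R / eta ^+ 2)))).
  apply: ler_wpM2l; first exact: sqr_ge0.
  by apply: le_trans h1 _; rewrite ler_pM2l.
rewrite natrM le_eqVlt; apply/orP; left; apply/eqP; field.
by rewrite nR_neq0 pR_neq0 gt_eqF.
Qed.

Definition stieltjes w : R[i] := p%:R^-1 * \tr (res (M w) z).

(** The first term is the change of trace caused by removing row [k]; for the second,
    [1 + |z| / eta <= 4 / eta] because [|z| <= 3] and [eta <= 1]. *)
Lemma cabs_mean_sigma_sub w k :
  cabs (mean_sigma k w - stieltjes w) <= (p%:R * eta)^-1 + 4 * kap / eta.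
Proof.
rewrite mean_sigmaE /stieltjes.
have ringE (u v d i l y : R[i]) : d * (v + i) + l * (1 + y * (d * v)) - d * u =
    - (d * (u - v - i)) + l * (1 + y * (d * v)) by ring.
rewrite ringE.
apply: le_trans (cabsD _ _) _; apply: lerD.
  rewrite cabsN cabsM cabsV cabs_nat invfM ler_wpM2l ?invr_ge0 //.
  exact: trace_minor_le.
rewrite cabsM cabs_real ger0_norm // [4 * kap]mulrC -[leRHS]mulrA; apply: ler_wpM2l => //.
apply: le_trans (cabsD _ _) _; rewrite cabs1 !cabsM cabsV cabs_nat.
have h : p%:R^-1 * cabs (\tr (minor_res k w)) <= eta^-1.
  rewrite mulrC ler_pdivrMr ?ltr0n // mulrC.
  exact: (cabs_trace_res (minor_herm w k) z_gt0).
have : cabs z * (p%:R^-1 * cabs (\tr (minor_res k w))) <= 3 * eta^-1.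
  by rewrite ler_pM ?cabs_ge0 // mulr_ge0 ?invr_ge0 ?cabs_ge0.
by move: eta_inv_ge1; lra.
Qed.

(** Before and after the change of row [k] the minor is the same, so both traces are within [eta^-1]
    of the same number. *)
Lemma stieltjes_bounded_diff : bounded_diff stieltjes (2 / (p%:R * eta)).
Proof.
move=> w k t; rewrite /stieltjes -mulrBr cabsM cabsV cabs_nat.
rewrite invfM mulrCA ler_wpM2l ?invr_ge0 //.
have h1 := trace_minor_le w k.
have h2 := trace_minor_le (upd w k t) k.
rewrite /minor_res minor_upd -/(minor_res k w) in h2.
exact: (cabs_sub_le2 h1 h2).
Qed.

Let Omega_gt0 : (0 < #|{ffun 'I_p -> T}|)%N.
Proof. by rewrite card_ffun expn_gt0 T_gt0. Qed.

Local Notation f := (mean stieltjes).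

Lemma mean_stieltjesE : f = p%:R^-1 * \sum_k mean (fun w => res (M w) z k k).
Proof. by rewrite -mean_sum -meanZ. Qed.

Lemma Im_mean_stieltjes_ge0 : 0 <= complex.Im f.
Proof.
rewrite Im_mean; apply: mean_ge0 => w; rewrite /stieltjes.
rewrite -(rmorph_nat (real_complex R)) -fmorphV.
rewrite (_ : complex.Im _ = p%:R^-1 * complex.Im (\tr (res (M w) z))).
  rewrite (Im_trace_res (centered_gram_herm (data_mx w)) z_gt0).
  by rewrite !mulr_ge0 ?invr_ge0 ?fro2_ge0 // ltW.
by case: (\tr _) => ? ? /=; rewrite mul0r addr0.
Qed.

Let eps k w := sigma k w - f.

Lemma mean_eps k : cabs (mean (fun w => sigma k w - f)) <= (p%:R * eta)^-1 + 4 * kap / eta.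
Proof.
rewrite meanB (mean_cst Omega_gt0) mean_sigma_mean -meanB.
apply: le_trans (cabs_mean _) _; rewrite -[leRHS](mean_cst Omega_gt0).
by apply: ler_mean => w; exact: cabs_mean_sigma_sub.
Qed.

Lemma mean_sqr_eps k : mean (fun w => cabs (sigma k w - f) ^+ 2) <=
  200 / (p%:R * eta ^+ 2) + 128 * kap ^+ 2 / eta ^+ 2.
Proof.
pose d := (p%:R * eta)^-1 + 4 * kap / eta.
have d_ge0 : 0 <= d.
  by rewrite addr_ge0 ?invr_ge0 ?mulr_ge0 ?invr_ge0 // ltW.
have d2 : d ^+ 2 <= 2 * ((p%:R * eta ^+ 2)^-1 + 16 * kap ^+ 2 / eta ^+ 2).
  apply: (@le_trans _ _ (2 * ((p%:R * eta)^-1 ^+ 2 + (4 * kap / eta) ^+ 2))).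
    rewrite /d -subr_ge0.
    rewrite (_ : _ - _ = ((p%:R * eta)^-1 - (4 * kap / eta)) ^+ 2) ?sqr_ge0 //; ring.
  rewrite ler_pM2l // lerD //; last first.
    by rewrite le_eqVlt; apply/orP; left; apply/eqP; field; rewrite gt_eqF.
  rewrite exprVn lef_pV2 ?posrE ?exprn_gt0 ?mulr_gt0 ?exprn_gt0 ?ltr0n //.
  by rewrite exprMn ler_wpM2r ?sqr_ge0 // expr2 ler_peMl.
(* The three parts are the fluctuation due to row [k], the bias [d] and the fluctuation of
   [stieltjes]: [2 * 80 + 4 * 2 + 4 * 4 <= 200] and [4 * 2 * 16 = 128]. *)
apply: (@le_trans _ _ (mean (fun w => 2 * cabs (sigma k w - mean_sigma k w) ^+ 2 +
   (4 * d ^+ 2 + 4 * cabs (stieltjes w - f) ^+ 2)))).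
  apply: ler_mean => w.
  rewrite (_ : sigma k w - f = (sigma k w - mean_sigma k w) +
     ((mean_sigma k w - stieltjes w) + (stieltjes w - f))); last by ring.
  have h1 := sqr_cabsD (sigma k w - mean_sigma k w)
     ((mean_sigma k w - stieltjes w) + (stieltjes w - f)).
  have h2 := sqr_cabsD (mean_sigma k w - stieltjes w) (stieltjes w - f).
  have h3 : cabs (mean_sigma k w - stieltjes w) ^+ 2 <= d ^+ 2.
    by rewrite lerXn2r ?nnegrE ?cabs_ge0 // cabs_mean_sigma_sub.
  by lra.
rewrite 2!meanD (mean_cst Omega_gt0) (meanZ 2) (meanZ 4).
have h1 := variance_sigma k.
have c_ge0 : 0 <= 2 / (p%:R * eta) by rewrite divr_ge0 ?mulr_ge0 // ltW.
have h2 := bounded_diff_variance T_gt0 c_ge0 stieltjes_bounded_diff.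
rewrite card_ord in h2.
have h3 : p%:R * (2 / (p%:R * eta)) ^+ 2 = 4 * (p%:R * eta ^+ 2)^-1.
  by field; rewrite pR_neq0 gt_eqF.
rewrite {}h3 in h2.
have h0 : 0 <= (p%:R * eta ^+ 2)^-1 by rewrite invr_ge0 mulr_ge0 ?sqr_ge0.
have arith (V W D u a b : R) : V <= 80 * u -> W <= 4 * u ->
    D <= 2 * (u + 16 * a / b) -> 0 <= u ->
    2 * V + (4 * D + 4 * W) <= 200 * u + 128 * a / b.
  by lra.
exact: (arith _ _ _ _ _ _ h1 h2 d2 h0).
Qed.

Lemma self_consistent : exists2 r : R[i],
  f * (z + f) ^+ 2 = - (z + f) + r &
  cabs r <= 201 / (p%:R * eta ^+ 3) + 4 * kap / eta + 128 * kap ^+ 2 / eta ^+ 3.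
Proof.
pose G w k := res (M w) z k k.
exists (p%:R^-1 * \sum_k (mean (eps k) + mean (fun w => eps k w ^+ 2 * G w k))).
  rewrite {1}mean_stieltjesE -mulrA mulr_suml.
  have E k : mean (fun w => res (M w) z k k) * (z + f) ^+ 2 =
      - (z + f) + (mean (eps k) + mean (fun w => eps k w ^+ 2 * G w k)).
    transitivity (mean (fun w => - (z + f) + (eps k w + eps k w ^+ 2 * G w k))); last first.
      by rewrite meanD (mean_cst Omega_gt0) meanD.
    rewrite mulrC -meanZ; apply: eq_mean => w.
    exact: (resolvent_expand (mean stieltjes) (res_diag_sigma w k)).
  rewrite (eq_bigr _ (fun k _ => E k)) big_split /= mulrDr sumr_const card_ord.
  by congr (_ + _); rewrite -[- _ *+ p]mulr_natl mulrA mulVf // mul1r.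
rewrite cabsM cabsV cabs_nat mulrC ler_pdivrMr ?ltr0n //.
apply: le_trans (cabs_sum _ _ _) _.
set b := (X in _ <= X * _).
suff h k : cabs (mean (eps k) + mean (fun w => eps k w ^+ 2 * G w k)) <= b.
  apply: le_trans (ler_sum _ (fun k _ => h k)) _.
  by rewrite sumr_const card_ord mulr_natr.
have h1 := mean_eps k; have h2 := mean_sqr_eps k.
have h3 : cabs (mean (fun w => eps k w ^+ 2 * G w k)) <=
    eta^-1 * mean (fun w => cabs (sigma k w - f) ^+ 2).
  apply: le_trans (cabs_mean _) _; rewrite -meanZ; apply: ler_mean => w.
  rewrite cabsM cabsX mulrC ler_wpM2r ?sqr_ge0 //.
  exact: (cabs_res_diag (centered_gram_herm _) z_gt0).
apply: le_trans (cabsD _ _) _; apply: le_trans (lerD h1 h3) _.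
have ei : 0 <= eta^-1 by rewrite invr_ge0 ltW.
have h4 := ler_wpM2l ei h2.
apply: le_trans (lerD (lexx _) h4) _.
rewrite /b {b}.
have -> : eta^-1 * (200 / (p%:R * eta ^+ 2) + 128 * kap ^+ 2 / eta ^+ 2) =
   200 / (p%:R * eta ^+ 3) + 128 * kap ^+ 2 / eta ^+ 3.
  by field; rewrite pR_neq0 gt_eqF.
(* As [eta <= 1], the [1 / p] part of the linear error joins the quadratic one: [201 = 200 + 1]. *)
have h5 : (p%:R * eta)^-1 <= (p%:R * eta ^+ 3)^-1.
  rewrite lef_pV2 ?posrE ?mulr_gt0 ?exprn_gt0 ?ltr0n // ler_pM2l ?ltr0n //.
  by rewrite exprS ler_piMr ?expr_le1 // ltW.
have arith (u v a b : R) : u <= v -> u + a + (200 * v + b) <= 201 * v + a + b.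
  by lra.
exact: (arith _ _ _ _ h5).
Qed.

End Model.

(** * Stability of the self-consistent equation *)

Section Stability.
Variable R : realType.

Lemma cabs_im (y : R) : cabs ('i * y%:C) = `|y|.
Proof.
rewrite cabsM cabs_real (_ : cabs 'i = 1) ?mul1r //.
by rewrite /cabs /= expr0n expr1n add0r sqrtr1.
Qed.

Lemma complex_split (u y : R) : u +i* y = u%:C + 'i * y%:C.
Proof. exact: complexE. Qed.

Lemma cabs_spectral_param (u y : R) : -2 <= u <= 2 -> 0 < y <= 1 -> cabs (u +i* y) <= 3.
Proof.
move=> hu /andP[y0 y1]; rewrite complex_split; apply: le_trans (cabsD _ _) _.
rewrite cabs_im cabs_real (gtr0_norm y0).
have : `|u| <= 2 by rewrite ler_norml.
by lra.
Qed.

(* With [w := z + f] the equation reads [w * (w ^+ 2 - z * w + 1) = r]; since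
   [Im w >= y > 2 * cabs r], [w] cannot be close to 0, so that
   [f ^+ 2 + z * f + 1 = r / w] is small.  The comparison is made with the root
   [m] of [m ^+ 2 + u * m + 1 = 0] at the real point [u]. *)
Lemma stability (f r : R[i]) (u y : R) : -2 <= u <= 2 -> 0 < y <= 1 ->
  0 <= complex.Im f -> let z := u +i* y in
  f * (z + f) ^+ 2 = - (z + f) + r -> cabs r <= y / 4 ->
  cabs f <= 24 /\
  `|complex.Im f - Num.sqrt (4 - u ^+ 2) / 2| * Num.sqrt (4 - u ^+ 2) <= 52 * y.
Proof.
move=> hu hy f0 z E hr; have /andP[y0 y1] := hy.
pose w := z + f.
have wr : w * (w ^+ 2 - z * w + 1) = r.
  have -> : r = f * (z + f) ^+ 2 + (z + f) by rewrite E; ring.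
  by rewrite /w; ring.
have yw : y <= cabs w.
  by apply: le_trans (Im_le_cabs w); rewrite /w raddfD /= lerDl.
have z3 : cabs z <= 3 by exact: cabs_spectral_param.
have w8 : 1 / 8 <= cabs w.
  rewrite leNgt; apply/negP => w8.
  have w0 := cabs_ge0 w; have z0 := cabs_ge0 z.
  have h1 : cabs (w ^+ 2 - z * w) <= 1 / 2.
    apply: le_trans (cabsB _ _) _; rewrite cabsM cabsX.
    have : cabs w ^+ 2 <= (1 / 8) * (1 / 8) by rewrite expr2 ler_pM // ltW.
    have : cabs z * cabs w <= 3 * (1 / 8) by rewrite ler_pM // ltW.
    by lra.
  have h2 : 1 / 2 <= cabs (w ^+ 2 - z * w + 1).
    have := cabsB (w ^+ 2 - z * w + 1) (w ^+ 2 - z * w).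
    rewrite (_ : _ + 1 - _ = 1) ?cabs1; last by ring.
    by lra.
  have := cabsM w (w ^+ 2 - z * w + 1); rewrite wr => h3.
  have : y * (1 / 2) <= cabs r by rewrite h3 ler_pM // ?ltW //; lra.
  by lra.
pose d := f * w + 1.
have d2 : cabs d <= 2 * y.
  have e : w * d = r by rewrite -wr /d /w; ring.
  have := cabsM w d; rewrite e => h.
  have : (1 / 8) * cabs d <= cabs r by rewrite h ler_wpM2r ?cabs_ge0.
  by lra.
have f24 : cabs f <= 24.
  have e : f * w = d - 1 by rewrite /d; ring.
  have := cabsM f w; rewrite e => h.
  have h2 := cabsB d 1; rewrite cabs1 in h2.
  have : cabs f * (1 / 8) <= cabs f * cabs w by rewrite ler_wpM2l ?cabs_ge0.
  by lra.
split => //.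
set s := Num.sqrt _.
have s0 : 0 <= s by exact: sqrtr_ge0.
have s2 : s ^+ 2 = 4 - u ^+ 2.
  have /andP[u1 u2] := hu.
  rewrite sqr_sqrtr // (_ : _ - _ = (2 - u) * (2 + u)); last by ring.
  by rewrite mulr_ge0 //; lra.
pose m : R[i] := (- (u / 2)) +i* (s / 2).
have me : m * (m + u%:C) = -1.
  rewrite /m; apply/eqP; rewrite eq_complex /=; apply/andP; split; apply/eqP; last by field.
  have -> : - (u / 2) * (- (u / 2) + u) - s / 2 * (s / 2 + 0) = - (u ^+ 2 + s ^+ 2) / 4 by field.
  by rewrite s2; field.
have fm : (f - m) * (f + m + u%:C) = d - 'i * y%:C * f.
  have -> : d - 'i * y%:C * f = f * f + u%:C * f + 1.
    by rewrite /d /w /z complex_split; ring.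
  have -> : (f - m) * (f + m + u%:C) = f * f + u%:C * f - m * (m + u%:C) by ring.
  by rewrite me opprK.
(* The factor [f + m + u] has imaginary part [Im f + s / 2 >= s / 2]: the sign of [Im f] selects the
   root [m]. Here [26 = 2 + 24], from the bounds on [d] and on [f]. *)
have h1 : cabs (f - m) * (s / 2) <= 26 * y.
  apply: (@le_trans _ _ (cabs (f - m) * cabs (f + m + u%:C))).
    apply: ler_wpM2l; first exact: cabs_ge0.
    apply: le_trans (Im_le_cabs _).
    by rewrite !raddfD /= addr0 lerDr.
  rewrite -cabsM fm; apply: le_trans (cabsB _ _) _; rewrite cabsM cabs_im (gtr0_norm y0).
  have : y * cabs f <= y * 24 by rewrite ler_pM2l.
  by lra.
have h2 : `|complex.Im f - s / 2| <= cabs (f - m).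
  by apply: le_trans (normIm_cabs _); rewrite raddfB.
have : `|complex.Im f - s / 2| * (s / 2) <= cabs (f - m) * (s / 2).
  by rewrite ler_wpM2r // divr_ge0.
by lra.
Qed.

End Stability.

(** * Smoothing with Poisson kernels *)

Section RealDerivatives.
Variable R : realType.
Implicit Types (f g : R -> R) (x a b : R).

Lemma is_derive1D f g x a b : is_derive x 1 f a -> is_derive x 1 g b ->
  is_derive x 1 (fun t => f t + g t) (a + b).
Proof. exact: is_deriveD. Qed.

Lemma is_derive1M f g x a b : is_derive x 1 f a -> is_derive x 1 g b ->
  is_derive x 1 (fun t => f t * g t) (f x * b + g x * a).
Proof. exact: is_deriveM. Qed.

Lemma is_derive1Z k f x a : is_derive x 1 f a ->
  is_derive x 1 (fun t => k * f t) (k * a).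
Proof. exact: is_deriveZ. Qed.

Lemma is_derive1_linear k x : is_derive x 1 (fun t : R => k * t) k.
Proof.
by have := is_derive1Z k (is_derive_id (x : R) (1 : R)); rewrite mulr1.
Qed.

Lemma is_derive1_sum (J : Type) (r : seq J) (F : J -> R -> R) (dF : J -> R) x :
  (forall j, is_derive x 1 (F j) (dF j)) ->
  is_derive x 1 (fun t => \sum_(j <- r) F j t) (\sum_(j <- r) dF j).
Proof.
move=> h; elim: r => [|j r IH].
  rewrite big_nil (_ : (fun t => _) = cst 0); first exact: is_derive_cst.
  by apply/funext => t; rewrite big_nil.
rewrite big_cons (_ : (fun t => _) = fun t => F j t + \sum_(i <- r) F i t).
  exact: is_derive1D.
by apply/funext => t; rewrite big_cons.
Qed.

Lemma is_derive1_mean (J : finType) (F : J -> R -> R) (dF : J -> R) x :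
  (forall j, is_derive x 1 (F j) (dF j)) ->
  is_derive x 1 (fun t => mean (fun j => F j t)) (mean dF).
Proof.
move=> h; rewrite /mean mulrC.
rewrite (_ : (fun t => _) = fun t => #|J|%:R^-1 * \sum_j F j t).
  exact/is_derive1Z/is_derive1_sum.
by apply/funext => t; rewrite mulrC.
Qed.

Lemma MVT_global f df a b : (forall x, is_derive x 1 f (df x)) -> a <= b ->
  exists2 c, a <= c <= b & f b - f a = df c * (b - a).
Proof.
move=> fd ab.
have [c cab e] := @MVT_segment R f df a b ab (fun x _ => fd x)
   (derivable_within_continuous (fun x _ => @ex_derive _ _ _ _ _ _ _ (fd x))).
by exists c.
Qed.

End RealDerivatives.

Section SmoothedStep.
Variable R : realType.

(* Up to the factor [pi], the distribution function of [2 P_1 - P_2], where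
   [P_y] is the Poisson kernel.  The leading tails of [P_1] and [P_2] cancel,
   so that the deviation from the step function is [O(1 / (1 + x ^ 2))]. *)
Definition smooth_step (x : R) : R := 2 * atan x - atan (x / 2).

Lemma is_derive_smooth_step (x : R) :
  is_derive x (1 : R) smooth_step (2 / (1 + x ^+ 2) - 2 / (4 + x ^+ 2)).
Proof.
have h : is_derive x 1 (fun t : R => atan (t / 2)) ((1 + (x / 2) ^+ 2)^-1 * 2^-1).
  apply: (@is_derive1_comp _ atan (fun t => t / 2)).
  have := is_derive1_linear 2^-1 x.
  by rewrite (_ : (fun t => _) = (fun t : R => t / 2)) //; apply/funext => t; rewrite mulrC.
have := is_derive1D (is_derive1Z 2 (is_derive1_atan x)) (is_derive1Z (-1) h).
rewrite (_ : (fun t => _) = smooth_step); last by apply/funext => t; rewrite mulN1r.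
move=> H; apply: is_derive_eq H _.
have x2 := sqr_ge0 x; field.
by rewrite !gt_eqF // ltr_pwDl.
Qed.

Lemma pihalf_sub_atan (x : R) : 0 < x -> pi / 2 - atan x = atan x^-1.
Proof.
move=> x0.
have a0 : 0 < atan x by rewrite -[ltLHS](atan0 R) lt_atan.
have a1 := atan_ltpi2 x.
rewrite -[LHS]tanK; last by rewrite in_itv /=; apply/andP; split; lra.
congr atan; rewrite /tan sinB cosB sin_pihalf cos_pihalf !mul1r !mul0r subr0 add0r.
by rewrite -[in RHS](atanK x) /tan invf_div.
Qed.

(** Reflection by [pi / 2 - atan x = atan x^-1] moves the question to [g] at [x^-1], near 0. There
    the linear terms of [2 * atan t] and [atan (2 * t)] cancel, so that the derivative is at most
    [6 * t ^+ 2]. *)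
Lemma smooth_step_ge x : 1 <= x -> `|smooth_step x - pi / 2| <= 16 / (1 + x ^+ 2).
Proof.
move=> x1; have x0 : 0 < x by lra.
pose g (t : R) := 2 * atan t - atan (2 * t).
have e : smooth_step x - pi / 2 = - g x^-1.
  rewrite /g -pihalf_sub_atan // (_ : 2 * x^-1 = (x / 2)^-1); last by rewrite invf_div.
  by rewrite -pihalf_sub_atan ?divr_gt0 // /smooth_step; field.
rewrite e normrN.
pose dg (t : R) := 6 * t ^+ 2 / ((1 + t ^+ 2) * (1 + 4 * t ^+ 2)).
have gd (t : R) : is_derive t (1 : R) g (dg t).
  have h : is_derive t 1 (fun s : R => atan (2 * s)) ((1 + (2 * t) ^+ 2)^-1 * 2).
    apply: (@is_derive1_comp _ atan (fun s => 2 * s)).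
    exact: is_derive1_linear.
  have := is_derive1D (is_derive1Z 2 (is_derive1_atan t)) (is_derive1Z (-1) h).
  rewrite (_ : (fun s => _) = g); last by apply/funext => s; rewrite mulN1r.
  move=> H; apply: is_derive_eq H _; rewrite /dg.
  have t2 := sqr_ge0 t; field.
  by rewrite !gt_eqF // ltr_pwDl // mulr_ge0.
have xV0 : 0 <= x^-1 by rewrite invr_ge0 ltW.
have [c /andP[c0 c1] gE] := MVT_global gd xV0.
have g0 : g 0 = 0 by rewrite /g mulr0 atan0 mulr0 subrr.
rewrite g0 !subr0 in gE; rewrite gE.
have x2 : 0 < 1 + x ^+ 2 by rewrite ltr_pwDl ?sqr_ge0.
have c2 := sqr_ge0 c.
have d1 : 1 <= (1 + c ^+ 2) * (1 + 4 * c ^+ 2) by rewrite -[leLHS]mulr1 ler_pM //; lra.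
have dgc : 0 <= dg c <= 6 * x^-1 ^+ 2.
  rewrite /dg divr_ge0 /=; last 2 first.
  - by rewrite mulr_ge0.
  - by apply: le_trans d1.
  rewrite ler_pdivrMr; last exact: lt_le_trans d1.
  apply: (@le_trans _ _ (6 * x^-1 ^+ 2 * 1)); last first.
    by rewrite ler_wpM2l // mulr_ge0 ?sqr_ge0.
  by rewrite mulr1 ler_wpM2l // lerXn2r.
case/andP: dgc => dg0 dg1.
rewrite ger0_norm; last exact: mulr_ge0 dg0 xV0.
have xV1 : x^-1 <= 1 by rewrite invf_le1.
apply: (@le_trans _ _ (6 * x^-1 ^+ 2 * 1)); first exact: ler_pM dg0 xV0 dg1 xV1.
have xx : x^-1 * x = 1 by rewrite mulVf // gt_eqF.
have : x^-1 ^+ 2 <= 1 by rewrite exprn_ile1.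
rewrite mulr1 ler_pdivlMr // mulrDr mulr1 -mulrA -exprMn xx expr1n.
by lra.
Qed.

Lemma norm_atan_le2 (x : R) : `|atan x| <= 2.
Proof.
have := atan_gtNpi2 x; have := atan_ltpi2 x; have := pihalf_lt2 R.
by move=> *; rewrite ler_norml; apply/andP; split; lra.
Qed.

Lemma norm_smooth_step x : `|smooth_step x| <= 6.
Proof.
have := norm_atan_le2 x; have := norm_atan_le2 (x / 2).
by rewrite !ler_norml /smooth_step => /andP[? ?] /andP[? ?]; apply/andP; split; lra.
Qed.

Lemma smooth_stepN x : smooth_step (- x) = - smooth_step x.
Proof. by rewrite /smooth_step mulNr !atanN; ring. Qed.

Lemma smooth_step_pos x : 0 <= x -> `|smooth_step x - pi / 2| <= 16 / (1 + x ^+ 2).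
Proof.
move=> x0; have [x1|x1] := leP 1 x; first exact: smooth_step_ge.
have x2 : x ^+ 2 <= 1 by rewrite exprn_ile1 // ltW.
apply: (@le_trans _ _ 8).
  have := norm_smooth_step x; have := pihalf_lt2 R; have := pihalf_ge1 R.
  by rewrite !ler_norml => ? ? /andP[? ?]; apply/andP; split; lra.
rewrite ler_pdivlMr; last by rewrite ltr_pwDl ?sqr_ge0.
by lra.
Qed.

Lemma smooth_step_neg x : x <= 0 -> `|smooth_step x + pi / 2| <= 16 / (1 + x ^+ 2).
Proof.
move=> x0; have := @smooth_step_pos (- x).
by rewrite oppr_ge0 smooth_stepN sqrrN -opprD normrN; apply.
Qed.

End SmoothedStep.

(** * The semicircle law *)

Section Semicircle.
Variable R : realType.
Local Notation mu := (@lebesgue_measure R).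

Lemma is_derive1_continuous (f df : R -> R) :
  (forall x : R, is_derive x (1 : R) f (df x)) -> continuous f.
Proof.
move=> fd x; apply/differentiable_continuous; rewrite -derivable1_diffP.
by have [] := fd x.
Qed.

Lemma is_derive1_LRcontinuous (f df : R -> R) (a b : R) :
  (forall x : R, is_derive x (1 : R) f (df x)) -> derivable_oo_LRcontinuous f a b.
Proof.
move=> fd; have fc := is_derive1_continuous fd; split.
- by move=> x _; have [] := fd x.
- exact/cvg_at_right_filter/fc.
- exact/cvg_at_left_filter/fc.
Qed.

Lemma is_derive1_derive (f df : R -> R) :
  (forall x : R, is_derive x (1 : R) f (df x)) -> derive1 f = df.
Proof.
by move=> fd; apply/funext => x; rewrite derive1E; have [_] := fd x.
Qed.

Lemma asin_half (u : R) : -2 <= u <= 2 ->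
  [/\ - (pi / 2) <= asin (u / 2), asin (u / 2) <= pi / 2 & 2 * sin (asin (u / 2)) = u].
Proof.
move=> /andP[u1 u2]; have h : -1 <= u / 2 <= 1 by apply/andP; split; lra.
split; [exact: asin_geNpi2|exact: asin_lepi2|].
by rewrite asinK ?in_itv //=; field.
Qed.

Lemma asin_half_lt (a b : R) : -2 <= a -> a < b -> b <= 2 ->
  asin (a / 2) < asin (b / 2).
Proof.
move=> a2 ab b2.
have [a3 a4 a5] := @asin_half a (introT andP (conj a2 (ltW (lt_le_trans ab b2)))).
have [b3 b4 b5] := @asin_half b (introT andP (conj (ltW (le_lt_trans a2 ab)) b2)).
rewrite -ltr_sin ?in_itv /= ?a3 ?b3 //.
by lra.
Qed.

Definition circle_arc (t : R) : R := t + sin t * cos t.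

Lemma is_derive_circle_arc (t : R) :
  is_derive t (1 : R) circle_arc (2 * cos t ^+ 2).
Proof.
have := is_derive1D (is_derive_id (t : R) (1 : R))
  (is_derive1M (is_derive_sin t) (is_derive_cos t)).
move=> H; apply: is_derive_eq H _.
by have := cos2Dsin2 t; rewrite !expr2; lra.
Qed.

(** Under [u = 2 * sin t] the semicircle law becomes [2 * cos t ^+ 2 / pi] in [t], so on [-2, 2]
    this is its distribution function up to an additive constant. *)
Definition semicircle_primitive (u : R) : R := circle_arc (asin (u / 2)) / pi.

Lemma continuous_semicircle : continuous (fun x : R => (2 * pi)^-1 * Num.sqrt (4 - x ^+ 2)).
Proof.
move=> x; apply: cvgM; first exact: cvg_cst.
apply: (@continuous_comp _ _ _ (fun x : R => 4 - x ^+ 2) (@Num.sqrt R)).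
  by apply: cvgB; [exact: cvg_cst|exact: exprn_continuous].
exact: sqrt_continuous.
Qed.

Lemma integral_semicircle_itv (a b : R) : -2 <= a -> a < b -> b <= 2 ->
  (\int[mu]_(x in `[a, b]) ((2 * pi)^-1 * Num.sqrt (4 - x ^+ 2))%:E =
   (semicircle_primitive b - semicircle_primitive a)%:E)%E.
Proof.
move=> a2 ab b2.
have [a3 a4 a5] := @asin_half a (introT andP (conj a2 (ltW (lt_le_trans ab b2)))).
have [b3 b4 b5] := @asin_half b (introT andP (conj (ltW (le_lt_trans a2 ab)) b2)).
have st := asin_half_lt a2 ab b2.
rewrite /semicircle_primitive; set s := asin _ in a3 a4 a5 st *.
set t := asin _ in b3 b4 b5 st *.
have Fd (x : R) : is_derive x (1 : R) (fun x : R => 2 * sin x) (2 * cos x).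
  exact: is_derive1Z.
have F'c : continuous (fun x : R => 2 * cos x).
  exact: (is_derive1_continuous (fun x => is_derive1Z 2 (is_derive_cos x))).
rewrite -{1}a5 -{1}b5.
rewrite (@integration_by_substitution_increasing _ (fun x : R => 2 * sin x)); first last.
- exact: continuous_subspaceT continuous_semicircle.
- exact: is_derive1_LRcontinuous Fd.
- by rewrite (is_derive1_derive Fd); apply/cvg_ex; exists (2 * cos t);
    exact/cvg_at_left_filter/F'c.
- by rewrite (is_derive1_derive Fd); apply/cvg_ex; exists (2 * cos s);
    exact/cvg_at_right_filter/F'c.
- by move=> x _; rewrite (is_derive1_derive Fd); exact: F'c.
- move=> x y; rewrite !in_itv /= => /andP[x1 x2] /andP[y1 y2] xy.
  rewrite ltr_pM2l // ltr_sin // in_itv /=; apply/andP; split.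
  + exact: le_trans x1.
  + exact: le_trans x2 _.
  + exact: le_trans y1.
  + exact: le_trans y2 _.
- exact: ltW.
rewrite (is_derive1_derive Fd).
have Pd (x : R) : is_derive x (1 : R) (fun x : R => pi^-1 * circle_arc x) (pi^-1 * (2 * cos x ^+ 2)).
  exact/is_derive1Z/is_derive_circle_arc.
rewrite (@eq_integral _ _ _ mu `[s, t] (fun x => (pi^-1 * (2 * cos x ^+ 2))%:E)); last first.
  move=> x; rewrite inE /= in_itv /= => /andP[x1 x2].
  have c0 : 0 <= cos x.
    by apply: cos_ge0_pihalf; apply/andP; split; [exact: le_trans x1|exact: le_trans x2 _].
  congr (_%:E).
  rewrite -[LHS]/((2 * pi)^-1 * Num.sqrt (4 - (2 * sin x) ^+ 2) * (2 * cos x)).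
  have -> : 4 - (2 * sin x) ^+ 2 = (2 * cos x) ^+ 2.
    by rewrite !exprMn cos2sin2; ring.
  rewrite sqrtr_sqr ger0_norm ?mulr_ge0 //.
  by have := lt0r_neq0 (pi_gt0 R); move: (pi : R) => q q0; field.
rewrite (@continuous_FTC2 _ _ (fun x : R => pi^-1 * circle_arc x) _ _ st).
- by rewrite -EFinB ![_ / pi]mulrC.
- apply: continuous_subspaceT => x; apply: cvgM; first exact: cvg_cst.
  apply: cvgM; first exact: cvg_cst.
  apply: (@continuous_comp _ _ _ cos (fun y : R => y ^+ 2)); first exact: continuous_cos.
  exact: exprn_continuous.
- exact: is_derive1_LRcontinuous Pd.
- by move=> x _; rewrite (is_derive1_derive Pd).
Qed.

Lemma semicircle_setI (I : interval R) : semicircle [set` I] =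
  (\int[mu]_(x in [set` (I `&` `[(-2)%R, 2%R])%O]) ((2 * pi)^-1 * Num.sqrt (4 - x ^+ 2))%:E)%E.
Proof.
rewrite set_itvI integral_mkcondr /semicircle; apply: eq_integral => x _.
rewrite /semicircle_density /patch indicE.
by case: (x \in _); rewrite ?mulr1 ?mulr0.
Qed.

(** Whether the bounds of [I] are open, closed or infinite, its part in [-2, 2] is recorded only up
    to the endpoints [a] and [b]: the semicircle law does not charge them, and [indic_step]
    tolerates either value there. *)
Lemma semicircle_itv (I : interval R) :
  (exists a b, [/\ -2 <= a, a <= b & b <= 2] /\
     [/\ forall x, a < x < b -> x \in I,
        forall x, -2 <= x <= 2 -> x \in I -> a <= x <= b
      & semicircle [set` I] = (semicircle_primitive b - semicircle_primitive a)%:E]) \/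
  ((forall x, -2 <= x <= 2 -> x \notin I) /\ semicircle [set` I] = 0%E).
Proof.
have IE x : -2 <= x <= 2 -> (x \in I) = (x \in (I `&` `[(-2)%R, 2%R])%O).
  by move=> x2; rewrite in_itvI [x \in `[_, _]]in_itv /= x2 andbT.
rewrite semicircle_setI.
have JE x : x \in (I `&` `[(-2)%R, 2%R])%O -> -2 <= x <= 2.
  by rewrite in_itvI => /andP[_]; rewrite in_itv.
have JI x : x \in (I `&` `[(-2)%R, 2%R])%O -> x \in I.
  by rewrite in_itvI => /andP[].
have Jle : ((I `&` `[(-2)%R, 2%R]) <= `[(-2)%R, 2%R])%O by exact: leIr.
move: Jle JI JE IE; set J := (_ `&` _)%O => Jle JI JE IE.
case EJ : J Jle => [l r] Jle; rewrite EJ in JI JE IE.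
have [lr|lr] := ltP l r; last first.
  right; split; last by rewrite set_itv_ge ?integral_set0 // -leNgt.
  move=> x x2; rewrite IE //; apply/negP => xJ.
  have : x \in [set` Interval l r] by rewrite inE.
  by rewrite set_itv_ge ?inE // -leNgt.
left.
move: Jle; rewrite subitvE => /andP[l2 r2].
case: l lr l2 JI JE IE EJ => [bl a|[]] lr l2 JI JE IE EJ //.
case: r lr r2 JI JE IE EJ => [br b|[]] lr r2 JI JE IE EJ //.
have a2 : -2 <= a by move: l2; case: (bl); rewrite bnd_simp // => /ltW.
have b2 : b <= 2 by move: r2; case: (br); rewrite bnd_simp // => /ltW.
have ab : a <= b by move: lr; case: (bl); case: (br); rewrite bnd_simp // => /ltW.
exists a, b; split; first by split.
split.
- move=> x /andP[ax xb]; apply: JI; rewrite in_itv /=.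
  by apply/andP; split; [case: (bl) => //=; exact: ltW|case: (br) => //=; exact: ltW].
- move=> x x2; rewrite IE // in_itv /= => /andP[ax xb]; apply/andP; split.
    by move: ax; case: (bl) => //= /ltW.
  by move: xb; case: (br) => //= /ltW.
transitivity (\int[mu]_(x in `[a, b]) ((2 * pi)^-1 * Num.sqrt (4 - x ^+ 2))%:E)%E.
  have e1 : (\int[mu]_(x in [set` Interval (BSide bl a) (BSide br b)])
      ((2 * pi)^-1 * Num.sqrt (4 - x ^+ 2))%:E =
     \int[mu]_(x in [set` Interval (BSide bl a) (BRight b)])
      ((2 * pi)^-1 * Num.sqrt (4 - x ^+ 2))%:E)%E.
    case: (br) => //; apply: integral_itv_bndo_bndc.
    apply/measurable_EFinP; apply: measurable_funTS.
    by apply: continuous_measurable_fun; exact: continuous_semicircle.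
  rewrite e1; case: (bl) => //; apply: integral_itv_obnd_cbnd.
  apply/measurable_EFinP; apply: measurable_funTS.
  by apply: continuous_measurable_fun; exact: continuous_semicircle.
have [ab'|ba] := ltP a b; first exact: integral_semicircle_itv.
have -> : a = b by apply/eqP; rewrite eq_le ab.
by rewrite set_itv1 integral_set1 subrr.
Qed.

End Semicircle.

(** * Recovering interval masses from Poisson averages *)

Section Desmoothing.
Variables (R : realType) (J : finType) (lam : J -> R) (h B : R).
Hypotheses (J_gt0 : (0 < #|J|)%N) (h_gt0 : 0 < h) (B_ge0 : 0 <= B).

Definition poisson (y u : R) : R := mean (fun j => y / ((lam j - u) ^+ 2 + y ^+ 2)).

Hypothesis poisson_le : forall u, -2 <= u <= 2 -> poisson h u <= B.
Hypothesis poisson_near : forall u y, -2 <= u <= 2 -> y = h \/ y = 2 * h ->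
  `|poisson y u - Num.sqrt (4 - u ^+ 2) / 2| * Num.sqrt (4 - u ^+ 2) <= B * y.

Let F (u : R) := mean (fun j => smooth_step ((u - lam j) / h)).

Let is_derive_F (u : R) :
  is_derive u (1 : R) F (2 * poisson h u - poisson (2 * h) u).
Proof.
have -> : 2 * poisson h u - poisson (2 * h) u =
    mean (fun j => (2 / (1 + ((u - lam j) / h) ^+ 2) - 2 / (4 + ((u - lam j) / h) ^+ 2)) / h).
  rewrite /poisson -meanZ -meanB; apply: eq_mean => j.
  have d2 := sqr_ge0 (u - lam j); have h2 : 0 < h ^+ 2 by rewrite exprn_gt0.
  have h3 : 0 < (2 * h) ^+ 2 by rewrite exprn_gt0 ?mulr_gt0.
  have -> : lam j - u = - (u - lam j) by rewrite opprB.
  move: (u - lam j) d2 => d d2; rewrite sqrrN; field.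
  by rewrite !gt_eqF // ltr_pwDl // mulr_gt0.
apply: is_derive1_mean => j.
apply: (@is_derive1_comp _ (@smooth_step R) (fun t => (t - lam j) / h)).
  exact: is_derive_smooth_step.
have := is_derive1D (is_derive1_linear h^-1 u) (is_derive_cst (- lam j / h) u (1 : R)).
rewrite addr0 (_ : (fun t => _) = (fun t => (t - lam j) / h)) //.
by apply/funext => t; rewrite mulrBl [_ * t]mulrC mulNr.
Qed.

(** In the variable [u = 2 * sin x] the chain rule produces [2 * cos x = sqrt (4 - u ^+ 2)], exactly
    the weight in [poisson_near]. The derivative of the difference is thus at most [4 * B * h] up to
    the edges, and [|t - s| <= 4]. *)
Let F_diff_aux (s t : R) : - (pi / 2) <= s -> s <= t -> t <= pi / 2 ->
  `|F (2 * sin t) - F (2 * sin s) - (circle_arc t - circle_arc s)| <= 16 * B * h.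
Proof.
move=> s1 st t1.
pose D (x : R) := F (2 * sin x) - circle_arc x.
pose dD (x : R) := (2 * poisson h (2 * sin x) - poisson (2 * h) (2 * sin x)) * (2 * cos x)
   - 2 * cos x ^+ 2.
have Dd (x : R) : is_derive x (1 : R) D (dD x).
  have h1 : is_derive x (1 : R) (fun x => F (2 * sin x))
     ((2 * poisson h (2 * sin x) - poisson (2 * h) (2 * sin x)) * (2 * cos x)).
    apply: (@is_derive1_comp _ F (fun x => 2 * sin x)); exact: is_derive_F.
  have := is_derive1D h1 (is_derive1Z (-1) (is_derive_circle_arc x)).
  rewrite (_ : (fun y => _) = D); last by apply/funext => y; rewrite mulN1r.
  by rewrite mulN1r.
have [c /andP[c1 c2] e] := MVT_global Dd st.
have -> : F (2 * sin t) - F (2 * sin s) - (circle_arc t - circle_arc s) = D t - D s.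
  by rewrite /D; ring.
rewrite e normrM.
have cs : -2 <= 2 * sin c <= 2.
  by have := sin_geN1 c; have := sin_le1 c; move=> *; apply/andP; split; lra.
have cc : 0 <= cos c.
  by apply: cos_ge0_pihalf; apply/andP; split; [exact: le_trans c1|exact: le_trans c2 _].
have sq : Num.sqrt (4 - (2 * sin c) ^+ 2) = 2 * cos c.
  have -> : 4 - (2 * sin c) ^+ 2 = (2 * cos c) ^+ 2 by rewrite !exprMn cos2sin2; ring.
  by rewrite sqrtr_sqr ger0_norm ?mulr_ge0.
have p1 := poisson_near cs (or_introl erefl).
have p2 := poisson_near cs (or_intror erefl).
rewrite !sq in p1 p2.
have dle : `|dD c| <= 4 * B * h.
  rewrite /dD; move: p1 p2.
  have -> : 2 * cos c / 2 = cos c by field.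
  move: (poisson h _) (poisson (2 * h) _) (cos c) cc => P1 P2 k k0 p1 p2.
  have -> : (2 * P1 - P2) * (2 * k) - 2 * k ^+ 2 = 2 * ((P1 - k) * (2 * k)) - (P2 - k) * (2 * k) by ring.
  apply: le_trans (ler_normB _ _) _; rewrite !normrM (ger0_norm k0) !(ger0_norm (ler0n _ 2)).
  by lra.
have ts : `|t - s| <= 4.
  by have := pihalf_lt2 R; rewrite ger0_norm ?subr_ge0 //; lra.
rewrite (_ : 16 * B * h = 4 * B * h * 4); last by ring.
exact: ler_pM.
Qed.

Let F_diff a b : -2 <= a -> a <= b -> b <= 2 ->
  `|F b - F a - pi * (semicircle_primitive b - semicircle_primitive a)| <= 16 * B * h.
Proof.
move=> a2 ab b2.
have [a3 a4 a5] := @asin_half R a (introT andP (conj a2 (le_trans ab b2))).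
have [b3 b4 b5] := @asin_half R b (introT andP (conj (le_trans a2 ab) b2)).
have st : asin (a / 2) <= asin (b / 2).
  have [->|nab] := eqVneq a b; first by [].
  by rewrite ltW // asin_half_lt // lt_neqAle nab.
have := F_diff_aux a3 st b4; rewrite a5 b5.
rewrite (_ : pi * _ = circle_arc (asin (b / 2)) - circle_arc (asin (a / 2))) //.
rewrite /semicircle_primitive -mulrBl mulrC divfK //.
by rewrite gt_eqF // pi_gt0.
Qed.

Let tail u j : R := 1 / (1 + ((u - lam j) / h) ^+ 2).

(* [tail u] is [h] times the Poisson kernel of width [h], so the error of the
   smoothing is controlled by [poisson_le] alone. *)
Let mean_tail u : -2 <= u <= 2 -> mean (tail u) <= B * h.
Proof.
move=> u2; apply: (@le_trans _ _ (h * poisson h u)); last first.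
  by rewrite mulrC ler_pM2r // poisson_le.
rewrite /poisson -meanZ; apply: ler_mean => j.
rewrite le_eqVlt; apply/orP; left; apply/eqP; rewrite /tail.
have d2 := sqr_ge0 (u - lam j); have h2 : 0 < h ^+ 2 by rewrite exprn_gt0.
have -> : lam j - u = - (u - lam j) by rewrite opprB.
move: (u - lam j) d2 => d d2; rewrite sqrrN; field.
by rewrite !gt_eqF // ltr_wpDl.
Qed.

(** Away from the endpoints each smoothed step is close to [pi / 2] or [- pi / 2], according to the
    side on which [l] lies. At an endpoint [A] is arbitrary, but one of the two error terms equals
    16 there, which covers the crude bound [pi + 12]. *)
Let indic_step (A : pred R) a b l : a <= b ->
  (forall x, a < x < b -> A x) -> (A l -> a <= l <= b) ->
  `|pi * ((A l : nat)%:R) - (smooth_step ((b - l) / h) - smooth_step ((a - l) / h))|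
  <= 16 / (1 + ((b - l) / h) ^+ 2) + 16 / (1 + ((a - l) / h) ^+ 2).
Proof.
move=> ab Ain Aout.
have hV : 0 < h^-1 by rewrite invr_gt0.
have sp u : l <= u -> `|smooth_step ((u - l) / h) - pi / 2| <= 16 / (1 + ((u - l) / h) ^+ 2).
  by move=> lu; apply: smooth_step_pos; rewrite divr_ge0 ?subr_ge0 // ltW.
have sn u : u <= l -> `|smooth_step ((u - l) / h) + pi / 2| <= 16 / (1 + ((u - l) / h) ^+ 2).
  by move=> lu; apply: smooth_step_neg; rewrite ler_pdivrMr // mul0r subr_le0.
have t0 u : 0 <= 16 / (1 + ((u - l) / h) ^+ 2).
  by rewrite divr_ge0 // addr_ge0 ?sqr_ge0.
have mid u : u = l -> 16 / (1 + ((u - l) / h) ^+ 2) = 16.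
  by move=> ->; rewrite subrr mul0r expr0n addr0 divr1.
have pi4 : (pi : R) <= 4 by have := pihalf_lt2 R; lra.
have pi0 := pi_ge0 R.
have crude : `|pi * ((A l : nat)%:R) - (smooth_step ((b - l) / h) - smooth_step ((a - l) / h))| <= 16.
  have := norm_smooth_step ((b - l) / h); have := norm_smooth_step ((a - l) / h).
  rewrite !ler_norml => /andP[? ?] /andP[? ?].
  by case: (A l); rewrite ?mulr1 ?mulr0; apply/andP; split; lra.
have ta := t0 a; have tb := t0 b.
have [la|la|la] := ltgtP l a.
- have nA : A l = false by apply: contraTF la => /Aout/andP[h1 _]; rewrite -leNgt.
  have := sp a (ltW la); have := sp b (ltW (lt_le_trans la ab)).
  rewrite nA mulr0 !ler_norml => /andP[? ?] /andP[? ?].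
  by apply/andP; split; lra.
- have [lb|lb|lb] := ltgtP l b.
  + have yA : A l by apply: Ain; rewrite la lb.
    have := sn a (ltW la); have := sp b (ltW lb).
    rewrite yA mulr1 !ler_norml => /andP[? ?] /andP[? ?].
    by apply/andP; split; lra.
  + have nA : A l = false by apply: contraTF lb => /Aout/andP[_ h1]; rewrite -leNgt.
    have := sn a (ltW la); have := sn b (ltW lb).
    rewrite nA mulr0 !ler_norml => /andP[? ?] /andP[? ?].
    by apply/andP; split; lra.
  + by apply: le_trans crude _; rewrite (mid b) //; lra.
- by apply: le_trans crude _; rewrite (mid a) //; lra.
Qed.

(** The error is 16 for the smoothed counts against the primitive and 16 for the tail at each
    endpoint; dividing 48 by [pi >= 2] leaves 24. *)
Let mean_indic (A : pred R) a b : -2 <= a -> a <= b -> b <= 2 ->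
  (forall x, a < x < b -> A x) -> (forall x, A x -> a <= x <= b) ->
  `|mean (fun j => (A (lam j) : nat)%:R) -
     (semicircle_primitive b - semicircle_primitive a)| <= 24 * B * h.
Proof.
move=> a2 ab b2 Ain Aout.
set Q := mean _; set S := semicircle_primitive b - semicircle_primitive a.
have h1 := F_diff a2 ab b2; rewrite -/S in h1.
have h2 : `|pi * Q - (F b - F a)| <= 32 * B * h.
  rewrite /Q /F -meanZ -!meanB.
  apply: (@le_trans _ _ (mean (fun j => 16 * tail b j + 16 * tail a j))).
    rewrite ler_norml; apply/andP; split.
      rewrite -meanN; apply: ler_mean => j.
      have := indic_step (l := lam j) ab Ain (Aout (lam j)).
      by rewrite /tail !mul1r ler_norml => /andP[].
    apply: ler_mean => j.
    have := indic_step (l := lam j) ab Ain (Aout (lam j)).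
    by rewrite /tail !mul1r ler_norml => /andP[].
  rewrite meanD (meanZ 16 (tail b)) (meanZ 16 (tail a)).
  have ma := mean_tail (introT andP (conj a2 (le_trans ab b2))).
  have mb := mean_tail (introT andP (conj (le_trans a2 ab) b2)).
  rewrite (_ : 32 * B * h = 16 * (B * h) + 16 * (B * h)); last by ring.
  by apply: lerD; rewrite ler_pM2l.
have p2 := pi_ge2 R.
have h3 : pi * `|Q - S| <= 48 * B * h.
  rewrite -[X in X * _](ger0_norm (pi_ge0 R)) -normrM.
  have -> : pi * (Q - S) = (pi * Q - (F b - F a)) + (F b - F a - pi * S) by ring.
  rewrite (_ : 48 * B * h = 32 * B * h + 16 * B * h); last by ring.
  exact: le_trans (ler_normD _ _) (lerD h2 h1).
have : 2 * `|Q - S| <= pi * `|Q - S| by rewrite ler_wpM2r.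
by lra.
Qed.

Lemma primitive_total : semicircle_primitive 2 - semicircle_primitive (-2) = 1 :> R.
Proof.
have pi0 := pi_gt0 R.
have e1 : asin (2 / 2 : R) = pi / 2.
  rewrite divff // -{1}(sin_pihalf R) sinK // in_itv /= lexx andbT.
  by have := pi_ge0 R; lra.
have e2 : asin (-2 / 2 : R) = - (pi / 2).
  rewrite mulNr divff // -{1}(sin_pihalf R) -sinN sinK // in_itv /= lexx /=.
  by have := pi_ge0 R; lra.
rewrite /semicircle_primitive e1 e2 /circle_arc sinN cosN sin_pihalf cos_pihalf !mulr0 !addr0.
by rewrite -mulrBl opprK -splitr divff // gt_eqF.
Qed.

(* Taking the interval [-2, 2] shows that the atoms outside of it are few. *)
Lemma desmoothing (I : interval R) : exists2 rho : R,
  semicircle [set` I] = rho%:E &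
  `|mean (fun j => (lam j \in I : nat)%:R) - rho| <= 48 * B * h.
Proof.
pose out j : R := ((lam j \notin `[(-2)%R, 2%R]) : nat)%:R.
have hout : mean out <= 24 * B * h.
  have := @mean_indic (mem `[(-2)%R, 2%R]) (-2) 2.
  rewrite primitive_total.
  have -> : mean out = 1 - mean (fun j => ((lam j \in `[(-2)%R, 2%R]) : nat)%:R).
    apply/eqP; rewrite eq_sym subr_eq -meanD; apply/eqP.
    rewrite -[LHS](mean_cst J_gt0).
    apply: eq_mean => j; rewrite /out.
    by case: (lam j \in _); rewrite /= ?addr0 ?add0r.
  move=> H; apply: le_trans (ler_norm _) _; rewrite distrC; apply: H => //; first by lra.
  by move=> x /andP[x1 x2]; rewrite inE /= in_itv /= !ltW.
pose A := [pred x : R | (x \in I) && (x \in `[(-2)%R, 2%R])].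
have close : `|mean (fun j => (lam j \in I : nat)%:R) - mean (fun j => (A (lam j) : nat)%:R)| <= 24 * B * h.
  rewrite -meanB; apply: le_trans hout; rewrite ler_norml; apply/andP; split.
    rewrite -meanN; apply: ler_mean => j; rewrite /out /=.
    by case: (lam j \in I); case: (_ \in `[_, _]); rewrite /= ?mulr1n ?mulr0n ?subrr ?subr0 ?oppr0 // lerN10.
  apply: ler_mean => j; rewrite /out /=.
  by case: (lam j \in I); case: (_ \in `[_, _]); rewrite /= ?mulr1n ?mulr0n ?subrr ?subr0.
have [[a [b [[a2 ab b2] [Iin Iout sE]]]]|[Iout sE]] := semicircle_itv I.
  exists (semicircle_primitive b - semicircle_primitive a) => //.
  have AI : `|mean (fun j => (A (lam j) : nat)%:R) -
      (semicircle_primitive b - semicircle_primitive a)| <= 24 * B * h.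
    apply: mean_indic => // x.
      move=> xab; rewrite /= Iin //= in_itv /=; case/andP: xab => xa xb.
      by rewrite (le_trans a2 (ltW xa)) (le_trans (ltW xb) b2).
    rewrite /= [x \in `[_, _]]in_itv /= => /andP[xI x2]; exact: Iout.
  rewrite (_ : 48 * B * h = 24 * B * h + 24 * B * h); last by ring.
  exact: le_trans (ler_distD _ _ _) (lerD close AI).
exists 0 => //; rewrite subr0.
have A0 : mean (fun j => (A (lam j) : nat)%:R) = 0 :> R.
  rewrite -[RHS](mean_cst J_gt0); apply: eq_mean => j /=.
  case: (boolP (_ \in `[_, _])); rewrite ?andbF // in_itv /= => l2.
  by rewrite (negbTE (Iout _ l2)).
move: close; rewrite A0 subr0 => /le_trans; apply.
have : 0 <= B * h by rewrite mulr_ge0 // ltW.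
by lra.
Qed.

End Desmoothing.

(** * Interlacing *)

Lemma exists_row_annihilated (K : fieldType) (p m : nat) (A : 'M[K]_(p, m)) :
  (m < p)%N -> exists2 v : 'rV[K]_p, v != 0 & v *m A = 0.
Proof.
move=> mp; have : kermx A != 0.
  rewrite -mxrank_eq0 mxrank_ker -lt0n subn_gt0.
  exact: leq_ltn_trans (rank_leq_col A) mp.
by case/rowV0Pn => v /sub_kermxP vA v0; exists v.
Qed.

(** If the two weights have equal totals and the two forms equal values, the right side vanishes;
    yet all terms on the left are nonnegative once [c] sits on small [d] and [c'] on large [d'].
    This compares the forms without naming a threshold. *)
Lemma sum_cross (R : comPzRingType) (I : finType) (d d' c c' : I -> R) :
  \sum_i \sum_j (d' j - d i) * (c i * c' j) =
  (\sum_i c i) * (\sum_j d' j * c' j) - (\sum_i d i * c i) * (\sum_j c' j).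
Proof.
rewrite !mulr_suml -sumrB; apply: eq_bigr => i _.
by rewrite !mulr_sumr -sumrB; apply: eq_bigr => j _; ring.
Qed.

Section Interlacing.
Variables (R : realType) (p : nat) (k : 'I_p).
Variables (H H' U U' : 'M[R[i]]_p) (d d' : 'I_p -> R).
Hypotheses (Uu : U \is unitarymx) (Uu' : U' \is unitarymx).
Hypothesis HE : H = U^t* *m diag_mx (\row_i (d i)%:C) *m U.
Hypothesis HE' : H' = U'^t* *m diag_mx (\row_i (d' i)%:C) *m U'.
Hypothesis HH' : forall i j, i != k -> j != k -> H i j = H' i j.

Lemma quadratic_form_spectral (V : 'M[R[i]]_p) (e : 'I_p -> R) (v : 'rV[R[i]]_p) :
  (v *m (V^t* *m diag_mx (\row_i (e i)%:C) *m V) *m v^t*) 0 0 =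
  (\sum_i e i * cabs ((v *m V^t*) 0 i) ^+ 2)%:C.
Proof.
have -> : v *m (V^t* *m diag_mx (\row_i (e i)%:C) *m V) *m v^t* =
  (v *m V^t*) *m diag_mx (\row_i (e i)%:C) *m (v *m V^t*)^t*.
  by rewrite adjmxM trmxCK !mulmxA.
move: (v *m V^t*) => c; rewrite mxE rmorph_sum; apply: eq_bigr => i _.
rewrite rmorphM /= -mul_conj_cabs mul_mx_diag !mxE.
by rewrite mulrCA mulrA.
Qed.

Lemma sum_sqr_unitary (V : 'M[R[i]]_p) (v : 'rV[R[i]]_p) : V \is unitarymx ->
  \sum_i cabs ((v *m V^t*) 0 i) ^+ 2 = \sum_i cabs (v 0 i) ^+ 2.
Proof.
move=> Vu; have VV : V^t* *m V = 1%:M by apply: mulmx1C; exact/unitarymxP.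
apply: complexI; rewrite -!mulmx_adj_diag adjmxM trmxCK.
by rewrite mulmxA -(mulmxA v) VV mulmx1.
Qed.

(* By dimension count there is a nonzero [v] with [v 0 k = 0] on which the form
   of [H] only sees eigenvalues in [L] and that of [H'] only those outside. *)
Lemma interlacing (L : pred R) :
  (forall s t, L s -> ~~ L t -> s < t) ->
  (#|[set i | L (d i)]%SET| <= #|[set i | L (d' i)]%SET|.+1)%N.
Proof.
move=> Ldown; set P := [set i | _]%SET; set P' := [set i | _]%SET.
rewrite leqNgt; apply/negP => PP'.
pose A1 := \matrix_(i < p, j < #|~: P|%SET) (U^t*) i (enum_val j).
pose A2 := \matrix_(i < p, j < #|P'|) (U'^t*) i (enum_val j).
pose A3 : 'M[R[i]]_(p, 1) := delta_mx k 0.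
have lt_p : (#|~: P|%SET + (#|P'| + 1) < p)%N.
  have := cardsC P; rewrite card_ord => cP.
  by rewrite -[X in (_ < X)%N]cP addnC ltn_add2r addn1.
have [v v0 vA] := exists_row_annihilated (row_mx A1 (row_mx A2 A3)) lt_p.
move: vA; rewrite !mul_mx_row => /eqP; rewrite !row_mx_eq0 => /and3P[/eqP vA1 /eqP vA2 /eqP vA3].
have vk : v 0 k = 0.
  by move: vA3 => /matrixP/(_ 0 0); rewrite -colE !mxE.
pose c i := cabs ((v *m U^t*) 0 i) ^+ 2.
pose c' i := cabs ((v *m U'^t*) 0 i) ^+ 2.
have cP i : ~~ L (d i) -> c i = 0.
  move=> Li; have iP : i \in (~: P)%SET by rewrite !inE.
  have := vA1 => /matrixP/(_ 0 (enum_rank_in iP i)); rewrite !mxE.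
  under eq_bigr => j _ do rewrite mxE enum_rankK_in //.
  by rewrite /c mxE => ->; rewrite cabs0 expr0n.
have cP' i : L (d' i) -> c' i = 0.
  move=> Li; have iP : i \in P' by rewrite !inE.
  have := vA2 => /matrixP/(_ 0 (enum_rank_in iP i)); rewrite !mxE.
  under eq_bigr => j _ do rewrite mxE enum_rankK_in //.
  by rewrite /c' mxE => ->; rewrite cabs0 expr0n.
have c_ge0 i : 0 <= c i by exact: sqr_ge0.
have c'_ge0 i : 0 <= c' i by exact: sqr_ge0.
have N0 : 0 < \sum_i cabs (v 0 i) ^+ 2.
  rewrite lt_neqAle sumr_ge0 ?andbT; last by move=> *; exact: sqr_ge0.
  apply: contraNneq v0 => /esym s0; apply/eqP/rowP => i; rewrite mxE.
  have /(_ i isT)/eqP := psumr_eq0P (fun i _ => sqr_ge0 (cabs (v 0 i))) s0.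
  by rewrite sqrf_eq0 cabs_eq0 => /eqP.
have sc : \sum_i c i = \sum_i cabs (v 0 i) ^+ 2 by exact: sum_sqr_unitary.
have sc' : \sum_i c' i = \sum_i cabs (v 0 i) ^+ 2 by exact: sum_sqr_unitary.
have qE : \sum_i d i * c i = \sum_i d' i * c' i.
  have e1 := quadratic_form_spectral U d v; have e2 := quadratic_form_spectral U' d' v.
  rewrite -HE in e1; rewrite -HE' in e2.
  apply: complexI; rewrite -[LHS]e1 -[RHS]e2 {e1 e2}.
  rewrite ![(_ *m _ *m _) 0 0]mxE; apply: eq_bigr => j _.
  have [->|jk] := eqVneq j k; first by rewrite ![(v^t*) _ _]mxE !mxE vk conjC0 !mulr0.
  congr (_ * _); rewrite !mxE; apply: eq_bigr => i _.
  by have [->|ik] := eqVneq i k; [rewrite vk !mul0r|rewrite HH'].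
clearbody c c'.
have pos i j : 0 <= (d' j - d i) * (c i * c' j).
  have [Li|Li] := boolP (L (d i)); last by rewrite (cP _ Li) mul0r mulr0.
  have [Lj|Lj] := boolP (L (d' j)); first by rewrite (cP' _ Lj) !mulr0.
  by rewrite mulr_ge0 ?mulr_ge0 // subr_ge0 ltW // Ldown.
have tot : \sum_i \sum_j (d' j - d i) * (c i * c' j) = 0.
  rewrite (sum_cross d d' c c').
  by rewrite sc sc' qE mulrC subrr.
have [i ci] : exists i, c i != 0.
  apply/existsP; apply: contraLR N0; rewrite negb_exists => /forallP h.
  by rewrite -sc big1 ?ltxx // => i _; apply/eqP; have := h i; rewrite negbK.
have [j cj] : exists j, c' j != 0.
  apply/existsP; apply: contraLR N0; rewrite negb_exists => /forallP h.
  by rewrite -sc' big1 ?ltxx // => j _; apply/eqP; have := h j; rewrite negbK.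
have Li : L (d i) by apply: contraR ci => /cP ->.
have Lj : ~~ L (d' j) by apply: contraNN cj => /cP' ->.
have /(_ i isT) rowi := psumr_eq0P (fun i _ => sumr_ge0 _ (fun j _ => pos i j)) tot.
have /(_ j isT)/eqP := psumr_eq0P (fun j _ => pos i j) rowi.
rewrite !mulf_eq0 (negbTE ci) (negbTE cj) !orbF subr_eq0 => /eqP e.
by have := Ldown _ _ Li Lj; rewrite e ltxx.
Qed.

End Interlacing.

(** * The character matrix of a code *)

(** The trace is the sum of distinct automorphisms with all coefficients 1, so it cannot vanish
    identically, by Dedekind's independence of characters. *)
Lemma galTrace_nontrivial (K0 : fieldType) (L : splittingFieldType K0)
  (K : {vspace L}) (E : {subfield L}) : exists a, galTrace K E a != 0.
Proof.
have [a _ h] := @gal_independent_contra _ L E (mem ('Gal(E / K))%g) (fun=> 1) 1%g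
  (group1 _) (oner_neq0 L).
exists a; apply: contraNneq h => h; rewrite -[X in _ == X]h /galTrace; apply/eqP.
by apply: eq_big => [y|y _]; rewrite ?mul1r.
Qed.

Lemma double_angle_eq1 (R : realFieldType) (c s : R) : c + s = 1 -> 1 = c + c - 1 -> s = 0.
Proof. by move=> ? ?; lra. Qed.

Section StandardCharacter.
Variables (R : realType) (F : finFieldType).
Local Notation r := (char_of F).
Local Notation psi := (@std_char R F).

Let r_gt0 : (0 < r)%N. Proof. exact/prime_gt0/pcharf_prime/char_ofP. Qed.

Lemma cexpX (x : R) (m : nat) :
  (cos x +i* sin x) ^+ m = cos (m%:R * x) +i* sin (m%:R * x).
Proof.
elim: m => [|m IH]; first by rewrite expr0 mul0r cos0 sin0.
rewrite exprS IH -natr1 mulrDl mul1r addrC cosD sinD.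
apply/eqP; rewrite eq_complex /=; apply/andP; split; apply/eqP; ring.
Qed.

Lemma zeta_expr (m : nat) : zeta R r ^+ m =
  cos (m%:R * (2 * pi / r%:R)) +i* sin (m%:R * (2 * pi / r%:R)).
Proof. exact: cexpX. Qed.

Lemma zeta_order : zeta R r ^+ r = 1.
Proof.
have r0 : (r%:R : R) != 0 by rewrite pnatr_eq0 -lt0n.
rewrite zeta_expr mulrC divfK // mulr_natl cos2pi sin2pi.
by [].
Qed.

Lemma cabs_zeta : cabs (zeta R r) = 1.
Proof. by rewrite /cabs /zeta /= cos2Dsin2 sqrtr1. Qed.

Lemma cabs_std_char a : cabs (psi a) = 1.
Proof. by rewrite /std_char cabsX cabs_zeta expr1n. Qed.

Lemma abs_traceD (a b : F) : abs_trace (a + b) = abs_trace a + abs_trace b.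
Proof.
by rewrite /abs_trace; exact: (raddfD (galTrace 1%VS {: pPrimeCharType (char_ofP F)}%VS)).
Qed.

Lemma eqn_mod_char (m k : nat) : (m%:R : F) = k%:R -> m = k %[mod r].
Proof.
wlog mk : m k / (k <= m)%N.
  by move=> H; case: (leqP k m) => [|/ltnW] h e; [|symmetry]; apply: H.
move=> e; apply/eqP; rewrite eqn_mod_dvd // (dvdn_pcharf (char_ofP F)) natrB //.
by rewrite e subrr.
Qed.

Lemma std_charD a b : psi (a + b) = psi a * psi b.
Proof.
rewrite /std_char -exprD -(expr_mod _ zeta_order) -[RHS](expr_mod _ zeta_order).
congr (_ ^+ _); apply: eqn_mod_char.
by rewrite natrD !abs_trace_natE abs_traceD.
Qed.

Lemma abs_trace_nontrivial : exists a : F, abs_trace a != 0.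
Proof.
exact: (@galTrace_nontrivial _ (pPrimeCharType (char_ofP F)) 1%VS {: _}%AS).
Qed.

(** The residue [j] of a nonzero trace satisfies [0 < j < r], so half the angle of the power of
    [zeta] lies strictly between 0 and [pi] and has positive sine; a cosine equal to 1 would make
    that sine vanish. *)
Lemma std_char_nontrivial : exists a, psi a != 1.
Proof.
have [a a0] := abs_trace_nontrivial; exists a.
rewrite /std_char /abs_trace_nat; case: pickP => [j /eqP jE|no]; last first.
  have := abs_trace_natE a; rewrite /abs_trace_nat; case: pickP => [j|_] /=.
    by rewrite no.
  by move=> h; rewrite -h eqxx in a0.
have j0 : (0 < j)%N by rewrite lt0n; apply: contraNneq a0 => h; rewrite -jE h.
rewrite zeta_expr; set x := _ * _.
have r0 : 0 < (r%:R : R) by rewrite ltr0n.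
have xE : x / 2 = pi * (j%:R / r%:R) by rewrite /x; field; rewrite gt_eqF.
have sx : 0 < sin (x / 2).
  apply: sin_gt0_pi; rewrite xE mulr_gt0 ?pi_gt0 ?divr_gt0 ?ltr0n //=.
  by rewrite gtr_pMr ?pi_gt0 // ltr_pdivrMr // mul1r ltr_nat.
apply/negP; rewrite eq_complex /= => /andP[/eqP cx _].
have : sin (x / 2) ^+ 2 = 0.
  have x2 : x = x / 2 *+ 2 by rewrite -[RHS]mulr_natr divfK.
  have := cos_mulr2n (x / 2); rewrite -x2 cx mulr2n.
  by move/(double_angle_eq1 (cos2Dsin2 (x / 2))).
by move/eqP; rewrite sqrf_eq0 gt_eqF.
Qed.

Lemma std_charN a : psi (- a) = ((psi a)^*)%R.
Proof.
have p0 : psi a != 0 by rewrite -cabs_eq0 cabs_std_char oner_neq0.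
apply: (mulfI p0); rewrite -std_charD subrr mul_conj_cabs cabs_std_char expr1n.
have /(congr1 (fun t => t / psi 0)) := std_charD 0 0.
have p00 : psi 0 != 0 by rewrite -cabs_eq0 cabs_std_char oner_neq0.
by rewrite addr0 mulfK // divff.
Qed.

Lemma std_char_mul_conj a b : psi a * ((psi b)^*)%R = psi (a - b).
Proof. by rewrite std_charD std_charN. Qed.

End StandardCharacter.

Section CodeMoments.
Variables (R : realType) (F : finFieldType) (n : nat) (C : {vspace 'rV[F]_n}).
Local Notation psi := (@std_char R F).

Definition codewords : {set 'rV[F]_n} := [set c | c \in C]%SET.

Definition codeword (t : 'I_#|codewords|) : 'rV[F]_n := enum_val t.

Definition char_row (t : 'I_#|codewords|) : 'rV[R[i]]_n :=
  \row_j psi (codeword t 0 j).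

Lemma card_codewords_gt0 : (0 < #|'I_#|codewords| |)%N.
Proof.
by rewrite card_ord; apply/card_gt0P; exists 0; rewrite inE mem0v.
Qed.

Lemma char_row_unimodular : unimodular char_row.
Proof. by move=> t j; rewrite mxE mul_conj_cabs cabs_std_char expr1n. Qed.

Definition dot (a c : 'rV[F]_n) : F := \sum_i a 0 i * c 0 i.

(** Some codeword is not orthogonal to [a], and a multiple [c1] of it has [dot a c1 = b] with
    [psi b != 1]. Translating the sum over the code by [c1] multiplies it by [psi b]. *)
Lemma mean_char_dot a : ~ dual_code C a ->
  mean (fun t => psi (dot a (codeword t))) = 0.
Proof.
move=> /existsNP[c0 /not_implyP[c0C /eqP ac0]].
have [b b1] := std_char_nontrivial R F.
pose s := dot a c0; pose c1 := (b / s) *: c0.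
have ac1 : dot a c1 = b.
  rewrite /dot /c1; under eq_bigr => i _ do rewrite mxE mulrCA.
  by rewrite -mulr_sumr divfK.
have c1C : c1 \in C by rewrite memvZ.
pose S := \sum_(c in codewords) psi (dot a c).
have e : S = psi b * S.
  rewrite {1}/S (reindex_inj (addrI c1)) mulr_sumr; apply: eq_big => [c|c _].
    by rewrite !inE rpredDl.
  rewrite -std_charD -ac1 /dot -big_split; congr (psi _).
  by apply: eq_bigr => i _; rewrite mxE mulrDr.
have S0 : S = 0.
  apply/eqP; rewrite -[_ == 0](mulrI_eq0 _ (mulfI (_ : 1 - psi b != 0))).
    by rewrite mulrBl mul1r -e subrr.
  by rewrite subr_eq0 eq_sym.
by rewrite /mean -(big_enum_val (fun c => psi (dot a c))) -/S S0 mul0r.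
Qed.

Hypothesis C5 : dual_distance_ge C 5.

Lemma mean_char_small_support (a : 'rV[F]_n) (s : seq 'I_n) : a != 0 -> (size s <= 4)%N ->
  (forall i, a 0 i != 0 -> i \in s) ->
  mean (fun t => psi (dot a (codeword t))) = 0.
Proof.
move=> a0 s4 h; apply: mean_char_dot => /C5/(_ a0).
apply/negP; rewrite -ltnNge ltnS; apply: leq_trans s4.
apply: leq_trans (card_size s); apply: subset_leq_card; apply/fintype.subsetP => i.
by rewrite inE; exact: h.
Qed.

Lemma dot_delta j c : dot (delta_mx 0 j) c = c 0 j.
Proof.
rewrite /dot (bigD1 j) //= mxE !eqxx mul1r big1 ?addr0 // => i /negbTE ij.
by rewrite mxE ij mul0r.
Qed.

Lemma dotB a b c : dot (a - b) c = dot a c - dot b c.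
Proof.
by rewrite /dot -sumrB; apply: eq_bigr => i _; rewrite !mxE mulrBl.
Qed.

Lemma char_row_orthogonal : orthogonal_coords char_row.
Proof.
move=> j l jl; pose a : 'rV[F]_n := delta_mx 0 j - delta_mx 0 l.
rewrite (@eq_mean _ _ _ (fun t => psi (dot a (codeword t)))); last first.
  by move=> t; rewrite !mxE std_char_mul_conj dotB !dot_delta.
apply: (@mean_char_small_support _ [:: j; l]) => //.
  apply/negP => /eqP/rowP/(_ j); rewrite !mxE !eqxx (negbTE jl) subr0.
  exact/eqP/oner_neq0.
move=> i; rewrite !inE !mxE /=; apply: contraR; rewrite negb_or.
by case/andP => /negbTE-> /negbTE->; rewrite subr0.
Qed.

(** The moment is a character sum along a vector of support at most 4, and the excluded pairs are
    what makes it nonzero: equal pairs would give 0, and swapped pairs twice a vector, which is 0 in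
    characteristic 2. *)
Lemma char_row_fourth_moments : iid_fourth_moments char_row.
Proof.
move=> j l j' l' jl jl' n1 n2.
pose a : 'rV[F]_n := (delta_mx 0 j - delta_mx 0 l) - (delta_mx 0 j' - delta_mx 0 l').
rewrite (@eq_mean _ _ _ (fun t => psi (dot a (codeword t)))); last first.
  by move=> t; rewrite !mxE !std_char_mul_conj !dotB !dot_delta.
apply: (@mean_char_small_support _ [:: j; l; j'; l']) => //; last first.
  move=> i; rewrite !inE !mxE /=; apply: contraR; rewrite !negb_or.
  by case/and4P => /negbTE-> /negbTE-> /negbTE-> /negbTE->; rewrite !subr0.
apply/negP => /eqP/rowP a0.
have := a0 j; have := a0 l; rewrite !mxE !eqxx /= [l == j]eq_sym (negbTE jl) subr0 sub0r.
have [e1|n3] := eqVneq j j'.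
  subst j'; have ll' : l != l' by apply: contraNneq n1 => ->.
  rewrite (negbTE ll') [l == j]eq_sym (negbTE jl) subr0 subr0 => /eqP.
  by rewrite oppr_eq0 oner_eq0.
have [e2|n4] := eqVneq j l'; last first.
  by move=> _ /eqP; rewrite subrr subr0 oner_eq0.
subst l'; have lj' : l != j' by apply: contraNneq n2 => ->.
rewrite (negbTE lj') [l == j]eq_sym (negbTE jl) subrr subr0 => /eqP.
by rewrite oppr_eq0 oner_eq0.
Qed.

End CodeMoments.

(** * The expected spectral measure *)

Section Eigenvalues.
Variables (R : realType) (p : nat).
Implicit Types (A U : 'M[R[i]]_p) (d : 'I_p -> R).

Lemma char_poly_spectral A U d : U \is unitarymx ->
  A = U^t* *m diag_mx (\row_i (d i)%:C) *m U ->
  char_poly A = \prod_i ('X - ((d i)%:C)%:P).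
Proof.
move=> Uu AE; set D := diag_mx _ in AE.
have UU : U^t* *m U = 1%:M by apply: mulmx1C; exact/unitarymxP.
have e : char_poly_mx A = map_mx polyC (U^t*) *m char_poly_mx D *m map_mx polyC U.
  rewrite /char_poly_mx mulmxBr mulmxBl -!map_mxM -AE; congr (_ - _).
  by rewrite mul_mx_scalar -scalemxAl -map_mxM UU map_mx1 scalemx1.
rewrite /char_poly e !det_mulmx mulrAC -det_mulmx -map_mxM UU map_mx1 det1 mul1r.
rewrite -/(char_poly D) char_poly_trig ?diag_mx_is_trig //.
by apply: eq_bigr => i _; rewrite !mxE eqxx.
Qed.

Lemma eigenvalues_spectral A U d : U \is unitarymx ->
  A = U^t* *m diag_mx (\row_i (d i)%:C) *m U ->
  perm_eq (eigenvalues A) [seq (d i)%:C | i <- enum 'I_p].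
Proof.
move=> Uu AE; apply: prod_XsubC_eq; rewrite -eigenvaluesE (char_poly_spectral Uu AE).
by rewrite big_map big_enum.
Qed.

Lemma size_eigenvalues A : A^t* = A -> size (eigenvalues A) = p.
Proof.
move=> Ah; have [U [d [Uu AE]]] := herm_spectral Ah.
by rewrite (perm_size (eigenvalues_spectral Uu AE)) size_map size_enum_ord.
Qed.

(** Indexing by ['I_p] lets empirical averages be written with [mean]; the default 0 is never
    reached when [A] is Hermitian. *)
Definition eigenvalue_at A (i : 'I_p) : R := complex.Re (nth 0 (eigenvalues A) i).

Lemma sum_eigenvalue_at A (V : nmodType) (g : R -> V) : A^t* = A ->
  \sum_i g (eigenvalue_at A i) = \sum_(z <- eigenvalues A) g (complex.Re z).
Proof.
by move=> Ah; rewrite (big_nth 0) (size_eigenvalues Ah) big_mkord.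
Qed.

Lemma sum_eigenvalues_spectral A U d (V : nmodType) (g : R -> V) : U \is unitarymx ->
  A = U^t* *m diag_mx (\row_i (d i)%:C) *m U ->
  \sum_(z <- eigenvalues A) g (complex.Re z) = \sum_i g (d i).
Proof.
move=> Uu AE; rewrite (perm_big _ (eigenvalues_spectral Uu AE)) big_map big_enum.
by [].
Qed.

Lemma trace_res_eigenvalues A z : A^t* = A -> 0 < complex.Im z ->
  \tr (res A z) = \sum_i ((eigenvalue_at A i)%:C - z)^-1.
Proof.
move=> Ah z0; have [U [d [Uu AE]]] := herm_spectral Ah.
rewrite (trace_res z0 Uu AE) (sum_eigenvalue_at (fun s => (s%:C - z)^-1) Ah).
by rewrite (sum_eigenvalues_spectral (fun s => (s%:C - z)^-1) Uu AE).
Qed.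

Lemma Im_inv_sub (s u y : R) : y != 0 ->
  complex.Im (s%:C - (u +i* y))^-1 = y / ((s - u) ^+ 2 + y ^+ 2).
Proof. by move=> y0; rewrite /= !sub0r sqrrN mulNr opprK. Qed.

End Eigenvalues.

Lemma error_budget (R : realFieldType) (a b b' c c' y : R) :
  1332 * a <= y -> 1332 * (b * b') <= y -> 1332 * (c * c') <= y ->
  201 * a + 4 * b * b' + 128 * c * c' <= y / 4.
Proof. by move=> ? ? ?; lra. Qed.

Section ExpectedSpectrum.
Variables (R : realType) (T : finType) (n p : nat) (x : T -> 'rV[R[i]]_n).
Hypotheses (T_gt0 : (0 < #|T|)%N) (n_gt0 : (0 < n)%N) (p_gt0 : (0 < p)%N).
Hypotheses (xU : unimodular x) (xO : orthogonal_coords x) (x4 : iid_fourth_moments x).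
Hypothesis p_le_n : (p <= n)%N.
Local Notation M w := (centered_gram (data_mx x w)).
Local Notation kap := (Num.sqrt (p%:R / n%:R : R)).

Definition spectral_count (I : interval R) (w : {ffun 'I_p -> T}) : R :=
  mean (fun i => (eigenvalue_at (M w) i \in I : nat)%:R).

(** Indexing by sample and position at once makes the expected spectral measure itself the uniform
    measure of a finite family of atoms, the setting of [desmoothing]. *)
Definition joint_eigenvalue (a : {ffun 'I_p -> T} * 'I_p) : R :=
  eigenvalue_at (M a.1) a.2.

Lemma mean_pair (I J : finType) (K : numFieldType) (f : I * J -> K) :
  mean f = mean (fun i => mean (fun j => f (i, j))).
Proof.
rewrite /mean -mulr_suml card_prod natrM invfM [in RHS]mulrAC mulrA; congr (_ * _ * _).
by rewrite pair_big; apply: eq_bigr => -[].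
Qed.

Lemma poisson_stieltjes (u y : R) : 0 < y ->
  poisson joint_eigenvalue y u = complex.Im (mean (@stieltjes R T n p x (u +i* y))).
Proof.
move=> y0; rewrite /poisson mean_pair Im_mean; apply: eq_mean => w.
have zy : 0 < complex.Im (u +i* y) by [].
rewrite /stieltjes (trace_res_eigenvalues (centered_gram_herm (data_mx x w)) zy).
rewrite -[X in X%:R^-1 * _](card_ord p) mulrC -/(mean _) Im_mean.
by apply: eq_mean => i; rewrite Im_inv_sub // gt_eqF.
Qed.

(* [2496 = 48 * 52], and [1332 = 4 * (201 + 4 + 128)] makes the error of
   [self_consistent] at most a quarter of the imaginary part. *)
Lemma expected_spectrum (h : R) (I : interval R) : 0 < h <= 1 / 2 ->
  1332 / p%:R <= h ^+ 4 -> 1332 * kap <= h ^+ 4 ->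
  exists2 rho : R, semicircle [set` I] = rho%:E &
    `|mean (spectral_count I) - rho| <= 2496 * h.
Proof.
move=> /andP[h0 h1] hp hk.
have pR : 0 < (p%:R : R) by rewrite ltr0n.
have kap0 : 0 <= kap by exact: sqrtr_ge0.
have bound y : y = h \/ y = 2 * h ->
    [/\ 0 < y, y <= 1 &
     201 / (p%:R * y ^+ 3) + 4 * kap / y + 128 * kap ^+ 2 / y ^+ 3 <= y / 4].
  move=> yh.
  have y0 : 0 < y by case: yh => ->; lra.
  have y1 : y <= 1 by case: yh => ->; lra.
  have hy : h <= y by case: yh => ->; lra.
  have hy4 : h ^+ 4 <= y ^+ 4 by rewrite lerXn2r ?nnegrE // ltW.
  split => //.
  have y3 : 0 < y ^+ 3 by rewrite exprn_gt0.
  have y41 : y ^+ 4 <= 1 by rewrite exprn_ile1 // ltW.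
  have k1 : 1332 * kap <= y ^+ 4 by apply: le_trans hy4.
  have a1 : 1332 / (p%:R * y ^+ 3) <= y.
    rewrite invfM mulrA ler_pdivrMr // -exprS.
    exact: le_trans hp hy4.
  have y31 : y ^+ 3 <= y by rewrite exprS ler_piMr ?exprn_ile1 // ltW.
  have a2 : 1332 * (kap / y) <= y.
    rewrite mulrA ler_pdivrMr //; apply: le_trans k1 _.
    by rewrite exprS exprS mulrA ler_piMr ?exprn_ile1 ?mulr_ge0 // ltW.
  have kap1 : kap <= 1.
    by apply: le_trans (le_trans k1 y41); rewrite ler_peMl // ler1n.
  have k2 : 1332 * kap ^+ 2 <= y ^+ 4.
    by apply: le_trans k1; rewrite ler_wpM2l ?ler0n // expr2 ler_piMl.
  have a3 : 1332 * (kap ^+ 2 / y ^+ 3) <= y.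
    by rewrite mulrA ler_pdivrMr // -exprS.
  exact: error_budget a1 a2 a3.
have J_gt0 : (0 < #|{: {ffun 'I_p -> T} * 'I_p}|)%N.
  by rewrite card_prod muln_gt0 card_ffun expn_gt0 T_gt0 card_ord.
have stab u y : -2 <= u <= 2 -> y = h \/ y = 2 * h ->
    poisson joint_eigenvalue y u <= 24 /\
    `|poisson joint_eigenvalue y u - Num.sqrt (4 - u ^+ 2) / 2| * Num.sqrt (4 - u ^+ 2)
      <= 52 * y.
  move=> u2 yh; have [y0 y1 rb] := bound y yh.
  have yy : 0 < y <= 1 by rewrite y0.
  rewrite poisson_stieltjes //.
  have zy : 0 < complex.Im (u +i* y) by [].
  have z3 := cabs_spectral_param u2 yy.
  have [r rE rle] := self_consistent T_gt0 n_gt0 p_gt0 xU xO x4 zy y1 z3 p_le_n.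
  have [f24 fn] := stability u2 yy (Im_mean_stieltjes_ge0 p x zy) rE (le_trans rle rb).
  by split => //; apply: le_trans (Im_le_cabs _) f24.
have [rho rhoE close] := @desmoothing R _ joint_eigenvalue h 52 J_gt0 h0 (ler0n _ _)
  (fun u u2 => le_trans (stab u h u2 (or_introl erefl)).1 (ler_nat _ 24 52 : 24 <= 52))
  (fun u y u2 yh => (stab u y u2 yh).2) I.
exists rho => //.
by rewrite mean_pair in close; apply: le_trans close _; rewrite -natrM.
Qed.

End ExpectedSpectrum.

(** * Concentration of the eigenvalue counts *)

Lemma norm_natB_le1 (R : realDomainType) (a b : nat) :
  (a <= b.+1)%N -> (b <= a.+1)%N -> `|a%:R - b%:R| <= 1 :> R.
Proof.
rewrite -!(ler_nat R) -!natr1 ler_norml => h1 h2.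
by apply/andP; split; lra.
Qed.

Lemma norm_sub_sub_le2 (R : realDomainType) (a b a' b' : R) :
  `|a - b| <= 1 -> `|a' - b'| <= 1 -> `|(a - a') - (b - b')| <= 2.
Proof.
move=> h h'; have -> : (a - a') - (b - b') = (a - b) - (a' - b') by ring.
by apply: le_trans (ler_normB _ _) _; lra.
Qed.

Lemma lt_dist_triangle (R : realDomainType) (a m r d t : R) :
  `|m - r| <= d -> d + t < `|a - r| -> t < `|a - m|.
Proof. by move=> h1 h2; have := ler_distD m a r; lra. Qed.

Lemma centered_gram_entry (R : realType) (n p : nat) (Phi : 'M[R[i]]_(p, n)) i j :
  centered_gram Phi i j = (Num.sqrt (n%:R / p%:R : R))%:C *
    (n%:R^-1 * (\sum_l Phi i l * ((Phi j l)^*)%R) - (i == j)%:R).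
Proof.
rewrite /centered_gram !mxE; congr (_ * (_ * _ - _)).
by apply: eq_bigr => l _; rewrite !mxE.
Qed.

Section Concentration.
Variables (R : realType) (T : finType) (n p : nat) (x : T -> 'rV[R[i]]_n).
Hypotheses (T_gt0 : (0 < #|T|)%N) (p_gt0 : (0 < p)%N).

(** Counting below an abstract interval bound treats open, closed and infinite ends alike: the count
    in an interval is the difference of the values at its two bounds. *)
Definition count_below (A : 'M[R[i]]_p) (c : itv_bound R) : nat :=
  \sum_i (BRight (eigenvalue_at A i) <= c)%O.

Lemma count_below_interlacing (A A' : 'M[R[i]]_p) (k : 'I_p) (c : itv_bound R) :
  A^t* = A -> A'^t* = A' -> (forall i j, i != k -> j != k -> A i j = A' i j) ->
  (count_below A c <= (count_below A' c).+1)%N.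
Proof.
move=> Ah Ah' AA'.
have [U [d [Uu AE]]] := herm_spectral Ah.
have [U' [d' [Uu' AE']]] := herm_spectral Ah'.
pose L := [pred s : R | (BRight s <= c)%O].
have cE (B V : 'M[R[i]]_p) (e : 'I_p -> R) : B^t* = B -> V \is unitarymx ->
    B = V^t* *m diag_mx (\row_i (e i)%:C) *m V ->
    count_below B c = #|[set i | L (e i)]%SET|.
  move=> Bh Vu BE; rewrite /count_below.
  rewrite (sum_eigenvalue_at (fun s => (BRight s <= c)%O : nat) Bh).
  rewrite (sum_eigenvalues_spectral (fun s => (BRight s <= c)%O : nat) Vu BE).
  rewrite -sum1_card [RHS]big_mkcond; apply: eq_bigr => i _.
  by rewrite !inE; case: (_ <= _)%O.
rewrite (cE _ _ _ Ah Uu AE) (cE _ _ _ Ah' Uu' AE').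
apply: (interlacing Uu Uu' AE AE' AA') => s t /= sc; rewrite -ltNge => tc.
by have := le_lt_trans sc tc; rewrite bnd_simp.
Qed.

Local Notation M w := (centered_gram (data_mx x w)).

Lemma centered_gram_upd w (k : 'I_p) t i j : i != k -> j != k ->
  M (upd w k t) i j = M w i j.
Proof.
move=> ik jk; have e i' : i' != k -> data_mx x (upd w k t) i' =1 data_mx x w i'.
  by move=> ik' l; rewrite !mxE ffunE (negbTE ik').
apply: etrans (centered_gram_entry _ i j) (etrans _ (esym (centered_gram_entry _ i j))).
congr (_ * (_ * _ - _)); apply: eq_bigr => l _.
by rewrite (e i ik) (e j jk).
Qed.

Lemma count_below_upd w (k : 'I_p) t c :
  `|(count_below (M (upd w k t)) c)%:R - (count_below (M w) c)%:R| <= 1 :> R.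
Proof.
have h1 := @count_below_interlacing (M (upd w k t)) (M w) k c
  (centered_gram_herm _) (centered_gram_herm _) (@centered_gram_upd w k t).
have h2 := @count_below_interlacing (M w) (M (upd w k t)) k c
  (centered_gram_herm _) (centered_gram_herm _)
  (fun i j ik jk => esym (@centered_gram_upd w k t i j ik jk)).
exact: norm_natB_le1.
Qed.

Lemma spectral_count_below (l r : itv_bound R) w : (l <= r)%O ->
  spectral_count x (Interval l r) w =
  p%:R^-1 * ((count_below (M w) r)%:R - (count_below (M w) l)%:R).
Proof.
move=> lr; rewrite /spectral_count /mean card_ord mulrC; congr (_ * _).
rewrite /count_below !natr_sum -sumrB; apply: eq_bigr => i _.
rewrite itv_boundlr /=; move: (eigenvalue_at _ _) => s.
have [sl|ls] := leP (BRight s) l.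
  rewrite (le_trans sl lr) subrr; move: sl; rewrite leNgt ltBRight_leBLeft.
  by move/negbTE->.
by rewrite -ltBRight_leBLeft ls subr0.
Qed.

(** Interlacing moves the count below each of the two bounds by at most 1. Reversed bounds are
    separate: the interval is then empty and its count constant. *)
Lemma spectral_count_bounded_diff (I : interval R) :
  bounded_diff (fun w : {ffun 'I_p -> T} => (spectral_count x I w)%:C) (2 / p%:R).
Proof.
move=> w k t; rewrite -rmorphB cabs_real.
have pR : 0 < (p%:R : R) by rewrite ltr0n.
case: I => l r; have [lr|rl] := leP l r; last first.
  have e (w' : {ffun 'I_p -> T}) : spectral_count x (Interval l r) w' = 0.
    rewrite /spectral_count /mean big1 ?mul0r // => i _.
    rewrite itv_boundlr; case: andP => // -[h1 h2].
    have := lt_le_trans rl h1; rewrite ltNge.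
    by rewrite (le_trans _ h2) // ltW // ltBRight_leBLeft.
  by rewrite !e subrr normr0 divr_ge0.
rewrite !spectral_count_below // -mulrBr normrM ger0_norm ?invr_ge0 // mulrC.
rewrite ler_pM2r ?invr_gt0 //.
have h1 := count_below_upd w k t r; have h2 := count_below_upd w k t l.
exact: norm_sub_sub_le2 h1 h2.
Qed.

Lemma spectral_count_concentration (I : interval R) (t : R) : 0 < t <= 4 ->
  mean (fun w : {ffun 'I_p -> T} => ((t < `|spectral_count x I w - mean (@spectral_count R T n p x I)|)%R : nat)%:R) <=
    2 * expR (- (t ^+ 2 * p%:R / 32)).
Proof.
move=> /andP[t0 t4].
have pR : 0 < (p%:R : R) by rewrite ltr0n.
have c0 : 0 < 2 / p%:R :> R by rewrite divr_gt0.
have := mcdiarmid T_gt0 (I := 'I_p) _ c0 _ (spectral_count_bounded_diff I) (t := t).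
rewrite card_ord => /(_ p_gt0).
have -> : 2 * p%:R * (2 / p%:R) = 4 :> R by field; rewrite gt_eqF.
rewrite t0 t4 => /(_ isT) /le_trans; apply.
rewrite ler_pM2l // ler_expR lerN2 le_eqVlt; apply/orP; left; apply/eqP.
by field; rewrite gt_eqF.
Qed.

Hypotheses (n_gt0 : (0 < n)%N) (p_le_n : (p <= n)%N).
Hypotheses (xU : unimodular x) (xO : orthogonal_coords x) (x4 : iid_fourth_moments x).

Lemma spectral_deviation (h t : R) (I : interval R) : 0 < h <= 1 / 2 ->
  1332 / p%:R <= h ^+ 4 -> 1332 * Num.sqrt (p%:R / n%:R) <= h ^+ 4 -> 0 < t <= 4 ->
  exists2 rho : R, semicircle [set` I] = rho%:E &
  mean (fun w : {ffun 'I_p -> T} => ((2496 * h + t < `|spectral_count x I w - rho|)%R : nat)%:R) <=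
    2 * expR (- (t ^+ 2 * p%:R / 32)).
Proof.
move=> hh hp hk ht.
have [rho rhoE close] := expected_spectrum T_gt0 n_gt0 p_gt0 xU xO x4 p_le_n I hh hp hk.
exists rho => //; apply: le_trans (spectral_count_concentration I ht).
apply: ler_mean => w; rewrite ler_nat.
case: (ltP (_ + t)) => // dev.
by rewrite (lt_dist_triangle close dev).
Qed.

End Concentration.

(** * From independent to distinct codewords *)

Lemma sum_indicator (K : pzSemiRingType) (J : finType) (E : pred J) :
  \sum_j (E j : nat)%:R = #|[set j | E j]%SET|%:R :> K.
Proof.
rewrite -sum1_card natr_sum [RHS]big_mkcond; apply: eq_bigr => j _.
by rewrite inE; case: (E j).
Qed.

Section Transfer.
Variables (R : realType) (F : finFieldType) (n p : nat) (C : {vspace 'rV[F]_n}).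
Local Notation T := 'I_#|codewords C|.
Local Notation N := #|codewords C|.
Local Notation x := (@char_row R F n C).

Definition choice_of_ranks (w : {ffun 'I_p -> T}) : {ffun 'I_p -> 'rV[F]_n} :=
  [ffun i => codeword (w i)].

Lemma choice_of_ranks_inj : injective choice_of_ranks.
Proof.
move=> v w /ffunP e; apply/ffunP => i; apply: enum_val_inj.
by have := e i; rewrite !ffunE.
Qed.

Lemma codeword_choicesE :
  codeword_choices C p = (choice_of_ranks @: [set w : {ffun 'I_p -> T} | injectiveb w])%SET.
Proof.
have z0 : 0 \in codewords C by rewrite inE mem0v.
apply/setP => w; rewrite !inE; apply/andP/imsetP => [[/injectiveP wi /forallP wC]|[v]].
  have vE : w = choice_of_ranks [ffun i => enum_rank_in z0 (w i)].
    by apply/ffunP => i; rewrite !ffunE /codeword enum_rankK_in // inE wC.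
  exists [ffun i => enum_rank_in z0 (w i)] => //; rewrite inE.
  apply/injectiveP => i j e; apply: wi; rewrite vE.
  by move: e; rewrite !ffunE => ->.
rewrite inE => /injectiveP vi ->; split.
  by apply/injectiveP => i j; rewrite !ffunE => /enum_val_inj/vi.
by apply/forallP => i; rewrite ffunE; have := enum_valP (v i); rewrite inE.
Qed.

Lemma card_codeword_choices : #|codeword_choices C p| = (N ^_ p)%N.
Proof.
rewrite codeword_choicesE card_imset; last exact: choice_of_ranks_inj.
by rewrite card_inj_ffuns !card_ord.
Qed.

(** The birthday bound: [k] independent draws from [m] values are distinct with probability at least
    [1 - k^2 / m], here multiplied through by [m^(k+1)]. *)
Lemma ffact_lower (m k : nat) : (k <= m)%N ->
  (m%:R ^+ k * (m%:R - k%:R ^+ 2) <= m%:R * (m ^_ k)%:R :> R).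
Proof.
elim: k => [|k IH] km; first by rewrite expr0 mul1r ffactn0 mulr1 expr0n subr0.
rewrite ffactnSr natrM natrB 1?ltnW // mulrA.
have h : 0 <= (m%:R - k%:R : R) by rewrite subr_ge0 ler_nat ltnW.
apply: le_trans (ler_wpM2r h (IH (ltnW km))).
rewrite exprS [m%:R * _]mulrC -!mulrA ler_wpM2l ?exprn_ge0 //.
rewrite -natr1 -subr_ge0.
rewrite (_ : _ - _ = m%:R * (k%:R + 1) + k%:R ^+ 3); last by ring.
by rewrite addr_ge0 ?mulr_ge0 ?addr_ge0 ?exprn_ge0.
Qed.

(** The choice of distinct codewords is the independent one conditioned on injectivity, and
    conditioning on an event of probability at least 1/2 at most doubles probabilities. *)
Lemma Pr_choice_le (E : pred {ffun 'I_p -> 'rV[F]_n}) : (2 * p ^ 2 <= N)%N ->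
  Pr_choice R C E <=
  2 * mean (fun w : {ffun 'I_p -> T} => (E (choice_of_ranks w) : nat)%:R).
Proof.
move=> pN; have N0 : (0 < N)%N by have := card_codewords_gt0 C; rewrite card_ord.
have NR : 0 < (N%:R : R) by rewrite ltr0n.
have pN' : (p <= N)%N.
  have [->//|p0] := posnP p; apply: leq_trans pN.
  by rewrite -mulnn mulnA leq_pmull // muln_gt0.
have NP : (0 < N ^_ p)%N by rewrite ffact_gt0.
rewrite /Pr_choice card_codeword_choices ler_pdivrMr ?ltr0n //.
rewrite /mean.
pose S := [set w : {ffun 'I_p -> T} | E (choice_of_ranks w)]%SET.
have -> : \sum_w (E (choice_of_ranks w) : nat)%:R = #|S|%:R :> R.
  exact: sum_indicator.
have h1 : (#|[set w in codeword_choices C p | E w]%SET| <= #|S|)%N.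
  apply: leq_trans (leq_imset_card choice_of_ranks S); apply: subset_leq_card.
  apply/fintype.subsetP => w; rewrite inE codeword_choicesE => /andP[/imsetP[v _ ->] Ev].
  by apply: imset_f; rewrite inE.
have h2 : (N%:R ^+ p <= 2 * (N ^_ p)%:R :> R).
  have := ffact_lower pN'.
  have : (2 * p%:R ^+ 2 <= N%:R :> R) by rewrite -natrX -natrM ler_nat.
  move=> k1 k2; rewrite -(ler_pM2r NR).
  have : N%:R ^+ p * (N%:R / 2) <= N%:R ^+ p * (N%:R - p%:R ^+ 2 : R).
    by rewrite ler_wpM2l ?exprn_ge0 //; lra.
  by lra.
rewrite card_ffun !card_ord natrX.
apply: le_trans (_ : #|S|%:R <= _); first by rewrite ler_nat.
rewrite (_ : 2 * _ * _ = #|S|%:R * (2 * (N ^_ p)%:R / N%:R ^+ p)); last by ring.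
by rewrite ler_peMr // ler_pdivlMr ?exprn_gt0 // mul1r.
Qed.

Hypothesis C5 : dual_distance_ge C 5.

(* The variance bound applied to the projection on a fixed row of the matrix. *)
Lemma card_codewords_ge : (0 < n)%N -> (n%:R - 1) ^+ 2 <= 2 * N%:R :> R.
Proof.
move=> n0; have T0 := card_codewords_gt0 C.
have N0 : (0 < N)%N by have := T0; rewrite card_ord.
pose t0 : T := Ordinal N0.
have xU : unimodular x := @char_row_unimodular R F n C.
(* [A] has trace [n] and squared Frobenius norm [n^2], while its quadratic form at [t0] is [n^2].
   Keeping only [t0] in the average leaves [n^2 * (n - 1)^2 / N <= 2 * n^2]. *)
pose A := (x t0)^t* *m x t0.
pose q := x t0 *m (x t0)^t*.
have qE : q = (n%:R)%:M.
  rewrite [LHS]mx11_scalar mulmx_adj_diag.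
  under eq_bigr => j _ do rewrite (cabs_unimodular xU) expr1n.
  by rewrite sumr_const card_ord rmorph_nat.
have trA : \tr A = n%:R by rewrite mxtrace_mulC -/q qE mxtrace_scalar.
have quadA : quad x A t0 = n%:R * n%:R.
  by rewrite /quad /A !mulmxA -/q -mulmxA -/q qE -scalar_mxM mxE eqxx.
have froA : fro2 A = n%:R ^+ 2.
  apply: complexI; rewrite -trace_mulmx_adj /A adjmxM trmxCK !mulmxA mxtrace_mulC !mulmxA -/q.
  by rewrite -mulmxA -/q qE -scalar_mxM mxtrace_scalar mulr1n -expr2 rmorphXn /= rmorph_nat.
have := variance_quad T0 xU (@char_row_fourth_moments R F n C C5) A.
rewrite trA froA => V.
have h : cabs (quad x A t0 - n%:R) ^+ 2 / N%:R <= 2 * n%:R ^+ 2.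
  apply: le_trans V; rewrite /mean card_ord ler_wpM2r ?invr_ge0 //.
  by rewrite (bigD1 t0) //= lerDl; apply: sumr_ge0 => t _; rewrite sqr_ge0.
have e : cabs (quad x A t0 - n%:R) = n%:R * (n%:R - 1).
  rewrite quadA (_ : _ - _ = (n%:R * (n%:R - 1))%:C); last first.
    by rewrite rmorphM rmorphB rmorph_nat rmorph1; ring.
  by rewrite cabs_real ger0_norm // mulr_ge0 // subr_ge0 ler1n.
move: h; rewrite e exprMn ler_pdivrMr ?ltr0n //.
have n2 : 0 < (n%:R : R) ^+ 2 by rewrite exprn_gt0 ?ltr0n.
rewrite (_ : 2 * _ * _ = n%:R ^+ 2 * (2 * N%:R)); last by ring.
by rewrite ler_pM2l.
Qed.

Lemma Phi_mx_choice (w : {ffun 'I_p -> T}) :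
  M_mx R (choice_of_ranks w) = centered_gram (data_mx x w).
Proof.
suff e : Phi_mx R (choice_of_ranks w) = data_mx x w by rewrite /M_mx /Gram_mx e.
by apply/matrixP => i j; rewrite !mxE ffunE.
Qed.

Lemma spectral_measure_count (w : {ffun 'I_p -> T}) (I : interval R) :
  spectral_measure (M_mx R (choice_of_ranks w)) [set` I] = (spectral_count x I w)%:E.
Proof.
rewrite Phi_mx_choice /spectral_measure /spectral_count /mean card_ord.
rewrite (sum_eigenvalue_at (fun s => (s \in I : nat)%:R) (centered_gram_herm _)).
rewrite mulrC EFinM; congr (_ * _)%E.
rewrite -sumEFin; apply: eq_bigr => z _.
by rewrite diracE mem_setE.
Qed.

Lemma code_deviation (h t s : R) (I : interval R) : (0 < p)%N ->
  2 * p%:R <= n%:R - 1 :> R -> 0 < h <= 1 / 2 ->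
  1332 / p%:R <= h ^+ 4 -> 1332 * Num.sqrt (p%:R / n%:R) <= h ^+ 4 -> 0 < t <= 4 ->
  2496 * h + t <= s ->
  Pr_choice R C (fun w : {ffun 'I_p -> 'rV[F]_n} =>
    (s%:E < `| spectral_measure (M_mx R w) [set` I] - semicircle [set` I] |)%E)
  <= 4 * expR (- (t ^+ 2 * p%:R / 32)).
Proof.
move=> p0 pn hh hp hk ht hs.
have pR : 1 <= (p%:R : R) by rewrite ler1n.
have pn' : (p <= n)%N by rewrite -(ler_nat R); lra.
have n0 : (0 < n)%N by exact: leq_trans pn'.
(* [2 * p <= n - 1] gives [4 * p^2 <= (n - 1)^2], which [card_codewords_ge] bounds by [2 * N]. *)
have pN : (2 * p ^ 2 <= N)%N.
  rewrite -(ler_nat R) natrM natrX -(ler_pM2l (ltr0Sn R 1)).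
  apply: le_trans (card_codewords_ge n0).
  rewrite (_ : 2 * _ = (2 * p%:R) ^+ 2); last by ring.
  by rewrite lerXn2r ?nnegrE ?mulr_ge0 //; lra.
have T0 := card_codewords_gt0 C.
have [rho rhoE dev] := spectral_deviation T0 p0 n0 pn' (@char_row_unimodular R F n C)
  (@char_row_orthogonal R F n C C5) (@char_row_fourth_moments R F n C C5) I hh hp hk ht.
apply: le_trans (Pr_choice_le _ pN) _.
rewrite (_ : 4 * _ = 2 * (2 * expR (- (t ^+ 2 * p%:R / 32)))); last by ring.
rewrite ler_pM2l //; apply: le_trans dev; apply: ler_mean => w.
rewrite spectral_measure_count rhoE -EFinB abse_EFin lte_fin ler_nat.
case: (ltP s) => // sw; case: ltP => // sw2.
by have := lt_le_trans sw sw2; rewrite ltNge hs.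
Qed.

End Transfer.

(** * Choice of the parameters *)

Lemma powR_large (R : realType) (a Y : R) : 0 < a ->
  exists N : nat, forall n : nat, (N <= n)%N -> Y <= n%:R `^ a.
Proof.
move=> a0; pose Z := `|Y| `^ a^-1; exists (Num.bound Z) => n Nn.
have Zn : Z <= n%:R.
  by apply: ltW; apply: lt_le_trans (archi_boundP (powR_ge0 _ _)) _; rewrite ler_nat.
apply: le_trans (ler_norm Y) _.
have -> : `|Y| = Z `^ a by rewrite /Z -powRrM mulVf ?gt_eqF // powRr1.
by apply: ge0_ler_powR => //; rewrite ?nnegrE ?powR_ge0 // ltW.
Qed.

Section ParameterChoice.
Variables (R : realType) (g1 g2 c beta eps D : R).
Hypotheses (c_ge1 : 1 <= c) (beta_gt0 : 0 < beta) (eps_gt0 : 0 < eps) (D_gt0 : 0 < D).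
Hypotheses (beta_g1 : 4 * beta <= g1) (beta_g2 : 8 * beta <= 1 - g2).

(** Shrinking [eps] to at most [beta] keeps the exponents of [h] and [t] negative or zero; the
    target exponent increases with [eps], so nothing is lost. *)
Let e := Num.min eps beta.
Let e_gt0 : 0 < e. Proof. by rewrite lt_min eps_gt0. Qed.
Let e_eps : e <= eps. Proof. by rewrite ge_min lexx. Qed.
Let e_beta : e <= beta. Proof. by rewrite ge_min lexx orbT. Qed.

(** One threshold for all constants to be absorbed by the power [e / 2] of the dimension:
    [4992 = 2 * 2496] for [choice_sum], [1332 * c] for the fourth power of [h], the last summand for
    [choice_tail]. *)
Let Y := 4992 + 1332 * c + 128 * c * (2 + D / e).

Section FixedDimension.
Variables (v p : R).
Hypotheses (v_ge2 : 2 <= v) (Y_le : Y <= v `^ (e / 2)).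
Hypotheses (p_lower : c^-1 * v `^ g1 <= p) (p_upper : p <= c * v `^ g2).

Let v_ge1 : 1 <= v. Proof. by apply: le_trans v_ge2; rewrite ler1n. Qed.
Let v_gt0 : 0 < v. Proof. by apply: lt_le_trans v_ge2. Qed.
Let v_neq0 : v != 0. Proof. by rewrite gt_eqF. Qed.
Let c_gt0 : 0 < c. Proof. by apply: lt_le_trans c_ge1. Qed.
Let Pgt0 a : 0 < v `^ a. Proof. exact: powR_gt0. Qed.
Let PD a b : v `^ (a + b) = v `^ a * v `^ b. Proof. by rewrite powRD // v_neq0 implybT. Qed.
Let Ple a b : a <= b -> v `^ a <= v `^ b. Proof. exact: ler_powR. Qed.
Let De_ge0 : 0 <= 128 * c * (2 + D / e).
Proof. by rewrite mulr_ge0 ?mulr_ge0 ?addr_ge0 ?divr_ge0 // ltW. Qed.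

Let P_big b a : b <= Y -> e / 2 <= a -> b <= v `^ a.
Proof. by move=> bY ea; apply: le_trans bY _; apply: le_trans Y_le _; exact: Ple. Qed.

Let p_gt0 : 0 < p.
Proof. by apply: lt_le_trans p_lower; rewrite mulr_gt0 ?invr_gt0. Qed.

(** The width [h] spends only half of the slack [e]; the other half absorbs the factor 2496, while
    [t] takes half of the total deviation. *)
Let h := v `^ (- beta + e / 2).
Let t := v `^ (- beta + e) / 2.

Lemma choice_h : 0 < h <= 1 / 2.
Proof.
rewrite Pgt0 /=; apply: (@le_trans _ _ (v `^ (- (e / 2)))).
  by apply: Ple; move: e_beta; lra.
rewrite powRN div1r lef_pV2 ?posrE ?ltr0n //; apply: P_big => //.
by rewrite /Y; move: De_ge0 c_ge1; lra.
Qed.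

Let h4 : h ^+ 4 = v `^ (2 * e) * v `^ (- (4 * beta)).
Proof.
rewrite -powR_mulrn ?powR_ge0 // /h -powRrM -PD; congr (_ `^ _).
by field.
Qed.

Let h4_ge : 1332 * c * v `^ (- (4 * beta)) <= h ^+ 4.
Proof.
rewrite h4 ler_pM2r ?Pgt0 //; apply: P_big; last by move: e_gt0; lra.
by rewrite /Y; move: De_ge0 c_ge1; lra.
Qed.

Lemma choice_p : 1332 / p <= h ^+ 4.
Proof.
apply: le_trans h4_ge; rewrite -mulrA ler_pM2l ?ltr0n //.
rewrite -[leRHS]invrK lef_pV2 ?posrE ?invr_gt0 ?mulr_gt0 //.
rewrite invfM -powRN opprK; apply: le_trans p_lower.
by rewrite ler_pM2l ?invr_gt0 // Ple.
Qed.

Lemma choice_kappa : 1332 * Num.sqrt (p / v) <= h ^+ 4.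
Proof.
apply: le_trans h4_ge; rewrite -mulrA ler_pM2l ?ltr0n //.
(* [c <= c ^+ 2] since [c >= 1], and [8 * beta <= 1 - g2] matches the powers of [v]; the square root
   halves [8 * beta] to the exponent in [h4_ge]. *)
have le1 : p / v <= (c * v `^ (- (4 * beta))) ^+ 2.
  rewrite ler_pdivrMr //; apply: le_trans p_upper _.
  rewrite exprMn -mulrA; apply: ler_pM; rewrite ?powR_ge0 //.
  - by rewrite ltW.
  - by rewrite expr2 ler_peMl // ltW.
  rewrite -powR_mulrn ?powR_ge0 // -powRrM -[X in _ * X](powRr1 (ltW v_gt0)) -PD.
  by apply: Ple; move: beta_g2; lra.
apply: le_trans (ler_wsqrtr le1) _.
by rewrite sqrtr_sqr ger0_norm // mulr_ge0 ?powR_ge0 // ltW.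
Qed.

Lemma choice_t : 0 < t <= 4.
Proof.
rewrite divr_gt0 ?Pgt0 //=.
have : v `^ (- beta + e) <= v `^ 0 by apply: Ple; move: e_beta; lra.
by rewrite powRr0 /t; lra.
Qed.

Lemma choice_sum : 2496 * h + t <= v `^ (- beta + eps).
Proof.
apply: (@le_trans _ _ (v `^ (- beta + e))); last by apply: Ple; rewrite lerD2l.
have E : v `^ (- beta + e) = v `^ (e / 2) * h.
  by rewrite /h -PD; congr (_ `^ _); field.
have : 4992 * h <= v `^ (e / 2) * h.
  rewrite ler_pM2r ?Pgt0 //; apply: P_big => //.
  by rewrite /Y; move: De_ge0 c_ge1; lra.
by rewrite -E /t; lra.
Qed.

Lemma choice_dimension : 2 * p <= v - 1.
Proof.
have E : v = v `^ g2 * v `^ (1 - g2).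
  by rewrite -PD addrC subrK powRr1 // ltW.
(* This yields [4 * p <= v], and [v >= 2] gives [v / 2 <= v - 1]. *)
have : v `^ g2 * (4 * c) <= v `^ g2 * v `^ (1 - g2).
  rewrite ler_pM2l ?Pgt0 //; apply: P_big; first by rewrite /Y; move: De_ge0 c_ge1; lra.
  by move: e_beta beta_g2 beta_gt0; lra.
rewrite -E; move: p_upper v_ge2; move: (v `^ g2) => q.
by lra.
Qed.

(** With [X] the power [e] of [v], the bound [g1 >= 2 * beta] makes [t ^+ 2 * p] at least
    [X ^+ 2 / (4 * c)]. One factor [X] dominates [128 * c * (2 + D / e)], where [128 = 4 * 32]; the
    other dominates [e * ln v]. The 2 pays for [4 <= expR 2]. *)
Lemma choice_tail : 4 * expR (- (t ^+ 2 * p / 32)) <= v `^ (- D).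
Proof.
have e1 : 4 <= expR 2 :> R.
  have := expR_ge1Dx (1 : R); rewrite (_ : 2 = 1 + 1 :> R) // expRD => h1.
  apply: (@le_trans _ _ ((1 + 1) * (1 + 1))); first by lra.
  by rewrite ler_pM //; lra.
apply: (@le_trans _ _ (expR 2 * expR (- (t ^+ 2 * p / 32)))).
  by rewrite ler_pM2r ?expR_gt0.
rewrite -expRD /powR (negbTE v_neq0) ler_expR.
pose X := v `^ e.
have X1 : 128 * c * (2 + D / e) <= X.
  by apply: P_big; rewrite /Y; [move: c_ge1|move: e_gt0]; lra.
have X_ge1 : 1 <= X by rewrite -[leLHS](powRr0 v); apply: Ple; exact: ltW.
have lnX : e * ln v <= X.
  rewrite /X /powR (negbTE v_neq0); apply: le_trans (expR_ge1Dx _).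
  by rewrite lerDr.
have lnv : D * ln v <= D / e * X.
  rewrite -mulrA ler_pM2l // -(ler_pM2l e_gt0) mulrA mulfV ?gt_eqF // mul1r.
  exact: lnX.
have tp : X ^+ 2 <= 4 * c * (t ^+ 2 * p).
  have -> : 4 * c * (t ^+ 2 * p) = (v `^ (- beta + e)) ^+ 2 * (c * p).
    by rewrite /t; field.
  have q1 : v `^ g1 <= c * p.
    by rewrite -ler_pdivrMl.
  apply: (@le_trans _ _ ((v `^ (- beta + e)) ^+ 2 * v `^ g1)); last first.
    by rewrite ler_wpM2l ?sqr_ge0.
  rewrite /X -!powR_mulrn ?powR_ge0 // -!powRrM -PD.
  by apply: Ple; move: beta_g1 beta_gt0; lra.
have q2 : 128 * c * ((2 + D / e) * X) <= X ^+ 2.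
  by rewrite mulrA expr2 ler_wpM2r // powR_ge0.
have q3 : 128 * c * ((2 + D / e) * X) <= 128 * c * (t ^+ 2 * p / 32).
  by apply: le_trans q2 (le_trans tp _); rewrite le_eqVlt; apply/orP; left; apply/eqP; field.
have q4 : (2 + D / e) * X <= t ^+ 2 * p / 32.
  by move: q3; rewrite ler_pM2l // mulr_gt0.
rewrite mulNr.
move: q4 lnv X_ge1; move: (D / e) (D * ln v) (t ^+ 2 * p / 32) => a b d.
by lra.
Qed.

End FixedDimension.

Lemma parameter_choice : exists N : nat, forall n : nat, (N <= n)%N -> forall p : R,
  c^-1 * n%:R `^ g1 <= p <= c * n%:R `^ g2 ->
  exists h t : R,
    [/\ 2 * p <= n%:R - 1, 0 < h <= 1 / 2, 1332 / p <= h ^+ 4,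
        1332 * Num.sqrt (p / n%:R) <= h ^+ 4 & 0 < t <= 4] /\
    2496 * h + t <= n%:R `^ (- beta + eps) /\
    4 * expR (- (t ^+ 2 * p / 32)) <= n%:R `^ (- D).
Proof.
have e2 : 0 < e / 2 by rewrite divr_gt0.
have [N NP] := powR_large Y e2; exists (maxn N 2) => n; rewrite geq_max => /andP[Nn n2] p.
move=> /andP[pl pu].
have v2 : 2 <= n%:R :> R by rewrite ler_nat.
have Yn := NP n Nn.
exists (n%:R `^ (- beta + e / 2)), (n%:R `^ (- beta + e) / 2); split; first split.
- exact: choice_dimension Yn pu.
- exact: choice_h Yn.
- exact: choice_p Yn pl.
- exact: choice_kappa Yn pu.
- exact: choice_t v2.
split; [exact: choice_sum Yn|exact: choice_tail Yn pl].
Qed.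

End ParameterChoice.

Theorem theorem2 (R : realType) (gamma1 gamma2 c : R)
    (hgamma1 : 0 < gamma1 < 1) (hgamma2 : 0 < gamma2 < 1) (hc : 1 <= c) :
  let beta : R := Num.min (gamma1 / 4) ((1 - gamma2) / 8) in
  0 < beta /\
  forall eps D : R, 0 < eps -> 0 < D ->
  exists N : nat, forall n : nat, (N <= n)%N ->
  forall (F : finFieldType) (k : nat) (C : {vspace 'rV[F]_n}) (p : nat),
    \dim C = k -> dual_distance_ge C 5 -> (0 < p)%N ->
    c^-1 * n%:R `^ gamma1 <= p%:R <= c * n%:R `^ gamma2 ->
    (ereal_sup [set (Pr_choice R C (fun w : {ffun 'I_p -> 'rV[F]_n} =>
                   ((n%:R `^ (- beta + eps))%:E <
                    `| spectral_measure (M_mx R w) [set` I]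
                       - semicircle [set` I] |)%E))%:E
               | I in [set: interval R]]
     <= (n%:R `^ (- D))%:E)%E.
Proof.
move=> beta.
have b0 : 0 < beta.
  have /andP[? ?] := hgamma1; have /andP[? ?] := hgamma2.
  by rewrite lt_min; apply/andP; split; lra.
have b1 : 4 * beta <= gamma1.
  have : beta <= gamma1 / 4 by rewrite ge_min lexx.
  by lra.
have b2 : 8 * beta <= 1 - gamma2.
  have : beta <= (1 - gamma2) / 8 by rewrite ge_min lexx orbT.
  by lra.
split=> // eps D eps0 D0.
have [N NP] := parameter_choice hc b0 eps0 D0 b1 b2.
exists N => n Nn F k C p _ C5 p0 pb.
have [h [t [[pn hh hp hk ht] [hs tail]]]] := NP n Nn p%:R pb.
apply: ge_ereal_sup => _ [I _ <-]; rewrite lee_fin.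
exact: le_trans (code_deviation C5 I p0 pn hh hp hk ht hs) tail.
Qed.
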